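(* For any $1\le s\le n$, there exists an algorithm for wildcard pattern matching in the non-streaming setting that runs in time $\tilde O(n^2/s)$ and uses space $O(s)$, where $n$ is the length of the text.
   Context: Wildcard pattern matching: given a text $T$ of length $n$ over an alphabet $\Sigma$ and a pattern $P$ (of length at most $n$) over $\Sigma\cup\{?\}$, decide whether there is a position at which $P$ matches a contiguous substring of $T$ of length $|P|$ (and report such a position if one exists), where '?' in $P$ matches any character of $T$ and every other character of $P$ must equal the corresponding character of $T$. In the non-streaming (random access) setting, both $T$ and $P$ are fixed and every character of each can be accessed by its index; space counts the working memory beyond this read-only access. $\tilde O$ hides polylogarithmic factors. *)

(* Defs.v *)
(* A word-RAM model with read-only random access
   to the text T and pattern P, unit-cost instructions, and a working memory
   of registers indexed by nat; space = number of working cells (addresses). *)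
From mathcomp Require Import all_boot.
Set Implicit Arguments. Unset Strict Implicit. Unset Printing Implicit Defensive.

(* Characters of Sigma are encoded as nats; a pattern symbol is [Some c] for
   a character c and [None] for the wildcard '?'. *)
Definition wmatch_at (T : seq nat) (P : seq (option nat)) (i : nat) : Prop :=
  i + size P <= size T /\
  forall j, j < size P ->
    match nth None P j with
    | Some c => nth 0 T (i + j) = c
    | None => True
    end.

Inductive instr : Type :=
| IConst  (d v : nat)
| IAdd    (d a b : nat)
| ISub    (d a b : nat)          (* r[d] := r[a] - r[b] (truncated) *)
| IMul    (d a b : nat)
| IDiv    (d a b : nat)
| IMod    (d a b : nat)
| ILt     (d a b : nat)
| IEq     (d a b : nat)
| ILoad   (d a : nat)
| IStore  (a b : nat)
| IReadT  (d a : nat)            (* r[d] := T[r[a]] (0 if out of range) *)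
| IReadP  (d a : nat)            (* r[d] := character P[r[a]] (0 if '?' or out of range) *)
| IIsWild (d a : nat)
| IJz     (a l : nat)
| IJmp    (l : nat)
| IHalt.

Record config : Type := Config { pc : nat; mem : nat -> nat }.

Definition upd (m : nat -> nat) (d v : nat) : nat -> nat :=
  fun x => if x == d then v else m x.

Definition fetch (prog : seq instr) (p : nat) : instr := nth IHalt prog p.

Definition halted (prog : seq instr) (c : config) : bool :=
  if fetch prog (pc c) is IHalt then true else false.

Definition step (w : nat) (T : seq nat) (P : seq (option nat))
    (prog : seq instr) (c : config) : config :=
  let m := mem c in
  let nx := (pc c).+1 in
  let B := 2 ^ w in
  match fetch prog (pc c) with
  | IConst d v => Config nx (upd m d (v %% B))
  | IAdd d a b => Config nx (upd m d ((m a + m b) %% B))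
  | ISub d a b => Config nx (upd m d (m a - m b))
  | IMul d a b => Config nx (upd m d ((m a * m b) %% B))
  | IDiv d a b => Config nx (upd m d (m a %/ m b))
  | IMod d a b => Config nx (upd m d (m a %% m b))
  | ILt d a b => Config nx (upd m d (m a < m b))
  | IEq d a b => Config nx (upd m d (m a == m b))
  | ILoad d a => Config nx (upd m d (m (m a)))
  | IStore a b => Config nx (upd m (m a) (m b))
  | IReadT d a => Config nx (upd m d (nth 0 T (m a)))
  | IReadP d a => Config nx (upd m d (if nth None P (m a) is Some ch then ch else 0))
  | IIsWild d a => Config nx (upd m d ((m a < size P) && (nth None P (m a) == None)))
  | IJz a l => Config (if m a == 0 then l else nx) m
  | IJmp l => Config l m
  | IHalt => c
  end.

Definition accessed (prog : seq instr) (c : config) : seq nat :=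
  let m := mem c in
  match fetch prog (pc c) with
  | IConst d _ => [:: d]
  | IAdd d a b | ISub d a b | IMul d a b | IDiv d a b | IMod d a b
  | ILt d a b | IEq d a b => [:: d; a; b]
  | ILoad d a => [:: d; a; m a]
  | IStore a b => [:: a; b; m a]
  | IReadT d a | IReadP d a | IIsWild d a => [:: d; a]
  | IJz a _ => [:: a]
  | IJmp _ | IHalt => [::]
  end.

Definition run (w : nat) (T : seq nat) (P : seq (option nat))
    (prog : seq instr) (t : nat) (c : config) : config :=
  iter t (step w T P prog) c.

Definition init_config (s : nat) (T : seq nat) (P : seq (option nat)) : config :=
  Config 0 (fun x => if x == 0 then s else if x == 1 then size T
                     else if x == 2 then size P else 0).

(* Output convention (in r[0] on halting): 0 = no occurrence,
   i.+1 = an occurrence at position i. *)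
Definition correct_output (T : seq nat) (P : seq (option nat)) (o : nat) : Prop :=
  (o = 0 /\ forall i, ~ wmatch_at T P i) \/
  (exists i, o = i.+1 /\ wmatch_at T P i).

Definition solves_within (prog : seq instr) (w s : nat)
    (T : seq nat) (P : seq (option nat)) (t S : nat) : Prop :=
  let c0 := init_config s T P in
  halted prog (run w T P prog t c0) /\
  (forall t', t' < t -> ~~ halted prog (run w T P prog t' c0)) /\
  (forall t', t' < t -> all (fun a => a < S) (accessed prog (run w T P prog t' c0))) /\
  correct_output T P (mem (run w T P prog t c0) 0).

(* Main.v *)
(** Cut the candidate positions and the pattern into blocks of [N] symbols, where
    [N] is about [s / log n], so that a pair of blocks must be handled in
    [N * polylog n] time and [O(N log n)] space.

    For one pair of blocks, replace the characters by small integers: ranks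
    obtained by repeatedly extracting the minimum of a tournament tree.  With
    [v_j] marking the non-wildcards, the pattern block matches at offset [i] iff
    [\sum_j v_j (p_j - t_(i+j))^2 = 0].  These [N] sums are coefficients of a single
    product of polynomials modulo [X^(8N) + 1], the text being read as the sequence
    of the [(t^2, t, 1, 0)] and the pattern as that of the [(v, -2vp, vp^2, 0)].

    No root of unity of large order is known to exist modulo a number of polynomial
    size, so the product is computed with shifts only (Nussbaumer): an element of
    [(Z/M)[z] / (z^(2^r) + 1)] is a polynomial of degree less than [2^a] in [x = z]
    over [(Z/M)[y] / (y^(2^(r-a)) + 1)], [y = z^(2^a)], and for [a <= r / 2] powers
    of [y] provide the Fourier transform of length [2^(a+1)] in [x].  This halves
    the exponent [r] and doubles the number of cells; it is iterated breadth first
    until [r = 1], which multiplies the length by [O(log N)] only.  Correctness is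
    expressed by evaluating arrays at an element [y] of an arbitrary commutative
    ring with [M = 0] and [y^R = -1]; the quotient ring itself appears only at the
    end, to read off coefficients. *)

Require Import Defs.
From mathcomp Require Import all_boot all_order all_algebra.
From mathcomp Require Import zify ring.
Set Implicit Arguments. Unset Strict Implicit. Unset Printing Implicit Defensive.

(** * A structured language compiled to the RAM *)

Arguments fetch : simpl never.

(** Two obstacles shape the constants. Characters may be as large as a word, so their squares would
    overflow; ranks within a pair of blocks are at most [4N] and preserve equality, which is all
    that matching needs. The inverse transforms cannot be divided by their lengths, as 2 is not
    invertible modulo the even [M]; the product therefore comes out multiplied by a power of two.
    The modulus [M = 512 (n+1)^4] exceeds this power times the largest possible sum, so the residue
    is zero exactly when the sum is, and words of O(log n) bits still suffice. [N] offsets against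
    [N] pattern symbols meet [2N] text symbols, hence [8N] text coefficients against [4N] pattern
    ones: wraparound modulo [X^(8N) + 1] pollutes only coefficients below [4N - 1], which is the
    lowest one read. There are about [(n/N)^2] pairs, each bounded crudely by log n levels of log n
    passes over [O(N log n)] cells; time multiplied by [s] is then [n^2] times the fourth power of
    the logarithm. *)

Inductive bop := OAdd | OSub | OMul | ODiv | OMod | OLt | OEq.

Inductive expr :=
| EC (c : nat)
| EV (x : nat)
| EArr (q : nat) (e : expr)
| EBin (o : bop) (a b : expr)
| ERdT (e : expr)
| ERdP (e : expr)
| EWild (e : expr).

(** There is no conditional: choices are computed arithmetically from 0/1 values, which leaves the
    loop as the only construct with jumps. *)
Inductive stmt :=
| SAsg (x : nat) (e : expr)
| SSet (q : nat) (i e : expr)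
| SSeq (s1 s2 : stmt)
| SWhile (e : expr) (s : stmt).

(* Variable [x < NV] is register [x], registers [NV .. HB - 1] are temporaries, and cell
   [i] of array [q < NQ] is at address [HB + NQ * i + q]: the arrays are interleaved, so
   that each of them can grow without bound. *)
Definition NV := 40.
Definition HB := 64.
Definition NQ := 8.

Record state := St { vr : nat -> nat; ar : nat -> nat -> nat }.

Definition setv (st : state) x v := St (upd (vr st) x v) (ar st).
Definition seta (st : state) q i v :=
  St (vr st) (fun q' i' => if (q' == q) && (i' == i) then v else ar st q' i').

Definition iop o := match o with
  | OAdd => IAdd | OSub => ISub | OMul => IMul | ODiv => IDiv | OMod => IMod
  | OLt => ILt | OEq => IEq end.

Definition evop o (a b : nat) : nat := match o with
  | OAdd => a + b | OSub => a - b | OMul => a * b | ODiv => a %/ b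
  | OMod => a %% b | OLt => a < b | OEq => a == b end.

Definition caddr d q :=
  [:: IConst d.+1 NQ; IMul d d d.+1; IConst d.+1 (HB + q); IAdd d d d.+1].

Fact caddr_key : unit. Proof. exact: tt. Qed.
(** Matching on an opaque proof of [unit] keeps simplification from expanding the four instructions,
    so the address computation stays one block when code is split. *)
Definition kcaddr d q := let: tt := caddr_key in caddr d q.
Lemma kcaddrE d q : kcaddr d q = caddr d q.
Proof. by rewrite /kcaddr; case: caddr_key. Qed.
Lemma size_kcaddr d q : size (kcaddr d q) = 4.
Proof. by rewrite kcaddrE. Qed.

(** Registers from [d] upward form an evaluation stack, and the value ends in [d]. A variable is
    copied by subtracting 0: the machine has no move and, unlike addition, subtraction is never
    reduced modulo the word. *)
Fixpoint cexpr d e := match e with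
  | EC c => [:: IConst d c]
  | EV x => [:: IConst d 0; ISub d x d]
  | EArr q e => cexpr d e ++ kcaddr d q ++ [:: ILoad d d]
  | EBin o a b => cexpr d a ++ cexpr d.+1 b ++ [:: iop o d d d.+1]
  | ERdT e => cexpr d e ++ [:: IReadT d d]
  | ERdP e => cexpr d e ++ [:: IReadP d d]
  | EWild e => cexpr d e ++ [:: IIsWild d d]
  end.

Fixpoint csize s := match s with
  | SAsg x e => (size (cexpr NV e)).+2
  | SSet q i e => size (cexpr NV i) + 4 + (size (cexpr NV.+1 e)).+1
  | SSeq s1 s2 => csize s1 + csize s2
  | SWhile e s => (size (cexpr NV e)).+2 + csize s
  end.

(** Jump targets are absolute, hence the start address [p]; [csize] does not depend on it, so the
    exit of a loop is known before its body is placed. *)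
Fixpoint cstmt p s := match s with
  | SAsg x e => cexpr NV e ++ [:: IConst x 0; ISub x NV x]
  | SSet q i e => cexpr NV i ++ kcaddr NV q ++ cexpr NV.+1 e ++ [:: IStore NV NV.+1]
  | SSeq s1 s2 => cstmt p s1 ++ cstmt (p + csize s1) s2
  | SWhile e s =>
      let l := p + size (cexpr NV e) in
      cexpr NV e ++ IJz NV (l + csize s).+2 :: cstmt l.+1 s ++ [:: IJmp p]
  end.

(** Constants stay below [HB] because [HB + NQ * Sz <= 2 ^ w] is all that the compiler proof knows
    of the word size; [d.+1] is the scratch register of the address computation. *)
Fixpoint wfe d e : bool := match e with
  | EC c => (d.+1 < HB) && (c < HB)
  | EV x => (d.+1 < HB) && (x < NV)
  | EArr q e => (q < NQ) && wfe d e
  | EBin o a b => wfe d a && wfe d.+1 b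
  | ERdT e | ERdP e | EWild e => wfe d e
  end.

Fixpoint wfs s : bool := match s with
  | SAsg x e => (x < NV) && wfe NV e
  | SSet q i e => [&& q < NQ, wfe NV i & wfe NV.+1 e]
  | SSeq s1 s2 => wfs s1 && wfs s2
  | SWhile e s => wfe NV e && wfs s
  end.

Lemma size_cstmt p s : size (cstmt p s) = csize s.
Proof.
elim: s p => [x e|q i e|s1 IH1 s2 IH2|e s IH] p /=;
  rewrite ?size_cat /= ?size_cat /= ?size_cat /= ?size_kcaddr ?IH1 ?IH2 ?IH; lia.
Qed.

Section Sem.
Variables (B Sz : nat) (T : seq nat) (P : seq (option nat)).

Fixpoint ev (e : expr) (st : state) : nat := match e with
  | EC c => c
  | EV x => vr st x
  | EArr q e => ar st q (ev e st)
  | EBin o a b => evop o (ev a st) (ev b st)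
  | ERdT e => nth 0 T (ev e st)
  | ERdP e => if nth None P (ev e st) is Some ch then ch else 0
  | EWild e => (ev e st < size P) && (nth None P (ev e st) == None)
  end.

Definition safeop o (a b : nat) : bool := match o with
  | OAdd => a + b < B | OMul => a * b < B | _ => true end.

(** Overflow is excluded rather than modelled: under [safe], the modular sums and products of the
    machine agree with those of [ev] in [nat]. The machine does not reduce the other operations, and
    input reads out of range are legal. *)
Fixpoint safe (e : expr) (st : state) : Prop := match e with
  | EC _ | EV _ => True
  | EArr q e => safe e st /\ ev e st < Sz
  | EBin o a b => [/\ safe a st, safe b st & safeop o (ev a st) (ev b st)]
  | ERdT e | ERdP e | EWild e => safe e st
  end.

Inductive exec : stmt -> state -> nat -> state -> Prop :=
| XAsg x e st : safe e st ->
    exec (SAsg x e) st (csize (SAsg x e)) (setv st x (ev e st))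
| XSet q i e st : safe i st -> ev i st < Sz -> safe e st ->
    exec (SSet q i e) st (csize (SSet q i e)) (seta st q (ev i st) (ev e st))
| XSeq s1 s2 st t1 st1 t2 st2 : exec s1 st t1 st1 -> exec s2 st1 t2 st2 ->
    exec (SSeq s1 s2) st (t1 + t2) st2
| XWhT e s st t1 st1 t2 st2 : safe e st -> ev e st != 0 ->
    exec s st t1 st1 -> exec (SWhile e s) st1 t2 st2 ->
    exec (SWhile e s) st ((size (cexpr NV e)).+1 + t1 + 1 + t2) st2
| XWhF e s st : safe e st -> ev e st = 0 ->
    exec (SWhile e s) st (size (cexpr NV e)).+1 st.

End Sem.

Section Compile.
Variables (w S Sz : nat) (T : seq nat) (P : seq (option nat)) (prog : seq instr).
Hypothesis hS : HB + NQ * Sz <= S.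
Hypothesis hB : HB + NQ * Sz <= 2 ^ w.
Hypothesis hSz : 0 < Sz.

Let hS8 : HB + 8 * Sz <= S := hS.
Let hB8 : HB + 8 * Sz <= 2 ^ w := hB.

Definition steps c t c' :=
  run w T P prog t c = c' /\
  forall t', t' < t -> ~~ halted prog (run w T P prog t' c) /\
                       all (fun a => a < S) (accessed prog (run w T P prog t' c)).

Lemma steps_trans c1 c2 c3 t1 t2 t : steps c1 t1 c2 -> steps c2 t2 c3 ->
  t = t1 + t2 -> steps c1 t c3.
Proof.
move=> [r1 h1] [r2 h2] ->.
have runD t' : run w T P prog (t1 + t') c1 = run w T P prog t' c2.
  by rewrite /run addnC iterD -/(run w T P prog t1 c1) r1.
split; first by rewrite runD.
move=> t' ht'; case: (ltnP t' t1) => [/h1 //|ht1].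
by rewrite -(subnKC ht1) runD; apply: h2; rewrite ltn_subLR.
Qed.

Lemma steps1 c c' : step w T P prog c = c' -> ~~ halted prog c ->
  all (fun a => a < S) (accessed prog c) -> steps c 1 c'.
Proof. by move=> h1 h2 h3; split=> //; case. Qed.

Definition codeat p code := forall i, i < size code -> fetch prog (p + i) = nth IHalt code i.

Lemma codeat_cat p c1 c2 : codeat p (c1 ++ c2) -> codeat p c1 /\ codeat (p + size c1) c2.
Proof.
move=> h; split=> i hi.
  by rewrite h ?nth_cat ?hi // size_cat ltn_addr.
rewrite -addnA h ?size_cat ?ltn_add2l //.
by rewrite nth_cat ltnNge leq_addr /= addKn.
Qed.

Lemma codeat_cons p i c : codeat p (i :: c) -> fetch prog p = i /\ codeat p.+1 c.
Proof.
move=> h; split; first by rewrite -[p]addn0 h.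
by move=> j hj; rewrite addSnnS h.
Qed.

Definition memrel st (m : nat -> nat) :=
  (forall x, x < NV -> m x = vr st x) /\
  (forall q i, q < NQ -> m (NQ * i + (HB + q)) = ar st q i).

(** Evaluation at stack height [d] may disturb only registers [d .. HB - 1]; this protects
    variables, pending operands and arrays alike. *)
Definition same d (m m' : nat -> nat) := forall x, (x < d) || (HB <= x) -> m' x = m x.

Lemma memrel_same st d m m' : NV <= d -> memrel st m -> same d m m' -> memrel st m'.
Proof.
move=> hd [h1 h2] hs; split=> [x hx|q i hq].
  by rewrite hs ?h1 // (leq_trans hx).
rewrite hs ?h2 //.
by apply/orP; right; rewrite addnC -addnA leq_addr.
Qed.

Lemma same_trans d d' m1 m2 m3 : d <= d' -> same d m1 m2 -> same d' m2 m3 -> same d m1 m3.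
Proof.
move=> hd h1 h2 x hx; rewrite h2 ?h1 //.
by case/orP: hx => hx; rewrite ?hx ?orbT // (leq_trans hx).
Qed.

Lemma same_upd d m x v : d <= x < HB -> same d m (upd m x v).
Proof. by move=> hx y hy; rewrite /upd; case: eqP => // hyx; lia. Qed.

Lemma same_updr d m m' x v : same d m m' -> d <= x < HB -> same d m (upd m' x v).
Proof. by move=> h hx; apply: same_trans (leqnn d) h (same_upd _ _ hx). Qed.

Lemma caddr_steps d q p m i : d.+1 < HB -> q < NQ -> i < Sz ->
  codeat p (kcaddr d q) -> m d = i ->
  exists m', [/\ steps (Config p m) 4 (Config (p + 4) m'),
    m' d = NQ * i + (HB + q) & same d m m'].
Proof.
rewrite kcaddrE => hd hq hi /codeat_cons[f1] /codeat_cons[f2] /codeat_cons[f3] /codeat_cons[f4] _ hm.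
have hNQ : NQ = 8 by [].
have hHB : HB = 64 by [].
move: hS8 hB8 => hs8 hb8; rewrite hNQ.
have hle : 8 * i.+1 <= 8 * Sz by rewrite leq_mul2l hi orbT.
have b1 : 8 < 2 ^ w by lia.
have b2 : HB + q < 2 ^ w by lia.
have b3 : i * 8 < 2 ^ w by lia.
have b4 : i * 8 + (HB + q) < 2 ^ w by lia.
eexists; split.
- apply: (@steps_trans _ _ _ 1 3) => //.
    by apply: steps1; rewrite ?/step ?/halted ?/accessed /= ?f1 //=; lia.
  apply: (@steps_trans _ _ _ 1 2) => //.
    by apply: steps1; rewrite ?/step ?/halted ?/accessed /= ?f2 //=; lia.
  apply: (@steps_trans _ _ _ 1 1) => //.
    by apply: steps1; rewrite ?/step ?/halted ?/accessed /= ?f3 //=; lia.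
  apply: steps1; rewrite ?/step ?/halted ?/accessed /= ?f4 //=; last by lia.
  by rewrite -[p.+4]addn4.
- rewrite /upd !eqxx.
  have n1 : (d.+1 == d) = false by lia.
  have n2 : (d == d.+1) = false by lia.
  by rewrite ?n1 ?n2 hm !modn_small // mulnC.
- by do 4!(apply: same_updr; last by lia).
Qed.

Lemma same_le d d' m m' : d <= d' -> same d' m m' -> same d m m'.
Proof. by move=> h; apply: (same_trans h) => x. Qed.

Lemma wfe_lt d e : wfe d e -> d.+1 < HB.
Proof.
elim: e d => //= [c|x|q e IH|o a IHa b IHb] d.
- by case/andP.
- by case/andP.
- by case/andP => _ /IH.
- by case/andP => /IHa.
Qed.

Lemma cexpr_steps e : forall d st p m, NV <= d -> codeat p (cexpr d e) -> wfe d e ->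
  safe (2 ^ w) Sz T P e st -> memrel st m ->
  exists m', [/\ steps (Config p m) (size (cexpr d e)) (Config (p + size (cexpr d e)) m'),
     m' d = ev T P e st & same d m m'].
Proof.
have hHB : HB = 64 by [].
move: hS8 hB8 => hs8 hb8.
(* The three input reads differ only in the function [f] that their last instruction applies to
   register [d]. *)
have un c e1 d st p m (f : nat -> nat) : 
    (forall d st p m, NV <= d -> codeat p (cexpr d e1) -> wfe d e1 ->
      safe (2 ^ w) Sz T P e1 st -> memrel st m ->
      exists m', [/\ steps (Config p m) (size (cexpr d e1)) (Config (p + size (cexpr d e1)) m'),
         m' d = ev T P e1 st & same d m m']) ->
    (forall p m, fetch prog p = c -> [/\ ~~ halted prog (Config p m), accessed prog (Config p m) = [:: d; d]
      & step w T P prog (Config p m) = Config p.+1 (upd m d (f (m d)))]) ->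
    NV <= d -> codeat p (cexpr d e1 ++ [:: c]) -> wfe d e1 -> safe (2 ^ w) Sz T P e1 st -> memrel st m ->
    exists m', [/\ steps (Config p m) (size (cexpr d e1 ++ [:: c])) (Config (p + size (cexpr d e1 ++ [:: c])) m'),
     m' d = f (ev T P e1 st) & same d m m'].
  move=> IH hc hd /codeat_cat[hc1] /codeat_cons[hf _] hw hs hr.
  have hdl := wfe_lt hw.
  have [m' [h1 h2 h3]] := IH _ _ _ m hd hc1 hw hs hr.
  have [k1 k2 k3] := hc _ m' hf.
  exists (upd m' d (f (m' d))); split.
  - rewrite size_cat /= addn1.
    apply: (steps_trans h1) (steps1 _ k1 _) _; rewrite ?k2 ?k3 ?addn1 ?addnS //=.
    lia.
  - by rewrite /upd eqxx h2.
  - by apply: (same_trans (leqnn d)) h3 _; apply: same_upd; lia.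
elim: e => [c|x|q e IH|o a IHa b IHb|e IH|e IH|e IH] d st p m hd /=.
- move=> /codeat_cons[f _] /andP[h1 h2] _ hr; exists (upd m d c); split.
  + rewrite addn1; apply: steps1; rewrite ?/step ?/halted ?/accessed /= ?f //=.
      by rewrite modn_small //; lia.
    by lia.
  + by rewrite /upd eqxx.
  + by apply: same_upd; lia.
- move=> /codeat_cons[f1] /codeat_cons[f2] _ /andP[h1 h2] _ hr.
  (* Variables lie below the stack, so clearing register [d] first does not destroy the value to be
     copied. *)
  have hxd : (x == d) = false by lia.
  eexists; split.
  + apply: (@steps_trans _ _ _ 1 1) => //.
      by apply: steps1; rewrite ?/step ?/halted ?/accessed /= ?f1 //=; lia.
    apply: steps1; rewrite ?/step ?/halted ?/accessed /= ?f2 //=; last by lia.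
    by rewrite -[p.+2]addn2.
  + by rewrite /upd !eqxx mod0n subn0 hxd (proj1 hr).
  + by do 2!(apply: same_updr; last by lia).
- move=> /codeat_cat[hc1] /codeat_cat[c1] /codeat_cons[f _] /andP[hq hw] [hs hi] hr; rewrite size_kcaddr in f.
  have hdl := wfe_lt hw.
  have [m1 [h1 h2 h3]] := IH _ _ _ m hd hc1 hw hs hr.
  have [m2 [k1 k2 k3]] := caddr_steps hdl hq hi c1 h2.
  exists (upd m2 d (m2 (m2 d))); split.
  + apply: (steps_trans h1 (steps_trans k1 (steps1 _ _ _) erefl)).
    * rewrite /step /= f /=; congr (Config _ _).
      by rewrite !size_cat /= size_kcaddr; lia.
    * by rewrite /halted /= f.
    * rewrite /accessed /= f /= k2.
      have hNQ : NQ = 8 by [].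
      have : 8 * (ev T P e st).+1 <= 8 * Sz by rewrite leq_mul2l hi orbT.
      by lia.
    * by rewrite !size_cat /= size_kcaddr.
  + rewrite /upd eqxx k2.
    have hr2 : memrel st m2 by apply: (memrel_same hd hr); apply: (same_trans (leqnn d) h3).
    by rewrite (proj2 hr2).
  + apply: (same_trans (leqnn d) h3); apply: (same_trans (leqnn d) k3).
    by apply: same_upd; lia.
- move=> /codeat_cat[ca] /codeat_cat[cb] /codeat_cons[f _] /andP[hwa hwb] [hsa hsb ho] hr.
  have hdl := wfe_lt hwb.
  have [m1 [h1 h2 h3]] := IHa _ _ _ m hd ca hwa hsa hr.
  have hr1 := memrel_same hd hr h3.
  have [m2 [k1 k2 k3]] := IHb _ _ _ m1 (leqW hd) cb hwb hsb hr1.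
  have e1 : m2 d = ev T P a st by rewrite k3 // ltnSn.
  exists (upd m2 d (evop o (m2 d) (m2 d.+1))); split.
  + apply: (steps_trans h1 (steps_trans k1 (steps1 _ _ _) erefl)).
    * rewrite /step /= f; move: ho; rewrite -e1 -k2 size_cat size_cat /= addn1 !addnS addnA.
      by case: (o) => /= ho; rewrite ?(modn_small ho).
    * by rewrite /halted /= f; case: (o).
    * by rewrite /accessed /= f; case: (o) => /=; lia.
    * by rewrite !size_cat /=; lia.
  + by rewrite /upd eqxx e1 k2.
  + apply: (same_trans (leqnn d) h3); apply: (same_trans (leqnn d) (same_le (leqnSn d) k3)).
    by apply: same_upd; lia.
- by apply: (@un (IReadT d d) e d st p m (fun x => nth 0 T x) IH) => // p' m' f;
    rewrite /halted /accessed /step /= f.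
- by apply: (@un (IReadP d d) e d st p m (fun x => if nth None P x is Some ch then ch else 0) IH) => // p' m' f;
    rewrite /halted /accessed /step /= f.
- by apply: (@un (IIsWild d d) e d st p m (fun x => (x < size P) && (nth None P x == None)) IH) => // p' m' f;
    rewrite /halted /accessed /step /= f.
Qed.

Lemma cstmt_steps s st t st' : exec (2 ^ w) Sz T P s st t st' -> wfs s ->
  forall p m, codeat p (cstmt p s) -> memrel st m ->
  exists m', steps (Config p m) t (Config (p + csize s) m') /\ memrel st' m'.
Proof.
have hHB : HB = 64 by [].
have hNV : NV = 40 by [].
have hNQ : NQ = 8 by [].
move: hS8 hB8 => hs8 hb8.
elim=> {s st t st'}.
- move=> x e st hs /= /andP[hx hw] p m /codeat_cat[ce] /codeat_cons[f1] /codeat_cons[f2] _ hr.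
  have [m1 [h1 h2 h3]] := cexpr_steps (leqnn _) ce hw hs hr.
  have hr1 := memrel_same (leqnn _) hr h3.
  have hxn : (NV == x) = false by lia.
  eexists; split.
    apply: (steps_trans h1 _ (esym (addn2 _))).
    apply: (@steps_trans _ _ _ 1 1) => //.
      by apply: steps1; rewrite ?/step ?/halted ?/accessed /= ?f1 //=; lia.
    apply: steps1; rewrite ?/step ?/halted ?/accessed /= ?f2 //=; last by lia.
    by rewrite !addnS.
  split=> /=.
    move=> y hy; rewrite /upd !eqxx hxn mod0n subn0 h2; case: eqP => // _.
    exact: (proj1 hr1).
  move=> q i hq; rewrite /upd.
  have -> : (NQ * i + (HB + q) == x) = false by lia.
  exact: (proj2 hr1).
- move=> q i e st hs hi hse /= /and3P[hq hw hwe] p m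
    /codeat_cat[ci] /codeat_cat[ca] /codeat_cat[ce] /codeat_cons[f _] hr; rewrite size_kcaddr in ce f.
  have [m1 [h1 h2 h3]] := cexpr_steps (leqnn _) ci hw hs hr.
  have hr1 := memrel_same (leqnn _) hr h3.
  have [m2 [k1 k2 k3]] := caddr_steps (wfe_lt hw) hq hi ca h2.
  have hr2 := memrel_same (leqnn _) hr1 k3.
  have [m3 [l1 l2 l3]] := cexpr_steps (leqnSn _) ce hwe hse hr2.
  have hr3 := memrel_same (leqnSn _) hr2 l3.
  have e3 : m3 NV = NQ * ev T P i st + (HB + q) by rewrite l3 ?k2 // ltnSn.
  exists (upd m3 (m3 NV) (m3 NV.+1)); split.
    apply: (steps_trans h1 (steps_trans k1 (steps_trans l1 (steps1 _ _ _) erefl) erefl)).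
    + by rewrite /step /= f /=; congr Config; lia.
    + by rewrite /halted /= f.
    + rewrite /accessed /= f /= e3.
      have : 8 * (ev T P i st).+1 <= 8 * Sz by rewrite leq_mul2l hi orbT.
      by lia.
    + by lia.
  split=> /=.
    move=> y hy; rewrite /upd e3.
    have -> : (y == NQ * ev T P i st + (HB + q)) = false by lia.
    exact: (proj1 hr3).
  move=> q' i' hq'; rewrite /upd e3 l2.
  (* Distinct residues modulo [NQ] keep the interleaved arrays disjoint. *)
  have -> : (NQ * i' + (HB + q') == NQ * ev T P i st + (HB + q)) =
            (q' == q) && (i' == ev T P i st) by lia.
  by case: ifP => // _; exact: (proj2 hr3).
- move=> s1 s2 st t1 st1 t2 st2 _ IH1 _ IH2 /= /andP[w1 w2] p m /codeat_cat[c1 c2] hr.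
  have [m1 [h1 r1]] := IH1 w1 p m c1 hr.
  rewrite size_cstmt in c2.
  have [m2 [h2 r2]] := IH2 w2 _ m1 c2 r1.
  by exists m2; split=> //; rewrite addnA; apply: steps_trans h1 h2 _.
- move=> e s st t1 st1 t2 st2 hs he _ IH1 _ IH2 wf p m cc hr.
  have /= /andP[hw w1] := wf.
  move: (cc) => /= /codeat_cat[ce] /codeat_cons[f1] /codeat_cat[c1] /codeat_cons[f2 _].
  have [m1 [h1 h2 h3]] := cexpr_steps (leqnn _) ce hw hs hr.
  have hr1 := memrel_same (leqnn _) hr h3.
  have [m2 [k1 k2]] := IH1 w1 _ m1 c1 hr1.
  rewrite size_cstmt in f2.
  have [m3 [l1 l2]] := IH2 wf p m2 cc k2.
  exists m3; split=> //.
  apply: (@steps_trans _ (Config (p + size (cexpr NV e)).+1 m1) _ (size (cexpr NV e)).+1 (t1 + 1 + t2));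
    last by lia.
    apply: (steps_trans h1 (steps1 _ _ _)); last by rewrite addn1.
    + by rewrite /step /= f1 /= h2 (negbTE he).
    + by rewrite /halted /= f1.
    + by rewrite /accessed /= f1 /=; lia.
  apply: (steps_trans (steps_trans k1 (steps1 _ _ _) erefl) l1 erefl).
  + by rewrite /step /= f2.
  + by rewrite /halted /= f2.
  + by rewrite /accessed /= f2.
- move=> e s st hs he /= /andP[hw w1] p m /codeat_cat[ce] /codeat_cons[f1] _ hr.
  have [m1 [h1 h2 h3]] := cexpr_steps (leqnn _) ce hw hs hr.
  have hr1 := memrel_same (leqnn _) hr h3.
  exists m1; split=> //.
  apply: (steps_trans h1 (steps1 _ _ _)); last by rewrite addn1.
  + by rewrite /step /= f1 /= h2 he /=; congr Config; lia.
  + by rewrite /halted /= f1.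
  + by rewrite /accessed /= f1 /=; lia.
Qed.

End Compile.

(** * Triples with time bounds and automatic framing *)

Fixpoint wv s : seq nat := match s with
  | SAsg x _ => [:: x] | SSet _ _ _ => [::]
  | SSeq s1 s2 => wv s1 ++ wv s2 | SWhile _ s => wv s end.

Fixpoint wa s : seq nat := match s with
  | SAsg _ _ => [::] | SSet q _ _ => [:: q]
  | SSeq s1 s2 => wa s1 ++ wa s2 | SWhile _ s => wa s end.

Definition frame (vs qs : seq nat) (st st' : state) :=
  (forall x, x \notin vs -> vr st' x = vr st x) /\
  (forall q, q \notin qs -> forall i, ar st' q i = ar st q i).

Lemma frame_refl vs qs st : frame vs qs st st. Proof. by []. Qed.

Lemma frame_trans vs qs st1 st2 st3 : frame vs qs st1 st2 -> frame vs qs st2 st3 -> frame vs qs st1 st3.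
Proof.
by move=> [h1 h2] [h3 h4]; split=> [x hx|q hq i]; rewrite ?h3 ?h4 ?h1 ?h2.
Qed.

Lemma frame_sub vs qs vs' qs' st1 st2 : frame vs qs st1 st2 ->
  {subset vs <= vs'} -> {subset qs <= qs'} -> frame vs' qs' st1 st2.
Proof.
move=> [h1 h2] sv sq; split=> [x hx|q hq i]; [rewrite h1 //|rewrite h2 //].
  by apply: contra hx => /sv.
by apply: contra hq => /sq.
Qed.

Section Tri.
Variables (B Sz : nat) (T : seq nat) (P : seq (option nat)).
Notation exec := (exec B Sz T P).
Notation ev := (ev T P).
Notation safe := (safe B Sz T P).

Lemma exec_frame s st t st' : exec s st t st' -> frame (wv s) (wa s) st st'.
Proof.
elim=> {s st t st'} //=.
- move=> x e st _; split=> // y; rewrite inE => /= h.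
  by rewrite /upd (negbTE h).
- move=> q i e st _ _ _; split=> // r; rewrite inE => /= h j.
  by rewrite (negbTE h).
- move=> s1 s2 st t1 st1 t2 st2 _ f1 _ f2.
  apply: frame_trans (frame_sub f1 _ _) (frame_sub f2 _ _) => x;
    by rewrite mem_cat => ->; rewrite ?orbT.
- by move=> e s st t1 st1 t2 st2 _ _ _ f1 _ f2; apply: frame_trans f1 f2.
Qed.

(* The time is counted in multiples of the code size, so that no explicit constant
   appears: [F] only has to account for the numbers of iterations. *)
Definition tri F s st (Q : state -> Prop) :=
  exists t st', [/\ exec s st t st', t <= csize s * F & Q st'].

Lemma tri_asg F x e st (Q : state -> Prop) : 0 < F -> safe e st ->
  Q (setv st x (ev e st)) -> tri F (SAsg x e) st Q.
Proof.
move=> hF hs hQ; exists (csize (SAsg x e)), (setv st x (ev e st)); split=> //.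
  exact: XAsg.
by rewrite leq_pmulr.
Qed.

Lemma tri_set F q i e st (Q : state -> Prop) : 0 < F -> safe i st -> ev i st < Sz -> safe e st ->
  Q (seta st q (ev i st) (ev e st)) -> tri F (SSet q i e) st Q.
Proof.
move=> hF hi hl hs hQ; exists (csize (SSet q i e)), (seta st q (ev i st) (ev e st)); split=> //.
  exact: XSet.
by rewrite leq_pmulr.
Qed.

Lemma tri_seq F s1 s2 st Q : tri F s1 st (fun st1 => tri F s2 st1 Q) -> tri F (SSeq s1 s2) st Q.
Proof.
move=> [t1 [st1 [x1 h1 [t2 [st2 [x2 h2 hQ]]]]]]; exists (t1 + t2), st2; split=> //.
  exact: XSeq x1 x2.
by rewrite /= mulnDl leq_add.
Qed.

(** The consequence rule hands over the frame of [s] for free, so that postconditions and invariants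
    only speak of what changes. *)
Lemma tri_imp F F' s st (Q Q' : state -> Prop) : tri F s st Q -> F <= F' ->
  (forall st', frame (wv s) (wa s) st st' -> Q st' -> Q' st') -> tri F' s st Q'.
Proof.
move=> [t [st' [x h hQ]]] hF hQQ; exists t, st'; split=> //.
  by apply: leq_trans h _; rewrite leq_mul2l hF orbT.
by apply: hQQ => //; apply: exec_frame x.
Qed.

(** The loop runs exactly [k] times. Each round, test and jump included, is paid by the code size of
    the loop times [F]; the extra one in [k.+1] pays for the failing test. *)
Lemma tri_while (I : nat -> state -> Prop) k F F' e s st (Q : state -> Prop) :
  0 < F -> F * k.+1 <= F' -> I 0 st ->
  (forall i st', i < k -> frame (wv s) (wa s) st st' -> I i st' ->
     [/\ safe e st', ev e st' != 0 & tri F s st' (I i.+1)]) ->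
  (forall st', frame (wv s) (wa s) st st' -> I k st' ->
     [/\ safe e st', ev e st' = 0 & Q st']) ->
  tri F' (SWhile e s) st Q.
Proof.
move=> hF hF' h0 hi hk.
have main : forall j st', j <= k -> frame (wv s) (wa s) st st' -> I (k - j) st' ->
    exists t st'', [/\ exec (SWhile e s) st' t st'', t <= csize (SWhile e s) * (F * j.+1) & Q st''].
  elim=> [|j IH] st' hj hf hI.
    rewrite subn0 in hI; have [s1 s2 s3] := hk st' hf hI.
    exists (size (cexpr NV e)).+1, st'; split=> //; first exact: XWhF.
    by rewrite muln1; apply: leq_trans (leq_pmulr _ hF); rewrite /=; lia.
  have hlt : k - j.+1 < k by lia.
  have [s1 s2 [t1 [st1 [x1 b1 hI1]]]] := hi _ _ hlt hf hI.
  have e1 : (k - j.+1).+1 = k - j by lia.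
  rewrite e1 in hI1.
  have [t2 [st2 [x2 b2 hQ]]] := IH st1 (ltnW hj) (frame_trans hf (exec_frame x1)) hI1.
  exists ((size (cexpr NV e)).+1 + t1 + 1 + t2), st2; split=> //; first exact: XWhT x1 x2.
  move: b1 b2; rewrite /=; set E := size _; set C := csize s => b1 b2.
  have : E.+2 <= E.+2 * F by rewrite leq_pmulr.
  rewrite mulnS mulnDr !mulnDl in b2 *; lia.
have [|t [st' [x b hQ]]] := main k st (leqnn _) (frame_refl _ _ _); first by rewrite subnn.
exists t, st'; split=> //; apply: leq_trans b _.
by rewrite leq_mul2l hF' orbT.
Qed.

End Tri.

Declare Scope e_scope.
Delimit Scope e_scope with e.
Notation "a |+| b" := (EBin OAdd a b) (at level 50, left associativity) : e_scope.
Notation "a |-| b" := (EBin OSub a b) (at level 50, left associativity) : e_scope.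
Notation "a |*| b" := (EBin OMul a b) (at level 40, left associativity) : e_scope.
Notation "a |/| b" := (EBin ODiv a b) (at level 40, left associativity) : e_scope.
Notation "a |%| b" := (EBin OMod a b) (at level 40, left associativity) : e_scope.
Notation "a |<| b" := (EBin OLt a b) (at level 70) : e_scope.
Notation "a |=| b" := (EBin OEq a b) (at level 70) : e_scope.
Notation "a ;; b" := (SSeq a b) (at level 80, right associativity) : e_scope.
Notation "x <~ e" := (SAsg x e) (at level 75) : e_scope.
Coercion EC : nat >-> expr.
Open Scope e_scope.

Definition SFor x e s := x <~ EC 0 ;; SWhile (EV x |<| e) (s ;; x <~ EV x |+| EC 1).

Section For.
Variables (B Sz : nat) (T : seq nat) (P : seq (option nat)).
Notation ev := (ev T P).
Notation safe := (safe B Sz T P).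

(** The bound [e] is evaluated anew at each test, hence it must be stable under all that the loop
    writes. The invariant is indifferent to [x] so that it survives the increment. *)
Lemma tri_for (I : nat -> state -> Prop) k F F' x e s st (Q : state -> Prop) :
  0 < F -> F * k.+1 <= F' -> k < B -> x \notin wv s ->
  (forall st', frame (x :: wv s) (wa s) st st' -> safe e st' /\ ev e st' = k) ->
  (forall i st' v, I i st' -> I i (setv st' x v)) ->
  I 0 st ->
  (forall i st', i < k -> frame (x :: wv s) (wa s) st st' -> vr st' x = i -> I i st' ->
     tri B Sz T P F s st' (I i.+1)) ->
  (forall st', frame (x :: wv s) (wa s) st st' -> vr st' x = k -> I k st' -> Q st') ->
  tri B Sz T P F' (SFor x e s) st Q.
Proof.
move=> hF hF' hk hx he hI h0 hi hQ.
apply: tri_seq; apply: tri_asg => //=; first by apply: leq_trans hF'; rewrite muln_gt0 hF.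
have fr st' : frame (wv s ++ [:: x]) (wa s ++ [::]) (setv st x 0) st' -> frame (x :: wv s) (wa s) st st'.
  move=> hf; apply: (@frame_trans _ _ _ (setv st x 0)).
    by split=> // y; rewrite inE negb_or => /andP[h _]; rewrite /= /upd (negbTE h).
  by apply: frame_sub hf _ _ => y; rewrite ?cats0 ?mem_cat ?inE // orbC.
apply: (@tri_while _ _ _ _ (fun i st' => I i st' /\ vr st' x = i) k F) => //=.
- by split; [exact: hI | rewrite /upd eqxx].
- move=> i st' hik hf [hIi hvx]; have [hs hev] := he st' (fr _ hf).
  split=> //; first by rewrite hvx hev hik.
  apply: tri_seq; apply: tri_imp (hi i st' hik (fr _ hf) hvx hIi) (leqnn _) _.
  move=> st2 [hf2 _] hI2; have hv2 : vr st2 x = i by rewrite hf2.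
  apply: tri_asg => //=; first by rewrite hv2; split=> //; lia.
  by split; [exact: hI | rewrite /upd eqxx hv2 addn1].
- move=> st' hf [hIk hvx]; have [hs hev] := he st' (fr _ hf).
  split=> //; first by rewrite hvx hev ltnn.
  by apply: hQ => //; apply: fr.
Qed.

Definition yields e v st := safe e st /\ ev e st = v.

(** A new cell may depend on any old cells, so the results go to a second array and are copied back
    only when all are known. *)
Definition SPass x e qx qy s e1 :=
  SFor x e (s ;; SSet qy (EV x) e1) ;; SFor x e (SSet qx (EV x) (EArr qy (EV x))).

Lemma tri_pass (f : nat -> nat) k F F' x e qx qy s e1 st (Q : state -> Prop) :
  0 < F -> F * k.+1 <= F' -> k < B -> k <= Sz -> x \notin wv s -> wa s = [::] -> qx != qy ->
  (forall st', frame (x :: wv s) [:: qx; qy] st st' -> safe e st' /\ ev e st' = k) ->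
  (forall i st', i < k -> frame (x :: wv s) [:: qy] st st' -> vr st' x = i ->
     tri B Sz T P F s st' (yields e1 (f i))) ->
  (forall st', frame (x :: wv s) [:: qx; qy] st st' -> (forall i, i < k -> ar st' qx i = f i) -> Q st') ->
  tri B Sz T P F' (SPass x e qx qy s e1) st Q.
Proof.
move=> hF hF' hkB hkS hx hwa hqq he hb hQ.
apply: tri_seq.
apply: (@tri_for (fun j st' => forall i, i < j -> ar st' qy i = f i) k F) => //=.
- by rewrite cats0.
- move=> st'; rewrite cats0 hwa /= => hf; apply: he; apply: frame_sub hf _ _ => // y.
  by rewrite !inE => ->; rewrite orbT.
- move=> i st' hik; rewrite cats0 hwa /= => hf hvx hI.
  apply: tri_seq; apply: tri_imp (hb i st' hik hf hvx) (leqnn _) _.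
  move=> st2; rewrite hwa => -[hf1 hf2] [hs hev].
  have hv2 : vr st2 x = i by rewrite hf1.
  apply: tri_set => //=; first by rewrite hv2; apply: leq_trans hik _.
  move=> j hj /=; rewrite hv2 hev eqxx /=.
  by case: (eqVneq j i) => [->|hji] //; rewrite hf2 // hI //; lia.
- move=> st1; rewrite cats0 hwa /= => hf1 _ hI1.
  apply: (@tri_for (fun j st' => forall i, i < j -> ar st' qx i = f i) k F) => //=.
  + move=> st' hf2; apply: he.
    apply: frame_trans (frame_sub hf1 _ _) (frame_sub hf2 _ _) => y; rewrite ?inE //.
    * by move=> ->; rewrite orbT.
    * by move=> ->.
    * by move=> ->.
  + move=> i st' hik [hf1' hf2'] hvx hI.
    apply: tri_set => //=; rewrite ?hvx; try by split=> //; lia.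
      lia.
    move=> j hj /=; rewrite eqxx /=.
    case: (eqVneq j i) => [->|hji]; last by apply: hI; lia.
    by rewrite hf2' ?inE 1?eq_sym // hI1.
  + move=> st2 hf2 _ hI2; apply: hQ => //.
    apply: frame_trans (frame_sub hf1 _ _) (frame_sub hf2 _ _) => y; rewrite ?inE //.
    * by move=> ->; rewrite orbT.
    * by move=> ->.
    * by move=> ->.
Qed.

End For.

(** * Exact negacyclic convolution *)

Section Algebra.
Import GRing.Theory.
Local Open Scope ring_scope.

Lemma big_ord_cat (A : nmodType) (m n k : nat) (F : nat -> A) : k = (m + n)%N ->
  \sum_(i < k) F i = \sum_(i < m) F i + \sum_(i < n) F (m + i)%N.
Proof. by move=> ->; rewrite big_split_ord. Qed.

Lemma big_ord_mul (A : nmodType) (m n : nat) (F : nat -> A) :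
  \sum_(k < m * n) F k = \sum_(i < m) \sum_(j < n) F (i + m * j)%N.
Proof.
rewrite exchange_big /=; elim: n => [|n IH]; first by rewrite muln0 !big_ord0.
rewrite mulnS addnC (big_ord_cat (fun k => F k) erefl) IH big_ord_recr /=; congr (_ + _).
by apply: eq_bigr => i _; rewrite addnC.
Qed.

Lemma divn_low V l q : (l < V)%N -> ((l + V * q) %/ V = q)%N.
Proof. by move=> h; rewrite addnC mulnC divnMDl ?divn_small ?addn0 //; lia. Qed.

Lemma modn_low V l q : (l < V)%N -> ((l + V * q) %% V = l)%N.
Proof. by move=> h; rewrite addnC mulnC modnMDl modn_small. Qed.

Lemma divn2_low V l (b : bool) i : (l < V)%N -> ((l + V * (b + 2 * i)) %/ (2 * V) = i)%N.
Proof.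
move=> h; rewrite [(2 * V)%N]mulnC divnMA divn_low // addnC mulnC divnMDl //.
by case: b; rewrite addn0.
Qed.

(** * Fourier transform by rotations *)

Section Transform.
Variables (A : comNzRingType) (y : A) (R : nat).

(** An array is read as [W] interleaved columns of [R] digits: column [pos] is an element of
    [(Z/M)[y] / (y^R + 1)], given by its value at [y]. *)
Definition ycol (X : nat -> nat) (W pos : nat) : A := \sum_(j < R) (X (pos + W * j)%N)%:R * y ^+ j.

(** Multiplication by [y ^+ e] moves every digit up by [e]; digits pushed past [R] re-enter at the
    bottom with the sign of [y ^+ R = -1]. Roots of unity thus cost no multiplication of digits. *)
Lemma rot_sum (u : nat -> A) (e : nat) : y ^+ R = -1 -> (e < R)%N ->
  \sum_(j < R) (if (j < e)%N then - u (j + R - e)%N else u (j - e)%N) * y ^+ j =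
  y ^+ e * \sum_(j < R) u j * y ^+ j.
Proof.
move=> hy he.
have hR : (R = e + (R - e))%N by lia.
rewrite (big_ord_cat (fun j => (if (j < e)%N then - u (j + R - e)%N else u (j - e)%N) * y ^+ j) hR).
have hR2 : (R = (R - e) + e)%N by lia.
rewrite (big_ord_cat (fun j => u j * y ^+ j) hR2) mulrDr addrC; congr (_ + _); rewrite mulr_sumr; apply: eq_bigr => i _.
  have -> : (e + i < e)%N = false by lia.
  by rewrite addKn exprD; ring.
rewrite ltn_ord mulNr -mulrN.
have -> : (i + R - e = R - e + i)%N by lia.
have -> : - y ^+ i = y ^+ e * y ^+ (R - e + i).
  by rewrite -exprD addnA subnKC ?(ltnW he) // exprD hy mulN1r.
by ring.
Qed.

(** A self-sorting (Stockham) butterfly: operands at distance [H], results at distance [V], with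
    [Cnt] independent transforms interleaved. The output comes in natural order, without bit
    reversal; [low %/ Cnt] is the frequency modulo the current power of two. *)
Definition butterfly (Cnt H V : nat) (u : nat -> A) (pos : nat) : A :=
  let low := (pos %% V)%N in
  let lo := (low + V * (pos %/ (2 * V)))%N in
  u lo + (-1) ^+ (odd (pos %/ V)) * y ^+ (low %/ Cnt * (R %/ (V %/ Cnt)))%N * u (lo + H)%N.

Fixpoint butterflies (Cnt H t : nat) (u : nat -> A) : nat -> A :=
  if t is t'.+1 then butterfly Cnt H (Cnt * 2 ^ t') (butterflies Cnt H t' u) else u.

(** Put [w = y ^+ (2 ^ (r - a))], so that [w^(2^a) = -1]. The value at [w^g] depends only on the
    input polynomial modulo [x^m - w^(g m)] with [m = 2^(a+1-t)], and this modulus depends only on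
    [g %% 2 ^ t]. After [t] stages the cells of that class hold the remainder; the next stage halves
    [m]. *)
Lemma butterflies_partial (Cnt a r t c g : nat) (u : nat -> A) :
  y ^+ R = -1 -> (R = 2 ^ r)%N -> (a <= r)%N -> (t <= a.+1)%N -> (c < Cnt)%N ->
  \sum_(i < 2 ^ (a.+1 - t)) butterflies Cnt (Cnt * 2 ^ a) t u (c + Cnt * (g %% 2 ^ t) + Cnt * 2 ^ t * i)%N
      * y ^+ (2 ^ (r - a) * g) ^+ i =
  \sum_(i < 2 ^ a.+1) u (c + Cnt * i)%N * y ^+ (2 ^ (r - a) * g) ^+ i.
Proof.
move=> hy hR har + hc; elim: t => [|t IH] ht.
  by rewrite subn0; apply: eq_bigr => i _ /=; rewrite expn0 modn1 muln0 addn0 muln1.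
rewrite -IH; last by lia.
have h2at : (2 ^ (a.+1 - t) = 2 ^ (a - t) + 2 ^ (a - t))%N.
  by rewrite addnn -mul2n -expnS; congr expn; lia.
rewrite subSS (big_ord_cat (fun i => butterflies Cnt (Cnt * 2 ^ a) t u (c + Cnt * (g %% 2 ^ t) + Cnt * 2 ^ t * i)%N * y ^+ (2 ^ (r - a) * g) ^+ i) h2at) -big_split /=; apply: eq_bigr => i _.
have h2t : (0 < 2 ^ t)%N by rewrite expn_gt0.
have hV : (0 < Cnt * 2 ^ t)%N by rewrite muln_gt0 h2t; lia.
set V := (Cnt * 2 ^ t)%N in hV *.
have hlow : (c + Cnt * (g %% 2 ^ t) < V)%N.
  have : (Cnt * (g %% 2 ^ t).+1 <= V)%N by rewrite leq_mul2l ltn_pmod ?orbT.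
  by rewrite mulnS; lia.
have hpos : (c + Cnt * (g %% 2 ^ t.+1) + Cnt * 2 ^ t.+1 * i =
    (c + Cnt * (g %% 2 ^ t)) + V * (odd (g %/ 2 ^ t) + 2 * i))%N.
  rewrite expnSr -modn2.
  have -> : (g %% (2 ^ t * 2) = g %% 2 ^ t + 2 ^ t * ((g %/ 2 ^ t) %% 2))%N.
    rewrite {1}(divn_eq g (2 ^ t)) {1}(divn_eq (g %/ 2 ^ t) 2).
    set q := (_ %/ 2)%N; set b := (_ %% 2)%N.
    have -> : ((q * 2 + b) * 2 ^ t + g %% 2 ^ t = q * (2 ^ t * 2) + (g %% 2 ^ t + 2 ^ t * b))%N by ring.
    rewrite modnMDl modn_small //.
    have : (b < 2)%N by rewrite ltn_pmod.
    have := ltn_pmod g h2t; case: (b) => [|[|]] //; lia.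
  by rewrite /V; ring.
rewrite /butterfly hpos divn_low // modn_low // divn2_low //.
rewrite oddD oddM addbF oddb.
have -> : ((c + Cnt * (g %% 2 ^ t)) %/ Cnt = g %% 2 ^ t)%N.
  by rewrite divn_low.
have -> : (V %/ Cnt = 2 ^ t)%N by rewrite mulKn //; lia.
have -> : (R %/ 2 ^ t = 2 ^ (r - t))%N.
  by rewrite hR -expnB //; lia.
have -> : (c + Cnt * (g %% 2 ^ t) + V * i + Cnt * 2 ^ a =
           c + Cnt * (g %% 2 ^ t) + V * (2 ^ (a - t) + i))%N.
  have -> : (2 ^ a = 2 ^ t * 2 ^ (a - t))%N by rewrite -expnD; congr expn; lia.
  by rewrite /V; ring.
rewrite [in RHS]exprD.
(* The bits of [g] from [2 ^ t] upward give powers of [y ^+ R = -1], so only their parity matters;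
   the lower bits give the rotation. *)
have -> : (y ^+ (2 ^ (r - a) * g)) ^+ (2 ^ (a - t))%N =
   (-1) ^+ odd (g %/ 2 ^ t) * y ^+ (g %% 2 ^ t * 2 ^ (r - t)).
  rewrite -exprM.
  have -> : (2 ^ (r - a) * g * 2 ^ (a - t) = R * (g %/ 2 ^ t) + g %% 2 ^ t * 2 ^ (r - t))%N.
    have -> : (2 ^ (r - a) * g * 2 ^ (a - t) = 2 ^ (r - t) * g)%N.
      rewrite mulnAC -expnD; congr (_ * _)%N; congr expn; lia.
    rewrite {1}(divn_eq g (2 ^ t)) hR.
    have -> : (2 ^ r = 2 ^ (r - t) * 2 ^ t)%N by rewrite -expnD; congr expn; lia.
    by ring.
  by rewrite exprD exprM hy signr_odd.
by ring.
Qed.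

Lemma butterflies_eval (Cnt a r c g : nat) (u : nat -> A) :
  y ^+ R = -1 -> (R = 2 ^ r)%N -> (a <= r)%N -> (c < Cnt)%N -> (g < 2 ^ a.+1)%N ->
  butterflies Cnt (Cnt * 2 ^ a) a.+1 u (c + Cnt * g)%N =
  \sum_(i < 2 ^ a.+1) u (c + Cnt * i)%N * y ^+ (2 ^ (r - a) * g) ^+ i.
Proof.
move=> hy hR har hc hg; rewrite -(butterflies_partial _ _ hy hR har (leqnn _) hc) subnn expn0.
by rewrite big_ord1 muln0 addn0 expr0 mulr1 modn_small.
Qed.

End Transform.

(** * The passes as functions on cells, and their effect on columns *)

Section Passes.
Local Open Scope nat_scope.
Variable M : nat.

(** Negation modulo [M] left unreduced: 0 is sent to [M], which is why cells are bounded by [M]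
    inclusively. *)
Definition sgn s x := (1 - s) * x + s * (M - x).

(** The product of two polynomials of degree below [2 ^ a] needs a transform of twice that length,
    hence the zeros. *)
Definition pad_f H (X : nat -> nat) q :=
  let pos := q %% (2 * H) in let j := q %/ (2 * H) in
  (pos < H) * X (pos + H * j).

Definition twid R Cnt V low := low %/ Cnt * (R %/ (V %/ Cnt)).

Definition stage_f R Cnt H V (X : nat -> nat) q :=
  let pos := q %% (2 * H) in let j := q %/ (2 * H) in
  let low := pos %% V in
  let lo := low + V * (pos %/ (2 * V)) in
  let e := twid R Cnt V low in
  let s := ((pos %/ V) %% 2 + (j < e)) %% 2 in
  (X (lo + 2 * H * j) + sgn s (X (lo + H + 2 * H * ((j + R - e) %% R)))) %% M.

(** Undoes a stage up to a factor 2 that is left in place: the sum of the pair, or its difference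
    rotated back, with a change of sign for the digits that wrap. *)
Definition inv_f R Cnt H V (X : nat -> nat) q :=
  let pos := q %% (2 * H) in let j := q %/ (2 * H) in
  let hi := nat_of_bool (H <= pos) in
  let low := (pos %% H) %% V in
  let je := j + hi * twid R Cnt V low in
  let s := nat_of_bool (R <= je) in
  let p := low + 2 * V * ((pos %% H) %/ V) + 2 * H * (je %% R) in
  (sgn s (X p) + sgn ((s + hi) %% 2) (X (p + V))) %% M.

(** Folds the upper coefficients in [x] back through [x^(2^a) = y]; multiplication by [y] is a
    rotation by one digit. *)
Definition comb_f R H (X : nat -> nat) q :=
  let pos := q %% H in let j := q %/ H in
  (X (pos + 2 * H * j) + sgn (j == 0) (X (pos + H + 2 * H * ((j + R - 1) %% R)))) %% M.

(** For [R = 2] a column is a Gaussian integer modulo [M], and this is complex multiplication of the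
    columns [2 * c] and [2 * c + 1]. The inner reduction brings the argument of [sgn] into its
    range. *)
Definition leaf_f C (X : nat -> nat) q :=
  let c := q %% C in let n := q %/ C in
  (X (2 * c) * X (2 * c + 1 + 2 * C * n)
   + sgn (n == 0) ((X (2 * c + 2 * C) * X (2 * c + 1 + 2 * C * (1 - n))) %% M)) %% M.

End Passes.

Section Cols.
Variables (A : comNzRingType) (M : nat).
Hypothesis hM : M%:R = 0 :> A.

Lemma natr_modM x : (x %% M)%:R = x%:R :> A.
Proof. by rewrite {2}(divn_eq x M) natrD natrM hM mulr0 add0r. Qed.

Lemma natr_sgn (s : bool) x : (x <= M)%N -> (sgn M s x)%:R = (-1) ^+ s * x%:R :> A.
Proof.
move=> hx; case: s; rewrite /sgn /= ?mul0n ?mul1n ?add0n ?addn0 ?mul1r //.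
by rewrite natrB // hM sub0r expr1 mulN1r.
Qed.

Variables (y : A) (R : nat).
Hypothesis hy : y ^+ R = -1.
Local Notation colR := (ycol y R).

Lemma col_ext W pos (X : nat -> nat) (f : nat -> A) :
  (forall j, (j < R)%N -> (X (pos + W * j)%N)%:R = f j) ->
  colR X W pos = \sum_(j < R) f j * y ^+ j.
Proof. by move=> h; apply: eq_bigr => j _; rewrite h. Qed.

Lemma inrange W pos j : (pos < W)%N -> (j < R)%N -> (pos + W * j < W * R)%N.
Proof.
move=> hp hj; have : (W * j.+1 <= W * R)%N by rewrite leq_mul2l hj orbT.
by rewrite mulnS; lia.
Qed.

Lemma col_pad H X Y : (forall q, (q < 2 * H * R)%N -> Y q = pad_f H X q) ->
  forall pos, (pos < 2 * H)%N -> colR Y (2 * H) pos = if (pos < H)%N then colR X H pos else 0.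
Proof.
move=> h pos hp.
rewrite (@col_ext _ _ _ (fun j => if (pos < H)%N then (X (pos + H * j)%N)%:R else 0)).
  by case: ifP => // _; rewrite big1 // => i _; rewrite mul0r.
move=> j hj; rewrite h ?inrange // /pad_f modn_low // divn_low //.
by case: ifP => _; rewrite ?mul1n.
Qed.

Lemma rot_idx (u : nat -> A) j e : (j < R)%N -> (e < R)%N ->
  (-1) ^+ (j < e)%N * u ((j + R - e) %% R)%N =
   (if (j < e)%N then - u (j + R - e)%N else u (j - e)%N).
Proof.
move=> hj he; case: ifP => hje.
  by rewrite modn_small ?mulN1r //; lia.
have -> : (j + R - e = R + (j - e))%N by lia.
by rewrite mul1r modnDl modn_small //; lia.
Qed.

Variables (Cnt a t : nat).
Let H := (Cnt * 2 ^ a)%N.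
Let V := (Cnt * 2 ^ t)%N.
Hypothesis hC : (0 < Cnt)%N.
Hypothesis hta : (t <= a)%N.
Let V0 : (0 < V)%N. Proof. by rewrite /V muln_gt0 hC expn_gt0. Qed.
Let hHV : H = (V * 2 ^ (a - t))%N.
Proof. by rewrite /H /V -mulnA -expnD; congr (_ * 2 ^ _)%N; lia. Qed.

Lemma lo_lt pos : (pos < 2 * H)%N -> (pos %% V + V * (pos %/ (2 * V)) < H)%N.
Proof.
move=> hp; rewrite hHV in hp *.
have h1 : (pos %/ (2 * V) < 2 ^ (a - t))%N by rewrite ltn_divLR ?muln_gt0 //; lia.
have : (V * (pos %/ (2 * V)).+1 <= V * 2 ^ (a - t))%N by rewrite leq_mul2l h1 orbT.
by have := ltn_pmod pos V0; rewrite mulnS; lia.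
Qed.

Lemma butterfly_ext (u u' : nat -> A) : (forall pos, (pos < 2 * H)%N -> u pos = u' pos) ->
  forall pos, (pos < 2 * H)%N -> butterfly y R Cnt H V u pos = butterfly y R Cnt H V u' pos.
Proof.
move=> h pos hp; have := lo_lt hp => hl.
by rewrite /butterfly !h //; lia.
Qed.

Hypothesis hRa : (2 ^ a %| R)%N.
Hypothesis hR0 : (0 < R)%N.

Lemma twid_lt low : (low < V)%N -> (twid R Cnt V low < R)%N.
Proof.
move=> hl; rewrite /twid /V mulKn //.
have hd : (2 ^ t %| R)%N by apply: dvdn_trans hRa; rewrite dvdn_exp2l.
have h1 : (low %/ Cnt < 2 ^ t)%N by rewrite ltn_divLR // mulnC.
have h2 : (0 < R %/ 2 ^ t)%N by rewrite divn_gt0 ?expn_gt0 //; apply: dvdn_leq.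
by rewrite -{2}(divnK hd) mulnC ltn_pmul2l.
Qed.

Lemma col_stage X Y : (forall q, (q < 2 * H * R)%N -> (X q <= M)%N) ->
  (forall q, (q < 2 * H * R)%N -> Y q = stage_f M R Cnt H V X q) ->
  forall pos, (pos < 2 * H)%N -> colR Y (2 * H) pos = butterfly y R Cnt H V (colR X (2 * H)) pos.
Proof.
move=> hX h pos hp; have hlo := lo_lt hp.
have he : (twid R Cnt V (pos %% V) < R)%N by apply: twid_lt; rewrite ltn_pmod.
rewrite /butterfly -/(twid R Cnt V (pos %% V)).
set e := twid _ _ _ _ in he *; set lo := (_ + V * _)%N in hlo *.
have hr : y ^+ e * colR X (2 * H) (lo + H) = \sum_(j < R) (-1) ^+ (j < e)%N *
    (X (lo + H + 2 * H * ((j + R - e) %% R))%N)%:R * y ^+ j.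
  rewrite -(@rot_sum _ y R (fun j => (X (lo + H + 2 * H * j)%N)%:R) e) //.
  by apply: eq_bigr => j _; rewrite -(@rot_idx (fun i => (X (lo + H + 2 * H * i)%N)%:R)).
rewrite -mulrA hr mulr_sumr -big_split /=.
apply: eq_bigr => -[j hj] _ /=; rewrite h ?inrange // /stage_f modn_low // divn_low //.
rewrite -/lo -/e natr_modM natrD.
have -> : (((pos %/ V) %% 2 + (j < e)) %% 2 = (odd (pos %/ V) (+) (j < e)))%N.
  by rewrite modnDml modn2 oddD oddb.
rewrite natr_sgn; last by rewrite hX // inrange ?ltn_pmod //; lia.
by rewrite signr_addb; ring.
Qed.

Lemma col_inv X Y (u : nat -> A) (s : A) :
  (forall q, (q < 2 * H * R)%N -> (X q <= M)%N) ->
  (forall q, (q < 2 * H * R)%N -> Y q = inv_f M R Cnt H V X q) ->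
  (forall pos, (pos < 2 * H)%N -> colR X (2 * H) pos = s * butterfly y R Cnt H V u pos) ->
  forall pos, (pos < 2 * H)%N -> colR Y (2 * H) pos = 2%:R * s * u pos.
Proof.
move=> hX h hu pos hp.
have H0 : (0 < H)%N by rewrite /H muln_gt0 hC expn_gt0.
pose l := (pos %% H)%N; pose low := (l %% V)%N; pose i := (l %/ V)%N.
have hlH : (l < H)%N by rewrite ltn_pmod.
have hlV : (low < V)%N by rewrite ltn_pmod.
have hi : (i < 2 ^ (a - t))%N by rewrite ltn_divLR // mulnC -hHV.
have hVi : (V * i.+1 <= H)%N by rewrite hHV leq_mul2l hi orbT.
rewrite mulnS in hVi.
have hl : l = (low + V * i)%N by rewrite /low {1}(divn_eq l V) -/i; lia.
set e := twid R Cnt V low.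
have he : (e < R)%N by exact: twid_lt.
have st0 : butterfly y R Cnt H V u (low + 2 * V * i)%N = u l + y ^+ e * u (l + H)%N.
  have hq : (low + 2 * V * i = low + V * (false + 2 * i))%N by lia.
  by rewrite /butterfly hq divn_low // modn_low // divn2_low // add0n oddM /= mul1r -hl.
have st1 : butterfly y R Cnt H V u (low + 2 * V * i + V)%N = u l - y ^+ e * u (l + H)%N.
  have hq : (low + 2 * V * i + V = low + V * (true + 2 * i))%N by rewrite /=; lia.
  by rewrite /butterfly hq divn_low // modn_low // divn2_low // oddD oddM /= expr1 mulN1r mulNr -hl.
have c0 := hu (low + 2 * V * i)%N; rewrite st0 in c0.
have c1 := hu (low + 2 * V * i + V)%N; rewrite st1 in c1.
case: (ltnP pos H) => hpH.
  have el : l = pos by rewrite /l modn_small.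
  have -> : colR Y (2 * H) pos = colR X (2 * H) (low + 2 * V * i) + colR X (2 * H) (low + 2 * V * i + V).
    rewrite /ycol -big_split /=; apply: eq_bigr => -[j hj] _ /=.
    rewrite h ?inrange // /inv_f modn_low // divn_low //.
    have -> : (H <= pos)%N = false by lia.
    rewrite -/l -/low -/i mul0n addn0.
    have -> : (R <= j)%N = false by lia.
    rewrite [(j %% R)%N]modn_small //.
    rewrite natr_modM natrD -mulrDl; congr (_ * _).
    rewrite addn0 mod0n !(natr_sgn false) ?mul1r.
    - by congr (_ + _%:R); congr X; lia.
    - by apply: hX; rewrite -addnA [(_ * j + V)%N]addnC addnA inrange //; lia.
    - by apply: hX; rewrite inrange //; lia.
  by rewrite c0 ?c1 ?el; [ring | lia | lia].
have hpl : pos = (l + H)%N.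
  have -> : l = (pos - H)%N by rewrite /l -{1}(subnKC hpH) modnDl modn_small //; lia.
  by rewrite subnK.
(* The digits of the difference of the two columns divided by [y ^+ e]. *)
pose v j : A := if (j + e < R)%N then ((X (low + 2 * V * i + 2 * H * (j + e))%N)%:R - (X (low + 2 * V * i + V + 2 * H * (j + e))%N)%:R)
   else - ((X (low + 2 * V * i + 2 * H * (j + e - R))%N)%:R - (X (low + 2 * V * i + V + 2 * H * (j + e - R))%N)%:R).
have hYv : colR Y (2 * H) pos = \sum_(j < R) v j * y ^+ j.
  apply: col_ext => j hj; rewrite h ?inrange // /inv_f modn_low // divn_low // hpH.
  rewrite -/l -/low -/i -/e mul1n natr_modM natrD.
  have hsx : ((nat_of_bool (R <= j + e) + true) %% 2 = nat_of_bool (j + e < R))%N.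
    by rewrite ltnNge; case: (_ <= _)%N.
  rewrite hsx !natr_sgn; last first.
  - by apply: hX; rewrite inrange ?ltn_pmod //; lia.
  - by apply: hX; rewrite -addnA [(_ * _ + V)%N]addnC addnA inrange ?ltn_pmod //; lia.
  rewrite /v; case: ltnP => hje.
    rewrite modn_small // mul1r expr1 mulN1r; congr (_ - _%:R); congr X; lia.
  have -> : ((j + e) %% R = j + e - R)%N.
    have -> : (j + e = R + (j + e - R))%N by lia.
    rewrite modnDl modn_small; lia.
  rewrite expr1 expr0 mul1r mulN1r opprB addrC; congr (_%:R - _); congr X; lia.
have hve : y ^+ e * \sum_(j < R) v j * y ^+ j =
   colR X (2 * H) (low + 2 * V * i) - colR X (2 * H) (low + 2 * V * i + V).
  rewrite -rot_sum // /ycol -sumrB; apply: eq_bigr => -[j hj] _ /=.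
  rewrite -mulrBl; congr (_ * _); rewrite /v.
  case: ltnP => hje.
    have -> : (j + R - e + e < R)%N = false by lia.
    have -> : (j + R - e + e - R = j)%N by lia.
    by rewrite opprK.
  have -> : (j - e + e = j)%N by lia.
  by rewrite hj.
have : y ^+ e * colR Y (2 * H) pos = y ^+ e * (2%:R * s * u pos).
  rewrite hYv hve c0 ?c1 ?hpl; [ring | lia | lia].
(* [y] is a unit: [- y ^+ (R - e)] is the inverse of [y ^+ e]. *)
move/(congr1 (fun z => - y ^+ (R - e) * z)); rewrite !mulrA.
have -> : - y ^+ (R - e) * y ^+ e = 1 by rewrite mulNr -exprD subnK ?hy ?opprK // ltnW.
by rewrite !mul1r.
Qed.

End Cols.

Section Cols2.
Variables (A : comNzRingType) (M : nat).
Hypothesis hM : M%:R = 0 :> A.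

Lemma col_comb (y : A) R H X Y : y ^+ R = -1 -> (0 < R)%N ->
  (forall q, (q < 2 * H * R)%N -> (X q <= M)%N) ->
  (forall q, (q < H * R)%N -> Y q = comb_f M R H X q) ->
  forall l, (l < H)%N -> ycol y R Y H l = ycol y R X (2 * H) l + y * ycol y R X (2 * H) (l + H).
Proof.
move=> hy hR hX h l hl.
(* [rot_sum] wants the shift 1 to be smaller than [R]; for [R = 1] the root [y] is itself -1. *)
have [R1|R1] : R = 1%N \/ (1 < R)%N by lia.
  rewrite /ycol R1 !big_ord1 h ?R1 ?muln0 ?addn0 ?muln1 // /comb_f.
  rewrite [(l %% H)%N]modn_small // divn_small // ?expr0 ?mulr1 ?modn1 ?muln0 ?addn0.
  rewrite natr_modM // natrD (natr_sgn _ true) //; last by apply: hX; rewrite R1; lia.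
  by rewrite R1 expr1 in hy; rewrite hy expr1.
have hr : y * ycol y R X (2 * H) (l + H) = \sum_(j < R) (-1) ^+ (j < 1)%N *
    (X (l + H + 2 * H * ((j + R - 1) %% R))%N)%:R * y ^+ j.
  rewrite -{1}[y]expr1 -(@rot_sum _ y R (fun j => (X (l + H + 2 * H * j)%N)%:R) 1) //.
  by apply: eq_bigr => j _; rewrite -(rot_idx (fun i => (X (l + H + 2 * H * i)%N)%:R)).
rewrite hr -big_split /=; apply: eq_bigr => -[j hj] _ /=.
rewrite h ?inrange // /comb_f modn_low // divn_low // natr_modM // natrD.
rewrite natr_sgn //; last by apply: hX; rewrite inrange ?ltn_pmod //; lia.
have -> : (j < 1)%N = (j == 0)%N by case: (j).
by ring.
Qed.

Lemma col_leaf (y : A) C X Y : (0 < M)%N -> y ^+ 2 = -1 ->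
  (forall q, (q < C * 2)%N -> Y q = leaf_f M C X q) ->
  forall c, (c < C)%N -> ycol y 2 Y C c = ycol y 2 X (2 * C) (2 * c) * ycol y 2 X (2 * C) (2 * c + 1).
Proof.
move=> M0 hy h c hc; rewrite /ycol !big_ord_recr !big_ord0 /= !add0r !expr0 !expr1 !mulr1 !muln0 !muln1 !addn0.
rewrite !h; [|lia|lia].
rewrite /leaf_f.
have [k1 k2] : (c + C < C * 2 /\ c < C * 2)%N by lia.
have e1 : (c + C = c + C * 1)%N by lia.
rewrite e1 modn_low // divn_low // [(c %% C)%N]modn_small // divn_small // eqxx.
rewrite !natr_modM // 2!natrD !natr_sgn //; try by rewrite ltnW // ltn_pmod.
rewrite !natr_modM // subn0 subnn !muln0 !muln1 !addn0 !natrM expr1 expr0.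
set a0 := (X (2 * c)%N)%:R; set b0 := (X (2 * c + 1)%N)%:R.
rewrite [(2 * c + 1 + 2 * C)%N]addnAC.
set a1 := (X _)%:R; set b1 := (X _)%:R.
transitivity (a0 * b0 + y ^+ 2 * (a1 * b1) + (a0 * b1 + a1 * b0) * y); last by ring.
by rewrite hy; ring.
Qed.

End Cols2.

(** * Recursion over the levels *)

Section Levels.
Variable M : nat.

(** Levels are specified by their values in every ring with [M = 0] and at every root [y], because
    an inner level gets evaluated at a power of [z] fixed by the outer ones. *)
Definition fwdlev (Cnt a r : nat) (X X' : nat -> nat) : Prop :=
  let R := (2 ^ (r - a))%N in let H := (Cnt * 2 ^ a)%N in
  forall (A : comNzRingType) (y : A), M%:R = 0 :> A -> y ^+ R = -1 ->
  forall pos, (pos < 2 * H)%N ->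
  ycol y R X' (2 * H) pos =
  butterflies y R Cnt H a.+1 (fun p => if (p < H)%N then ycol y R X H p else 0) pos.

(** Covers the inverse stages together with the folding [x^(2^a) = y]. Here [h] stands for an
    unreduced product known through its transform, and the factor is the omitted division. *)
Definition invlev (Cnt a r : nat) (Z Y : nat -> nat) : Prop :=
  let R := (2 ^ (r - a))%N in let H := (Cnt * 2 ^ a)%N in
  forall (A : comNzRingType) (y : A), M%:R = 0 :> A -> y ^+ R = -1 ->
  forall h : nat -> A,
  (forall pos, (pos < 2 * H)%N -> ycol y R Z (2 * H) pos = butterflies y R Cnt H a.+1 h pos) ->
  forall l, (l < H)%N -> ycol y R Y H l = (2 ^ a.+1)%:R * (h l + y * h (l + H)%N).

Definition leaflev (C : nat) (X Z : nat -> nat) : Prop :=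
  forall (A : comNzRingType) (y : A), M%:R = 0 :> A -> y ^+ 2 = -1 ->
  forall c, (c < C)%N -> ycol y 2 Z C c = ycol y 2 X (2 * C) (2 * c) * ycol y 2 X (2 * C) (2 * c + 1).

Fixpoint fwds (s : seq nat) Cnt r (X Xf : nat -> nat) : Prop :=
  if s is a :: s' then exists2 X', fwdlev Cnt a r X X' & fwds s' (2 * (Cnt * 2 ^ a))%N (r - a)%N X' Xf
  else Xf = X.

Fixpoint invs (s : seq nat) Cnt r (Z Y : nat -> nat) : Prop :=
  if s is a :: s' then exists2 Y', invs s' (2 * (Cnt * 2 ^ a))%N (r - a)%N Z Y' & invlev Cnt a r Y' Y
  else Y = Z.

Fixpoint lcnt (s : seq nat) Cnt := if s is a :: s' then lcnt s' (2 * (Cnt * 2 ^ a))%N else Cnt.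

Fixpoint lrad (s : seq nat) r : nat := if s is a :: s' then lrad s' (r - a)%N else r.

(** With [y^(2^(r-a)) = -1], a transform of length [2 ^ a.+1] uses the root
    [y ^+ (2 ^ (r - a - a))], hence [a <= r - a]. *)
Fixpoint lwf (s : seq nat) r : bool := if s is a :: s' then (2 * a <= r)%N && lwf s' (r - a)%N else true.

(** The factor left by inverse transforms that are not divided by their lengths. *)
Definition gain (s : seq nat) : nat := (\prod_(a <- s) 2 ^ a.+1)%N.

(** Passing from one variable to two, [z^(i + 2^a j) = z^i y^j], moves no data: the same array is
    read with [2 ^ a] times as many columns of fewer digits. *)
Lemma ycol_regroup (A : comNzRingType) (z : A) X Cnt a r c : (a <= r)%N ->
  ycol z (2 ^ r) X Cnt c =
  \sum_(i < 2 ^ a) z ^+ i * ycol (z ^+ (2 ^ a)) (2 ^ (r - a)) X (Cnt * 2 ^ a) (c + Cnt * i).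
Proof.
move=> har; rewrite /ycol.
have -> : \sum_(j < 2 ^ r) (X (c + Cnt * j)%N)%:R * z ^+ j =
   \sum_(j < 2 ^ a * 2 ^ (r - a)) (X (c + Cnt * j)%N)%:R * z ^+ j.
  by rewrite -expnD subnKC.
rewrite (big_ord_mul _ _ (fun j => (X (c + Cnt * j)%N)%:R * z ^+ j)).
apply: eq_bigr => i _; rewrite mulr_sumr; apply: eq_bigr => j _.
rewrite -exprM [in RHS]mulrCA -exprD; congr ((X _)%:R * _); lia.
Qed.

(** The factors of product [c] are the columns [2 * c] and [2 * c + 1]. By induction the inner
    levels multiply the transforms pointwise, which is the transform of the product polynomial in
    [x]; substituting [x = z] returns to the original columns. *)
Lemma conv_levels s : forall Cnt r X Xf Z Y, (0 < Cnt)%N -> lwf s r -> lrad s r = 1%N ->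
  fwds s (2 * Cnt) r X Xf -> leaflev (lcnt s Cnt) Xf Z -> invs s Cnt r Z Y ->
  forall (A : comNzRingType) (z : A), M%:R = 0 :> A -> z ^+ (2 ^ r) = -1 ->
  forall c, (c < Cnt)%N -> ycol z (2 ^ r) Y Cnt c =
    (gain s)%:R * (ycol z (2 ^ r) X (2 * Cnt) (2 * c) * ycol z (2 ^ r) X (2 * Cnt) (2 * c + 1)).
Proof.
elim: s => [|a s IH] Cnt r X Xf Z Y hC /=.
  by move=> _ -> -> hl -> A z hM hz c hc; rewrite /gain big_nil mul1r; apply: hl.
move=> /andP[ha hwf] hr [X' hX' hX] hl [Y' hY' hY] A z hM hz c hc.
pose R := (2 ^ (r - a))%N; pose H := (Cnt * 2 ^ a)%N; pose y := z ^+ (2 ^ a).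
have har : (a <= r)%N by lia.
have hy : y ^+ R = -1 by rewrite -exprM -expnD subnKC.
have h2a : (0 < 2 ^ a)%N by rewrite expn_gt0.
have hHc : (2 * (2 * Cnt * 2 ^ a) = 2 * (2 * H))%N by rewrite /H; lia.
rewrite hHc in hX.
have hH0 : (0 < 2 * H)%N by rewrite /H !muln_gt0 hC h2a.
have {}IH := IH _ _ _ _ _ _ hH0 hwf hr hX hl hY' A y hM hy.
pose p (b : bool) c : {poly A} := \poly_(i < 2 ^ a) ycol y R X (2 * H) (2 * c + b + 2 * Cnt * i).
have phorner b c' x : (p b c').[x] = \sum_(i < 2 ^ a) ycol y R X (2 * H) (2 * c' + b + 2 * Cnt * i) * x ^+ i.
  by rewrite horner_poly.
(* Coefficients of the unreduced product in [x], times the gain of the inner levels: the array that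
   [invlev] recovers. *)
pose h (pos : nat) : A := (gain s)%:R * (p false (pos %% Cnt)%N * p true (pos %% Cnt)%N)`_(pos %/ Cnt).
have sizep c' : (size (p false c' * p true c')%R <= 2 ^ a.+1)%N.
  apply: leq_trans (size_polyMleq _ _) _.
  have s1 : (size (p false c') <= 2 ^ a)%N by rewrite size_poly.
  have s2 : (size (p true c') <= 2 ^ a)%N by rewrite size_poly.
  rewrite expnS; lia.
have hsum c' x : (c' < Cnt)%N -> \sum_(i < 2 ^ a.+1) h (c' + Cnt * i)%N * x ^+ i =
    (gain s)%:R * ((p false c').[x] * (p true c').[x]).
  move=> hc'; rewrite -hornerM (horner_coef_wide _ (sizep c')) mulr_sumr.
  by apply: eq_bigr => i _; rewrite /h modn_low // divn_low // mulrA.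
have hev b c' g : (c' < Cnt)%N -> (g < 2 ^ a.+1)%N ->
   ycol y R X' (2 * (2 * H)) (2 * (c' + Cnt * g) + nat_of_bool b) = (p b c').[y ^+ (2 ^ (r - a - a) * g)].
  move=> hc' hg.
  have hcb : (2 * c' + b < 2 * Cnt)%N by case: b; lia.
  have hlt : (2 * c' + b + 2 * Cnt * g < 2 * (2 * H))%N.
    rewrite -hHc [(2 * (2 * Cnt * 2 ^ a))%N]mulnCA -expnS inrange //.
  have -> : (2 * (c' + Cnt * g) + b = 2 * c' + b + 2 * Cnt * g)%N by lia.
  have := hX' A y hM hy (2 * c' + b + 2 * Cnt * g)%N.
  rewrite hHc => -> //.
  have haa : (a <= r - a)%N by lia.
  rewrite (butterflies_eval _ hy erefl haa) //.
  have e2 : (2 ^ a.+1 = 2 ^ a + 2 ^ a)%N by rewrite expnS; lia.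
  rewrite (big_ord_cat (fun i => (if (2 * c' + b + 2 * Cnt * i < 2 * Cnt * 2 ^ a)%N then ycol y (2 ^ (r - a)) X (2 * Cnt * 2 ^ a) (2 * c' + b + 2 * Cnt * i) else 0) * (y ^+ (2 ^ (r - a - a) * g)) ^+ i) e2).
  rewrite [X in _ + X]big1 ?addr0 ?phorner => [|i _].
    apply: eq_bigr => i _; rewrite inrange // /H.
    by rewrite -mulnA.
  have -> : (2 * c' + b + 2 * Cnt * (2 ^ a + i) < 2 * Cnt * 2 ^ a)%N = false.
    rewrite mulnDr; lia.
  by rewrite mul0r.
have hZ pos : (pos < 2 * H)%N -> ycol y R Y' (2 * H) pos = butterflies y R Cnt H a.+1 h pos.
  move=> hp; rewrite IH //.
  have hpc : (pos %% Cnt < Cnt)%N by rewrite ltn_pmod.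
  have hpg : (pos %/ Cnt < 2 ^ a.+1)%N by rewrite ltn_divLR // expnS; rewrite /H in hp; lia.
  have hpe : pos = (pos %% Cnt + Cnt * (pos %/ Cnt))%N by rewrite {1}(divn_eq pos Cnt); lia.
  have haa : (a <= r - a)%N by lia.
  rewrite hpe (butterflies_eval _ hy erefl haa) // hsum //.
  by rewrite -hev // -hev //= addn0.
have {}hY := hY A y hM hy h hZ.
rewrite (ycol_regroup _ _ _ _ har).
(* As [z ^+ (2 ^ a) = y], the folded columns sum to the product polynomial evaluated at [x = z]. *)
transitivity ((2 ^ a.+1)%:R * \sum_(i < 2 ^ a.+1) h (c + Cnt * i)%N * z ^+ i).
  have -> : \sum_(i < 2 ^ a.+1) h (c + Cnt * i)%N * z ^+ i =
    \sum_(i < 2 ^ a) (h (c + Cnt * i)%N + y * h (c + Cnt * i + H)%N) * z ^+ i.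
    have e2 : (2 ^ a.+1 = 2 ^ a + 2 ^ a)%N by rewrite expnS; lia.
    rewrite (big_ord_cat (fun i => h (c + Cnt * i)%N * z ^+ i) e2) -big_split /=.
    apply: eq_bigr => i _; rewrite exprD -/y.
    have -> : (c + Cnt * (2 ^ a + i) = c + Cnt * i + H)%N by rewrite /H; lia.
    by ring.
  rewrite mulr_sumr; apply: eq_bigr => i _.
  rewrite hY ?inrange //; ring.
rewrite hsum // !(ycol_regroup _ _ _ _ har) !phorner /gain big_cons natrM -!mulrA; congr (_ * (_ * _)).
congr (_ * _); apply: eq_bigr => i _; rewrite mulrC /H -!mulnA //= ?addn0 //.
Qed.

Lemma lcnt_rcons s a Cnt : lcnt (rcons s a) Cnt = (2 * (lcnt s Cnt * 2 ^ a))%N.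
Proof. by elim: s Cnt => //= b s IH Cnt. Qed.

Lemma lrad_rcons s a r : lrad (rcons s a) r = (lrad s r - a)%N.
Proof. by elim: s r => //= b s IH r. Qed.

Lemma lcnt2 s Cnt : lcnt s (2 * Cnt) = (2 * lcnt s Cnt)%N.
Proof. by elim: s Cnt => //= b s IH Cnt; rewrite -IH; congr lcnt; lia. Qed.

Lemma lcnt_gt0 s Cnt : (0 < Cnt)%N -> (0 < lcnt s Cnt)%N.
Proof. by elim: s Cnt => //= b s IH Cnt h; apply: IH; rewrite !muln_gt0 h expn_gt0. Qed.

Lemma fwds_rcons s a Cnt r X X' X'' : fwds s Cnt r X X' -> fwdlev (lcnt s Cnt) a (lrad s r) X' X'' ->
  fwds (rcons s a) Cnt r X X''.
Proof.
elim: s Cnt r X => [|b s IH] Cnt r X /=; first by move=> -> h; exists X''.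
by move=> [X1 h1 h2] h3; exists X1 => //; apply: IH h3.
Qed.

Lemma gain_eq s r : lwf s r -> (gain s * 2 ^ lrad s r = 2 ^ (r + size s))%N.
Proof.
elim: s r => [|b s IH] r /=; first by rewrite /gain big_nil mul1n addn0.
move=> /andP[hb hw]; rewrite /gain big_cons -mulnA [X in (_ * X)%N]IH // -expnD; congr expn; lia.
Qed.

(** Padding doubles the number of cells at every level, whatever the exponent [a]. *)
Lemma lcnt_eq s r Cnt : lwf s r -> (lcnt s Cnt * 2 ^ lrad s r = Cnt * 2 ^ (r + size s))%N.
Proof.
elim: s r Cnt => [|b s IH] r Cnt /=; first by rewrite addn0.
move=> /andP[hb hw]; rewrite IH // mulnCA -!mulnA; congr (_ * _)%N.
rewrite -expnD -expnS; congr expn; lia.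
Qed.

End Levels.

(** * Choice of the levels and reading of the coefficients *)

Fixpoint levs i r : seq nat := if i is i'.+1 then r./2 :: levs i' (r - r./2)%N else [::].

Lemma size_levs i r : size (levs i r) = i.
Proof. by elim: i r => //= i IH r; rewrite IH. Qed.

Lemma levs_rcons i r : levs i.+1 r = rcons (levs i r) (lrad (levs i r) r)./2.
Proof. by elim: i r => //= i IH r; rewrite -IH. Qed.

Lemma lwf_levs i r : lwf (levs i r) r.
Proof. by elim: i r => //= i IH r; rewrite IH andbT; lia. Qed.

Lemma lrad_levs_gt0 i r : (0 < r)%N -> (0 < lrad (levs i r) r)%N.
Proof. by elim: i r => //= i IH r h; apply: IH; lia. Qed.

(** The exponent left is a rounded-up half, so the quantity that truly halves is the exponent minus
    one. *)
Lemma lrad_levs_le i r : (0 < r)%N -> ((lrad (levs i r) r).-1 * 2 ^ i <= r.-1)%N.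
Proof.
elim: i r => [|i IH] r h /=; first by rewrite muln1.
have h2 : (0 < r - r./2)%N by lia.
have := IH _ h2; rewrite expnSr mulnA; lia.
Qed.

(* The transform depth is logarithmic in the exponent, so that the total length only
   grows by a factor [2 ^ L <= 2 * r]. *)
Lemma levs_depth r : (1 < r)%N -> exists L, [/\ lrad (levs L r) r = 1%N,
  forall i, (i < L)%N -> (1 < lrad (levs i r) r)%N, (2 ^ L <= 2 * r)%N & (L <= r)%N].
Proof.
move=> r1; have r0 : (0 < r)%N by lia.
have ex : exists i, (lrad (levs i r) r <= 1)%N.
  exists r; have := lrad_levs_le r r0; have := ltn_expl r (ltnSn 1).
  case: (lrad _ _) => [|[|x]] //= h1 h2.
  have : (1 * 2 ^ r <= x.+1 * 2 ^ r)%N by rewrite leq_mul2r orbT.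
  by lia.
exists (ex_minn ex); case: ex_minnP => L hL hmin.
have h1 : lrad (levs L r) r = 1%N by have := lrad_levs_gt0 L r0; lia.
have h2 i : (i < L)%N -> (1 < lrad (levs i r) r)%N.
  by move=> hi; rewrite ltnNge; apply/negP => /hmin; rewrite leqNgt hi.
have h3 : (2 ^ L <= 2 * r)%N.
  case: (L) h2 => [|L'] h2; first by rewrite expn0; lia.
  have := h2 _ (ltnSn L'); have := lrad_levs_le L' r0; rewrite expnS.
  case: (lrad _ _) => [|[|x]] //= h4 _.
  have : (1 * 2 ^ L' <= x.+1 * 2 ^ L')%N by rewrite leq_mul2r orbT.
  by lia.
split=> //.
by case: (L) h3 => [|L'] //; rewrite expnS leq_pmul2l // => h3; apply: leq_trans h3; apply: ltn_expl.
Qed.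


Lemma nth_levs L j r : (j < L)%N -> nth 0%N (levs L r) j = (lrad (levs j r) r)./2.
Proof.
elim: L => // L IH; rewrite ltnS leq_eqVlt levs_rcons nth_rcons size_levs => /orP[/eqP ->|hj].
  by rewrite ltnn eqxx.
by rewrite hj IH.
Qed.

(** Since the second factor has length [L], the degrees from [D] on wrap only into coefficients
    below [L - 1]. The bound [L <= k.+1] avoids them, and the plain product is read. *)
Lemma conv_coef (M : nat) s r L X Xf Z Y k : (1 < M)%N -> (0 < r)%N -> lwf s r -> lrad s r = 1%N ->
  fwds M s 2 r X Xf -> leaflev M (lcnt s 1) Xf Z -> invs M s 1 r Z Y ->
  (forall b, (L <= b < 2 ^ r)%N -> X (2 * b + 1)%N = 0%N) -> (0 < L <= 2 ^ r)%N ->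
  (L <= k.+1 <= 2 ^ r)%N ->
  (Y k = gain s * \sum_(b < L) X (2 * (k - b)) * X (2 * b + 1) %[mod M])%N.
Proof.
move=> M1 r0 hwf hr hX hl hY hg /andP[L0 hL] /andP[Lk kD].
set D := (2 ^ r)%N in hg hL kD.
have D0 : (0 < D)%N by rewrite expn_gt0.
(* In this quotient, evaluation at the class of ['X] forgets nothing about polynomials of degree
   below [D]. *)
pose h : {poly 'Z_M} := 'X^D + 1%:P.
have hmon : h \is monic by rewrite /h monicXnaddC.
have hsz : size h = D.+1 by rewrite /h size_XnaddC.
have hmk : mk_monic h = h by rewrite /mk_monic hmon hsz ltnS D0.
pose iq := in_qpoly h.
have iqD p q : iq (p + q) = iq p + iq q by exact: in_qpolyD.
have iqM p q : iq (p * q) = iq p * iq q by exact: in_qpolyM.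
have iqX n : iq ('X^n) = (iq 'X) ^+ n by exact: rmorphXn.
have iqn n : iq n%:R = n%:R by exact: rmorph_nat.
have iqs n (F : nat -> {poly 'Z_M}) : iq (\sum_(i < n) F i) = \sum_(i < n) iq (F i) by exact: rmorph_sum.
have iq0 : iq h = 0.
  by apply/val_inj; rewrite /= hmk Pdiv.RingMonic.rmodpp.
have hz : (iq 'X) ^+ D = -1.
  by apply/eqP; rewrite -iqX -addr_eq0 -[1](iqn 1%N) -iqD -[X in _ + X]polyC1 -/h iq0.
have hM : M%:R = 0 :> {poly %/ h}.
  by rewrite -iqn -polyC_natr pchar_Zp // /iq polyC0 in_qpoly0.
have iqcol (G : nat -> nat) W c : ycol (iq 'X) D G W c = iq (\poly_(i < D) (G (c + W * i)%N)%:R).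
  rewrite poly_def (iqs _ (fun i => (G (c + W * i)%N)%:R *: 'X^i)); apply: eq_bigr => i _.
  by rewrite -mul_polyC iqM iqX polyC_natr iqn.
have := conv_levels (ltn0Sn 0) hwf hr hX hl hY hM hz (ltn0Sn 0).
rewrite !iqcol ?muln0 ?muln1 ?add0n.
set PY := \poly_(i < D) _; set PF := \poly_(i < D) _; set PG := \poly_(i < D) _.
rewrite -(iqM PF PG) -iqn => hiq.
pose Q : {poly 'Z_M} := PF * PG.
(* The remainder of [Q] modulo ['X^D + 1]: the upper part is subtracted from the lower one. *)
pose lh := take_poly D Q - drop_poly D Q.
have hQ : iq Q = iq lh.
  have iqN p : iq (- p) = - iq p by exact: rmorphN.
  by rewrite -(poly_take_drop D Q) iqD iqM iqX hz /lh iqD iqN mulrN1.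
have sF : (size PF <= D)%N by rewrite size_poly.
have sG : (size PG <= L)%N.
  apply/leq_sizeP => j hj; rewrite coef_poly; case: ifP => // hjD.
  by rewrite addnC hg ?hj ?hjD.
have sQ : (size Q <= (D + L).-1)%N.
  by apply: leq_trans (size_polyMleq _ _) _; rewrite -!subn1 leq_sub2r // leq_add.
have slh : (size ((gain s)%:R * lh)%R <= D)%N.
  rewrite -polyC_natr mul_polyC; apply: leq_trans (size_scale_leq _ _) _.
  apply: leq_trans (size_polyD _ _) _; rewrite size_polyN geq_max size_take_poly size_drop_poly.
  by rewrite leq_subLR; apply: leq_trans sQ _; lia.
(* Both sides have size at most [D], so equality of classes is equality of polynomials. *)
have ePY : PY = (gain s)%:R * lh.
  have : iq PY = iq ((gain s)%:R * lh) by rewrite hiq -/Q hQ -iqM.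
  move/(congr1 val); rewrite /iq /= -/(in_qpoly _ _).
  by rewrite !Pdiv.CommonRing.rmodp_small // hmk hsz ltnS // size_poly.
have := congr1 (fun p : {poly 'Z_M} => p`_k) ePY.
rewrite -polyC_natr mul_polyC coefZ coefB coef_take_poly coef_drop_poly coef_poly kD.
rewrite [Q`_(k + D)]nth_default ?subr0; last by apply: leq_trans sQ _; lia.
rewrite /Q coefMr.
have -> : \sum_(j < k.+1) PF`_(k - j) * PG`_j = (\sum_(b < L) X (2 * (k - b)) * X (2 * b + 1))%N%:R.
  rewrite natr_sum (big_ord_cat (fun j => PF`_(k - j) * PG`_j) (esym (subnKC Lk))).
  rewrite [X in _ + X]big1 ?addr0 => [|i _].
    apply: eq_bigr => -[b hb] _ /=; rewrite !coef_poly natrM.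
    have -> : (k - b < D)%N by lia.
    have -> : (b < D)%N by lia.
    by rewrite !add0n addnC.
  by rewrite [PG`__]nth_default ?mulr0 //; apply: leq_trans sG _; lia.
rewrite -natrM => /(congr1 val); rewrite /= !val_Zp_nat // add0n mul1n.
done.
Qed.

End Algebra.

(** * The convolution program *)

Ltac sp := repeat match goal with
  | |- _ /\ _ => split | |- and3 _ _ _ => split | |- True => exact I
  | |- is_true true => exact isT end.

Notation vM := 3 (only parsing).
Notation vQ := 10 (only parsing).
Notation vC := 11 (only parsing).
Notation vR := 12 (only parsing).
Notation vH := 13 (only parsing).
Notation vV := 14 (only parsing).
Notation vL := 15 (only parsing).
Notation vA := 16 (only parsing).
Notation vT := 17 (only parsing).
Notation tPos := 20 (only parsing).
Notation tJ := 21 (only parsing).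
Notation tLow := 22 (only parsing).
Notation tE := 23 (only parsing).
Notation tS := 24 (only parsing).
Notation tLo := 25 (only parsing).
Notation tHi := 26 (only parsing).
Notation aX := 0 (only parsing).
Notation aY := 1 (only parsing).

Definition sgnE s x := (EC 1 |-| s) |*| x |+| s |*| (EV vM |-| x).
Definition splitE w := tPos <~ EV vQ |%| w ;; tJ <~ EV vQ |/| w.
Definition twidE := EV tLow |/| EV vC |*| (EV vR |/| (EV vV |/| EV vC)).
Definition gatherE b e := SPass vQ (EV vT) aX aY b e.
Definition ld e := EArr aX e.
Definition dH := EC 2 |*| EV vH.

Definition padS := gatherE (splitE dH) ((EV tPos |<| EV vH) |*| ld (EV tPos |+| EV vH |*| EV tJ)).

Definition stageS := gatherE
  (tPos <~ EV vQ |%| dH ;; tJ <~ EV vQ |/| dH ;;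
   tLow <~ EV tPos |%| EV vV ;;
   tLo <~ EV tLow |+| EV vV |*| (EV tPos |/| (EC 2 |*| EV vV)) ;;
   tE <~ twidE ;;
   tS <~ (EV tPos |/| EV vV |%| EC 2 |+| (EV tJ |<| EV tE)) |%| EC 2)
  ((ld (EV tLo |+| dH |*| EV tJ)
    |+| sgnE (EV tS) (ld (EV tLo |+| EV vH |+| dH |*| ((EV tJ |+| EV vR |-| EV tE) |%| EV vR)))) |%| EV vM).

(** Here [tE] holds the digit index [j] of [inv_f] and [tJ] the shifted one [je]; [tHi] is taken
    before [tPos] is reduced modulo [vH]. *)
Definition invS := gatherE
  (tPos <~ EV vQ |%| dH ;; tE <~ EV vQ |/| dH ;;
   tHi <~ (EV vH |<| EV tPos |+| EC 1) ;;
   tPos <~ EV tPos |%| EV vH ;;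
   tLow <~ EV tPos |%| EV vV ;;
   tJ <~ EV tE |+| EV tHi |*| twidE ;;
   tS <~ (EV vR |<| EV tJ |+| EC 1) ;;
   tLo <~ EV tLow |+| EC 2 |*| EV vV |*| (EV tPos |/| EV vV) |+| dH |*| (EV tJ |%| EV vR))
  ((sgnE (EV tS) (ld (EV tLo)) |+| sgnE ((EV tS |+| EV tHi) |%| EC 2) (ld (EV tLo |+| EV vV))) |%| EV vM).

Definition combS := gatherE (splitE (EV vH))
  ((ld (EV tPos |+| dH |*| EV tJ)
    |+| sgnE (EV tJ |=| EC 0) (ld (EV tPos |+| EV vH |+| dH |*| ((EV tJ |+| EV vR |-| EC 1) |%| EV vR)))) |%| EV vM).

Definition leafS := gatherE (splitE (EV vC))
  ((ld (EC 2 |*| EV tPos) |*| ld (EC 2 |*| EV tPos |+| EC 1 |+| EC 2 |*| EV vC |*| EV tJ)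
    |+| sgnE (EV tJ |=| EC 0)
         ((ld (EC 2 |*| EV tPos |+| EC 2 |*| EV vC)
            |*| ld (EC 2 |*| EV tPos |+| EC 1 |+| EC 2 |*| EV vC |*| (EC 1 |-| EV tJ))) |%| EV vM)) |%| EV vM).

(** [U] bounds indices and cells; the slack in [8 * (U * U) < B] lets sums of two products with
    small factors fit in a word. *)
Lemma ltB_add B U a b : 8 * (U * U) < B -> a <= 4 * (U * U) -> b <= 4 * (U * U) -> a + b < B.
Proof. by lia. Qed.
Lemma ltB_mul B U a b : 8 * (U * U) < B -> a <= U -> b <= U -> a * b < B.
Proof. by move=> hB h1 h2; have := leq_mul h1 h2; lia. Qed.
Lemma le4_mul U a b : a <= U -> b <= U -> a * b <= 4 * (U * U).
Proof. by move=> h1 h2; have := leq_mul h1 h2; lia. Qed.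

Ltac leU := match goal with
  | |- is_true (_ %/ _ <= _) => apply: leq_trans (leq_div _ _) _; leU
  | |- is_true (_ %% _ <= _) => apply: leq_trans (leq_mod _ _) _; leU
  | |- is_true (nat_of_bool _ <= _) => apply: leq_trans (leq_b1 _) _; lia
  | |- is_true (_ * _ <= 4 * (_ * _)) => apply: le4_mul; leU
  | |- _ => lia end.
Ltac bd := sp; match goal with
  | hB : is_true (8 * (?U * ?U) < ?B) |- is_true (_ * _ < ?B) => apply: (ltB_mul hB); leU
  | hB : is_true (8 * (?U * ?U) < ?B) |- is_true (_ + _ < ?B) => apply: (ltB_add hB); leU
  | |- _ => idtac end.

(* Keeps an equation out of sight of [lia], which would otherwise expand the
   divisions it contains. *)
Definition is_val (v x : nat) := v = x.

Section Conv.
Variables (B Sz U M : nat) (T : seq nat) (P : seq (option nat)).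
Hypothesis hB : 8 * (U * U) < B.
Hypothesis hSz : Sz <= U.
Hypothesis hM : 1 < M <= U.
Notation tri := (tri B Sz T P).

(** The value becomes a fresh [v]: nested quotients and remainders would otherwise pile up in the
    conditions of the next assignments. *)
Lemma tri_let F x e st (Q : state -> Prop) : 0 < F -> safe B Sz T P e st ->
  (forall v, is_val v (ev T P e st) -> Q (setv st x v)) -> tri F (SAsg x e) st Q.
Proof. by move=> h1 h2 hQ; apply: tri_asg => //; apply: hQ. Qed.

Let U1 : 1 < U. Proof. by lia. Qed.
Let UU : U <= U * U. Proof. by rewrite leq_pmulr; lia. Qed.

Lemma leU_mul a b : a <= U -> b <= U -> a * b <= U * U.
Proof. exact: leq_mul. Qed.

Lemma sgn_le s x : s <= 1 -> x <= M -> sgn M s x <= M.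
Proof. by case: s => [|[|]] //= _ hx; rewrite /sgn; lia. Qed.

Lemma safe_bin o a b st : safe B Sz T P a st -> safe B Sz T P b st ->
  safeop B o (ev T P a st) (ev T P b st) -> safe B Sz T P (EBin o a b) st.
Proof. by []. Qed.

Lemma safe_modM a b st : safe B Sz T P a st -> safe B Sz T P b st -> ev T P a st <= M ->
  ev T P b st <= M -> safe B Sz T P ((a |+| b) |%| EV vM) st.
Proof. by move=> h1 h2 h3 h4; apply: safe_bin => //; apply: safe_bin => //=; lia. Qed.

Lemma safe_ld e st v : ev T P e st = v -> v < Sz -> safe B Sz T P e st -> safe B Sz T P (ld e) st.
Proof. by move=> <-. Qed.

Lemma safe_sgn s x st : safe B Sz T P s st -> safe B Sz T P x st ->
  ev T P s st <= 1 -> ev T P x st <= M -> vr st vM = M -> safe B Sz T P (sgnE s x) st.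
Proof.
move=> h1 h2 h3 h4 h5; split=> /=; last first.
- rewrite h5; have : sgn M (ev T P s st) (ev T P x st) <= M by apply: sgn_le.
  by rewrite /sgn; lia.
- by split=> //; rewrite h5; apply: (ltB_mul hB); lia.
- by split=> //; apply: (ltB_mul hB); lia.
Qed.

Lemma ev_sgn s x st : vr st vM = M -> ev T P (sgnE s x) st = sgn M (ev T P s st) (ev T P x st).
Proof. by move=> h /=; rewrite h. Qed.

Lemma tri_gather f F k b e st : 0 < F -> vr st vT = k -> k <= Sz ->
  vQ \notin wv b -> vT \notin wv b -> wa b = [::] ->
  (forall q st', q < k -> frame (vQ :: wv b) [:: aY] st st' -> vr st' vQ = q ->
     tri F b st' (yields B Sz T P e (f q))) ->
  tri (F * k.+1) (gatherE b e) st (fun st' => forall q, q < k -> ar st' aX q = f q).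
Proof.
move=> F0 hk hS hQ hT hw hb.
apply: (@tri_pass B Sz T P f k F) => //=; try by lia.
  by move=> st' [hf _]; rewrite hf //= !inE negb_or hT.
Qed.

Lemma tri_stage F Cnt a t R H V st : 0 < F -> 0 < Cnt -> t <= a -> 2 ^ a %| R -> 0 < R ->
  is_val H (Cnt * 2 ^ a) -> is_val V (Cnt * 2 ^ t) ->
  vr st vM = M -> vr st vC = Cnt -> vr st vR = R -> vr st vH = H -> vr st vV = V ->
  vr st vT = 2 * H * R -> 2 * H * R <= Sz ->
  (forall q, q < 2 * H * R -> ar st aX q <= M) ->
  tri (F * (2 * H * R).+1) stageS st (fun st' =>
    forall q, q < 2 * H * R -> ar st' aX q = stage_f M R Cnt H V (ar st aX) q).
Proof.
move=> F0 hC hta hRa hR0 HE VE vm vc vR' vh vv vt hT hX.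
have hH0 : 0 < H by rewrite HE muln_gt0 hC expn_gt0.
have hV0 : 0 < V by rewrite VE muln_gt0 hC expn_gt0.
have hVH : V <= H by rewrite HE VE leq_mul2l leq_exp2l ?hta ?orbT.
have hCV : Cnt <= V by rewrite VE leq_pmulr ?expn_gt0.
have hHT : 2 * H <= 2 * H * R by rewrite leq_pmulr.
have hRT : R <= 2 * H * R by rewrite leq_pmull; lia.
apply: tri_gather => // q st' hq [hf1 hf2] hvq.
have vm' : vr st' vM = M by rewrite hf1.
have vc' : vr st' vC = Cnt by rewrite hf1.
have vR2 : vr st' vR = R by rewrite hf1.
have vh' : vr st' vH = H by rewrite hf1.
have vv' : vr st' vV = V by rewrite hf1.
have hx' : forall i, ar st' aX i = ar st aX i by move=> i; rewrite hf2.
clear hf1 hf2 vm vc vR' vh vv vt.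
have dHB : 2 * H < B by apply: (ltB_mul hB); lia.
apply: tri_seq; apply: tri_let => //=; first by rewrite vh'; sp.
rewrite vh' hvq => pos posE.
apply: tri_seq; apply: tri_let => //=; rewrite /upd /= ?vh' ?hvq; first by sp.
move=> j jE.
apply: tri_seq; apply: tri_let => //=; rewrite /upd /= ?vv'.
move=> low lowE.
have hpos : pos < 2 * H by rewrite posE ltn_pmod; lia.
have hj : j < R by rewrite jE ltn_divLR 1?mulnC //; lia.
have hlow : low < V by rewrite lowE ltn_pmod.
have hlo : low + V * (pos %/ (2 * V)) < H by rewrite lowE HE VE; apply: lo_lt => //; rewrite -HE.
apply: tri_seq; apply: tri_let => //=; rewrite /upd /= ?vv'.
  by bd.
move=> lo loE; rewrite -loE in hlo.
have he : twid R Cnt V low < R by rewrite VE; apply: (twid_lt hC hta) => //; rewrite -VE.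
apply: tri_seq; apply: tri_let => //=; rewrite /upd /= ?vv' ?vc' ?vR2.
  by bd.
rewrite -/(twid _ _ _ _) => e eE; rewrite -eE in he.
apply: tri_let => //=; rewrite /upd /= ?vv'; first by bd.
move=> s sE.
have hs : s <= 1 by rewrite sE -ltnS ltn_pmod.
have i1 : lo + 2 * H * j < 2 * H * R by apply: inrange => //; lia.
have hj' : (j + R - e) %% R < R by rewrite ltn_pmod.
have i2 : lo + H + 2 * H * ((j + R - e) %% R) < 2 * H * R by apply: inrange => //; lia.
set st2 := setv _ tS _.
have m2 : vr st2 vM = M by rewrite /= /upd /=.
have l1 : ev T P (ld (EV tLo |+| dH |*| EV tJ)) st2 = ar st aX (lo + 2 * H * j).
  by rewrite /= /upd /= vh' hx'.
have l2 : ev T P (ld (EV tLo |+| EV vH |+| dH |*| ((EV tJ |+| EV vR |-| EV tE) |%| EV vR))) st2 =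
    ar st aX (lo + H + 2 * H * ((j + R - e) %% R)).
  by rewrite /= /upd /= vh' vR2 hx'.
have s2 : ev T P (EV tS) st2 = s by [].
have b1 := hX _ i1; have b2 := hX _ i2.
split.
  apply: safe_modM; rewrite ?ev_sgn // ?l1 ?l2 ?s2 ?sgn_le //.
  - by apply: safe_ld; rewrite /= /upd /= ?vh' //; [lia | bd].
  - apply: safe_sgn => //; rewrite ?s2 ?l2 //.
    by apply: safe_ld; rewrite /= /upd /= ?vh' ?vR2 //; [lia | bd].
have -> : forall a b st, ev T P ((a |+| b) |%| EV vM) st = (ev T P a st + ev T P b st) %% vr st vM by [].
rewrite ev_sgn // l1 l2 s2 m2 /stage_f -posE -jE -lowE -loE -eE.
by rewrite sE.
Qed.

Lemma tri_pad F R H st : 0 < F -> 0 < R -> 0 < H ->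
  vr st vH = H -> vr st vT = 2 * H * R -> 2 * H * R <= Sz ->
  (forall q, q < H * R -> ar st aX q <= M) ->
  tri (F * (2 * H * R).+1) padS st (fun st' =>
    forall q, q < 2 * H * R -> ar st' aX q = pad_f H (ar st aX) q).
Proof.
move=> F0 hR0 hH0 vh vt hT hX.
have hHT : 2 * H <= 2 * H * R by rewrite leq_pmulr.
have hRT : R <= 2 * H * R by rewrite leq_pmull; lia.
apply: tri_gather => // q st' hq [hf1 hf2] hvq.
have vh' : vr st' vH = H by rewrite hf1.
have hx' : forall i, ar st' aX i = ar st aX i by move=> i; rewrite hf2.
clear hf1 hf2 vh vt.
have dHB : 2 * H < B by apply: (ltB_mul hB); lia.
apply: tri_seq; apply: tri_let => //=; first by rewrite vh'; sp.
rewrite vh' hvq => pos posE.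
apply: tri_let => //=; rewrite /upd /= ?vh' ?hvq; first by sp.
move=> j jE.
have hpos : pos < 2 * H by rewrite posE ltn_pmod; lia.
have hj : j < R by rewrite jE ltn_divLR 1?mulnC //; lia.
have i1 : pos + 2 * H * j < 2 * H * R by apply: inrange => //; lia.
have i2 : pos + H * j < 2 * H * R by rewrite -mulnA in i1; lia.
split; last by rewrite /= /upd /= vh' hx' /pad_f -posE -jE.
apply: safe_bin => //.
  by apply: safe_ld; rewrite /= /upd /= ?vh' //; [lia | bd].
rewrite /= /upd /= vh' hx'; case: (ltnP pos H) => hp; last by rewrite /= mul0n; lia.
rewrite /= mul1n; have := hX (pos + H * j) (inrange hp hj); lia.
Qed.

Lemma tri_comb F R H st : 0 < F -> 0 < R -> 0 < H ->
  vr st vM = M -> vr st vR = R ->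
  vr st vH = H -> vr st vT = H * R -> 2 * H * R <= Sz ->
  (forall q, q < 2 * H * R -> ar st aX q <= M) ->
  tri (F * (H * R).+1) combS st (fun st' =>
    forall q, q < H * R -> ar st' aX q = comb_f M R H (ar st aX) q).
Proof.
move=> F0 hR0 hH0 vm vr' vh vt hT hX.
have hHT : 2 * H <= 2 * H * R by rewrite leq_pmulr.
have hRT : R <= 2 * H * R by rewrite leq_pmull; lia.
apply: tri_gather => //; first by apply: leq_trans hT; rewrite -mulnA leq_pmull.
move=> q st' hq [hf1 hf2] hvq.
have vm' : vr st' vM = M by rewrite hf1.
have vR2 : vr st' vR = R by rewrite hf1.
have vh' : vr st' vH = H by rewrite hf1.
have hx' : forall i, ar st' aX i = ar st aX i by move=> i; rewrite hf2.
clear hf1 hf2 vm vr' vh vt.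
have dHB : 2 * H < B by apply: (ltB_mul hB); lia.
apply: tri_seq; apply: tri_let => //=; rewrite vh' hvq => pos posE.
apply: tri_let => //=; rewrite /upd /= ?vh' ?hvq.
move=> j jE.
have hpos : pos < H by rewrite posE ltn_pmod; lia.
have hj : j < R by rewrite jE ltn_divLR 1?mulnC //; lia.
have hj' : (j + R - 1) %% R < R by rewrite ltn_pmod.
have i1 : pos + 2 * H * j < 2 * H * R by apply: inrange => //; lia.
have i2 : pos + H + 2 * H * ((j + R - 1) %% R) < 2 * H * R by apply: inrange => //; lia.
set st2 := setv _ tJ _.
have m2 : vr st2 vM = M by rewrite /= /upd /=.
have l1 : ev T P (ld (EV tPos |+| dH |*| EV tJ)) st2 = ar st aX (pos + 2 * H * j).
  by rewrite /= /upd /= vh' hx'.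
have l2 : ev T P (ld (EV tPos |+| EV vH |+| dH |*| ((EV tJ |+| EV vR |-| EC 1) |%| EV vR))) st2 =
    ar st aX (pos + H + 2 * H * ((j + R - 1) %% R)).
  by rewrite /= /upd /= vh' vR2 hx'.
have s2 : ev T P (EV tJ |=| EC 0) st2 = (j == 0) by [].
have b1 := hX _ i1; have b2 := hX _ i2.
split.
  apply: safe_modM; rewrite ?ev_sgn // ?l1 ?l2 ?s2 ?sgn_le ?leq_b1 //.
  - by apply: safe_ld; rewrite /= /upd /= ?vh' //; [lia | bd].
  - apply: safe_sgn => //; rewrite ?s2 ?l2 ?leq_b1 //.
    by apply: safe_ld; rewrite /= /upd /= ?vh' ?vR2 //; [lia | bd].
have -> : forall a b st, ev T P ((a |+| b) |%| EV vM) st = (ev T P a st + ev T P b st) %% vr st vM by [].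
by rewrite ev_sgn // l1 l2 s2 m2 /comb_f -posE -jE.
Qed.

Lemma tri_leaf F C st : 0 < F -> 0 < C -> vr st vM = M -> vr st vC = C ->
  vr st vT = C * 2 -> 2 * C * 2 <= Sz ->
  (forall q, q < 2 * C * 2 -> ar st aX q <= M) ->
  tri (F * (C * 2).+1) leafS st (fun st' =>
    forall q, q < C * 2 -> ar st' aX q = leaf_f M C (ar st aX) q).
Proof.
move=> F0 hC0 vm vc vt hT hX.
apply: tri_gather => //; first by lia.
move=> q st' hq [hf1 hf2] hvq.
have vm' : vr st' vM = M by rewrite hf1.
have vc' : vr st' vC = C by rewrite hf1.
have hx' : forall i, ar st' aX i = ar st aX i by move=> i; rewrite hf2.
clear hf1 hf2 vm vc vt.
apply: tri_seq; apply: tri_let => //=; rewrite vc' hvq => c cE.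
apply: tri_let => //=; rewrite /upd /= ?vc' ?hvq.
move=> j jE.
have hc : c < C by rewrite cE ltn_pmod; lia.
have hj : j < 2 by rewrite jE ltn_divLR 1?mulnC //; lia.
set st2 := setv _ tJ _.
have m2 : vr st2 vM = M by rewrite /= /upd /=.
have dCB : 2 * C < B by apply: (ltB_mul hB); lia.
have dcB : 2 * c < B by apply: (ltB_mul hB); lia.
have [i1 i2] : 2 * c < 2 * C * 2 /\ 2 * c + 1 + 2 * C * j < 2 * C * 2.
  by case: (j) hj => [|[|]] // _; lia.
have [i3 i4] : 2 * c + 2 * C < 2 * C * 2 /\ 2 * c + 1 + 2 * C * (1 - j) < 2 * C * 2.
  by case: (j) hj => [|[|]] // _; lia.
have l1 : ev T P (ld (EC 2 |*| EV tPos)) st2 = ar st aX (2 * c).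
  by rewrite /= /upd /= hx'.
have l2 : ev T P (ld (EC 2 |*| EV tPos |+| EC 1 |+| EC 2 |*| EV vC |*| EV tJ)) st2 = ar st aX (2 * c + 1 + 2 * C * j).
  by rewrite /= /upd /= hx' vc'.
have l3 : ev T P (ld (EC 2 |*| EV tPos |+| EC 2 |*| EV vC)) st2 = ar st aX (2 * c + 2 * C).
  by rewrite /= /upd /= hx' vc'.
have l4 : ev T P (ld (EC 2 |*| EV tPos |+| EC 1 |+| EC 2 |*| EV vC |*| (EC 1 |-| EV tJ))) st2 = ar st aX (2 * c + 1 + 2 * C * (1 - j)).
  by rewrite /= /upd /= hx' vc'.
have s2 : ev T P (EV tJ |=| EC 0) st2 = (j == 0) by [].
have b1 := hX _ i1; have b2 := hX _ i2; have b3 := hX _ i3; have b4 := hX _ i4.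
have eb o a b st0 : ev T P (EBin o a b) st0 = evop o (ev T P a st0) (ev T P b st0) by [].
have hm : ar st aX (2 * c + 2 * C) * ar st aX (2 * c + 1 + 2 * C * (1 - j)) %% M <= M by rewrite ltnW // ltn_pmod; lia.
have p1 : ar st aX (2 * c) * ar st aX (2 * c + 1 + 2 * C * j) <= U * U by apply: leU_mul; lia.
have g1 : safe B Sz T P (ld (EC 2 |*| EV tPos)) st2.
  by apply: safe_ld; rewrite /= /upd /= //; sp; lia.
have g2 : safe B Sz T P (ld (EC 2 |*| EV tPos |+| EC 1 |+| EC 2 |*| EV vC |*| EV tJ)) st2.
  by apply: safe_ld; rewrite /= /upd /= ?vc' //; [lia | bd].
have g3 : safe B Sz T P (ld (EC 2 |*| EV tPos |+| EC 2 |*| EV vC)) st2.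
  by apply: safe_ld; rewrite /= /upd /= ?vc' //; [lia | bd].
have g4 : safe B Sz T P (ld (EC 2 |*| EV tPos |+| EC 1 |+| EC 2 |*| EV vC |*| (EC 1 |-| EV tJ))) st2.
  by apply: safe_ld; rewrite /= /upd /= ?vc' //; [lia | bd].
set L1 := ld (EC 2 |*| EV tPos) in l1 g1 *.
set L2 := ld (_ |+| EC 2 |*| EV vC |*| EV tJ) in l2 g2 *.
set L3 := ld (_ |+| EC 2 |*| EV vC) in l3 g3 *.
set L4 := ld _ in l4 g4 *.
have g5 : safe B Sz T P (L3 |*| L4 |%| EV vM) st2.
  by apply: safe_bin => //; apply: safe_bin => //; rewrite l3 l4; apply: (ltB_mul hB); lia.
have m2' : ev T P (EV vM) st2 = M := m2.
have l5 : ev T P (L3 |*| L4 |%| EV vM) st2 =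
    ar st aX (2 * c + 2 * C) * ar st aX (2 * c + 1 + 2 * C * (1 - j)) %% M.
  by rewrite (eb OMod) (eb OMul) l3 l4 m2'.
have l6 : ev T P (L1 |*| L2) st2 = ar st aX (2 * c) * ar st aX (2 * c + 1 + 2 * C * j).
  by rewrite eb l1 l2.
have l7 : ev T P (sgnE (EV tJ |=| EC 0) (L3 |*| L4 |%| EV vM)) st2 =
   sgn M (j == 0) (ar st aX (2 * c + 2 * C) * ar st aX (2 * c + 1 + 2 * C * (1 - j)) %% M).
  by rewrite ev_sgn // l5 s2.
split; last by rewrite (eb OMod) (eb OAdd) l6 l7 m2' /leaf_f -cE -jE.
apply: safe_bin => //; apply: safe_bin.
- by apply: safe_bin => //; rewrite l1 l2; apply: (ltB_mul hB); lia.
- by apply: safe_sgn; rewrite ?s2 ?leq_b1 // l5.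
- rewrite l6 l7.
  have := sgn_le (leq_b1 (j == 0)) hm; rewrite /=; lia.
Qed.

Lemma inv_idx H V low k : low < V -> V * k.+1 <= H -> low + 2 * V * k + V < 2 * H.
Proof. rewrite mulnS -mulnA; lia. Qed.

Lemma tri_inv F Cnt a t R H V st : 0 < F -> 0 < Cnt -> t <= a -> 2 ^ a %| R -> 0 < R ->
  is_val H (Cnt * 2 ^ a) -> is_val V (Cnt * 2 ^ t) ->
  vr st vM = M -> vr st vC = Cnt -> vr st vR = R -> vr st vH = H -> vr st vV = V ->
  vr st vT = 2 * H * R -> 2 * H * R <= Sz ->
  (forall q, q < 2 * H * R -> ar st aX q <= M) ->
  tri (F * (2 * H * R).+1) invS st (fun st' =>
    forall q, q < 2 * H * R -> ar st' aX q = inv_f M R Cnt H V (ar st aX) q).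
Proof.
move=> F0 hC hta hRa hR0 HE VE vm vc vR' vh vv vt hT hX.
have hH0 : 0 < H by rewrite HE muln_gt0 hC expn_gt0.
have hV0 : 0 < V by rewrite VE muln_gt0 hC expn_gt0.
have hVH : V <= H by rewrite HE VE leq_mul2l leq_exp2l ?hta ?orbT.
have hdv : V * (H %/ V) = H.
  by rewrite mulnC divnK // HE VE dvdn_mul // dvdn_exp2l.
have hCV : Cnt <= V by rewrite VE leq_pmulr ?expn_gt0.
have hHT : 2 * H <= 2 * H * R by rewrite leq_pmulr.
have hRT : R <= 2 * H * R by rewrite leq_pmull; lia.
apply: tri_gather => // q st' hq [hf1 hf2] hvq.
have vm' : vr st' vM = M by rewrite hf1.
have vc' : vr st' vC = Cnt by rewrite hf1.
have vR2 : vr st' vR = R by rewrite hf1.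
have vh' : vr st' vH = H by rewrite hf1.
have vv' : vr st' vV = V by rewrite hf1.
have hx' : forall i, ar st' aX i = ar st aX i by move=> i; rewrite hf2.
clear hf1 hf2 vm vc vR' vh vv vt.
have dHB : 2 * H < B by apply: (ltB_mul hB); lia.
apply: tri_seq; apply: tri_let => //=; first by rewrite vh'; sp.
rewrite vh' hvq => pos posE.
apply: tri_seq; apply: tri_let => //=; rewrite /upd /= ?vh' ?hvq; first by sp.
move=> j jE.
have hpos : pos < 2 * H by rewrite posE ltn_pmod; lia.
have hj : j < R by rewrite jE ltn_divLR 1?mulnC //; lia.
apply: tri_seq; apply: tri_let => //=; rewrite /upd /= ?vh'; first by bd.
rewrite addn1 ltnS => hi hiE.
have hi1 : hi <= 1 by rewrite hiE leq_b1.
apply: tri_seq; apply: tri_let => //=; rewrite /upd /= ?vh'.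
move=> l lE.
have hl : l < H by rewrite lE ltn_pmod; lia.
apply: tri_seq; apply: tri_let => //=; rewrite /upd /= ?vv'.
move=> low lowE.
have hlow : low < V by rewrite lowE ltn_pmod.
have he : twid R Cnt V low < R by rewrite VE; apply: (twid_lt hC hta) => //; rewrite -VE.
have htw : low %/ Cnt * (R %/ (V %/ Cnt)) < B by bd.
have hje : hi * twid R Cnt V low <= twid R Cnt V low by rewrite -{2}[twid _ _ _ _]mul1n leq_mul2r hi1 orbT.
apply: tri_seq; apply: tri_let => //=; rewrite /upd /= ?vv' ?vc' ?vR2.
  by rewrite -/(twid _ _ _ _) in htw *; bd.
rewrite -/(twid _ _ _ _) => je jeE; clear htw.
have hje2 : je < 2 * R by rewrite jeE; lia.
apply: tri_seq; apply: tri_let => //=; rewrite /upd /= ?vR2; first by bd.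
rewrite addn1 ltnS => s sE.
have hs : s <= 1 by rewrite sE leq_b1.
have [r rE] : exists r, is_val r (je %% R) by exists (je %% R).
have [k kE] : exists k, is_val k (l %/ V) by exists (l %/ V).
have [rE' kE'] : je %% R = r /\ l %/ V = k by split; rewrite ?rE ?kE.
have hj' : r < R by rewrite rE ltn_pmod.
have hVi : V * k.+1 <= H.
  by rewrite -[X in _ <= X]hdv leq_mul2l kE ltn_divLR // [_ * V]mulnC hdv hl orbT.
have hk : k <= U by apply: leq_trans (_ : V * k.+1 <= U); [apply: leq_trans (leq_pmull _ hV0) | lia].
clear hdv.
have hb2 : low + 2 * V * k + V < 2 * H by exact: inv_idx.
have i2 : low + 2 * V * k + 2 * H * r + V < 2 * H * R by rewrite addnAC; apply: inrange.
have i1 : low + 2 * V * k + 2 * H * r < 2 * H * R by lia.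
have m1 : 2 * V * k < B by bd.
have m0 : 2 * H * r < B by bd.
apply: tri_let => [//||p pE].
  by rewrite /= /upd /= vh' vv' vR2 kE' rE'; sp; lia.
rewrite /= /upd /= vh' vv' vR2 kE' rE' in pE; rewrite -pE in i1 i2.
set st2 := setv _ tLo _.
have m2 : vr st2 vM = M by rewrite /= /upd /=.
have l1 : ev T P (ld (EV tLo)) st2 = ar st aX p by rewrite /= /upd /= hx'.
have l2 : ev T P (ld (EV tLo |+| EV vV)) st2 = ar st aX (p + V) by rewrite /= /upd /= vv' hx'.
have s1 : ev T P (EV tS) st2 = s by [].
have s2 : ev T P ((EV tS |+| EV tHi) |%| EC 2) st2 = (s + hi) %% 2 by [].
have hs2 : (s + hi) %% 2 <= 1 by rewrite -ltnS ltn_pmod.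
have b1 := hX _ i1; have b2 := hX _ i2.
split.
  apply: safe_modM; rewrite ?ev_sgn // ?l1 ?l2 ?s1 ?s2 ?sgn_le //.
  - apply: safe_sgn => //; rewrite ?s1 ?l1 //.
    by apply: safe_ld; rewrite /= /upd /= //; lia.
  - apply: safe_sgn => //; rewrite ?s2 ?l2 //.
      by rewrite /= /upd /=; bd.
    by apply: safe_ld; rewrite /= /upd /= ?vv' //; [lia | bd].
have -> : forall a b st, ev T P ((a |+| b) |%| EV vM) st = (ev T P a st + ev T P b st) %% vr st vM by [].
rewrite !ev_sgn // l1 l2 s1 s2 m2 /inv_f -posE -jE -lE -lowE -hiE -jeE kE' rE' -pE -sE.
by [].
Qed.

End Conv.

Notation aHist := 2 (only parsing).
Notation vD := 4 (only parsing).

(** For [vR = 2 ^ r] this finds the largest power of two whose square is at most [vR], that is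
    [2 ^ r./2], without a logarithm. *)
Definition mloopS := vA <~ EC 1 ;;
  SWhile (EC 4 |*| EV vA |*| EV vA |<| EV vR |+| EC 1) (vA <~ EC 2 |*| EV vA).

Definition stagesS := vV <~ EV vC ;;
  SWhile (EV vV |<| dH) (stageS ;; vV <~ EC 2 |*| EV vV).

Definition istagesS := vV <~ EV vH ;;
  SWhile (EV vC |<| EV vV |+| EC 1) (invS ;; vV <~ EV vV |/| EC 2).

(** One level for all columns at once. [aHist] replaces a recursion stack: it keeps [2 ^ a] for each
    level until the way back. *)
Definition fwdS :=
  mloopS ;; SSet aHist (EV vL) (EV vA) ;;
  vH <~ EV vC |*| EV vA ;; vR <~ EV vR |/| EV vA ;; vT <~ dH |*| EV vR ;;
  padS ;; stagesS ;; vC <~ dH ;; vL <~ EV vL |+| EC 1.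

Definition bwdS :=
  vL <~ EV vL |-| EC 1 ;; vA <~ EArr aHist (EV vL) ;;
  vH <~ EV vC |/| EC 2 ;; vC <~ EV vH |/| EV vA ;; vT <~ dH |*| EV vR ;;
  istagesS ;; vT <~ EV vH |*| EV vR ;; combS ;; vR <~ EV vR |*| EV vA.

(** The count starts at 2 because the two factors occupy alternate columns; it is halved for the
    leaf products, each of which leaves one column for two. *)
Definition convS :=
  vC <~ EC 2 ;; vR <~ EV vD ;; vL <~ EC 0 ;;
  SWhile (EC 2 |<| EV vR) fwdS ;;
  vC <~ EV vC |/| EC 2 ;; vT <~ EV vC |*| EC 2 ;; leafS ;;
  SWhile (EC 0 |<| EV vL) bwdS.

Section Conv.
Import GRing.Theory.
Variables (B Sz U M : nat) (T : seq nat) (P : seq (option nat)).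
Hypothesis hB : 8 * (U * U) < B.
Hypothesis hSz : Sz <= U.
Hypothesis hM : 1 < M <= U.
Notation tri := (tri B Sz T P).

Lemma tri_mloop r st : vr st vR = 2 ^ r -> 1 < r -> 2 * 2 ^ r <= U ->
  tri r.+1 mloopS st (fun st' => vr st' vA = 2 ^ r./2).
Proof.
move=> hR hr hU; apply: tri_seq; apply: tri_asg => //.
have e2 i : 4 * 2 ^ i * 2 ^ i = 2 ^ (2 * i.+1).
  by rewrite -mulnA -expnD -(expnD 2 2); congr expn; lia.
have hb i : i <= r./2 -> 4 * 2 ^ i <= U /\ 4 * 2 ^ i * 2 ^ i <= 4 * 2 ^ r /\ 2 ^ i <= U.
  move=> hi.
  have h1 : 4 * 2 ^ i <= 2 * 2 ^ r by rewrite -(expnD 2 2) -expnS leq_exp2l //; lia.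
  split; first by lia.
  split; last by lia.
  by rewrite e2 -(expnD 2 2) leq_exp2l //; lia.
have UU : U <= U * U by rewrite leq_pmulr; lia.
apply: (@tri_while _ _ _ _ (fun i st' => vr st' vA = 2 ^ i) r./2 1) => //=; first by lia.
- move=> i st' hi [hf _] hv.
  have hR' : vr st' vR = 2 ^ r by rewrite hf.
  have [h1 [h2 h3]] := hb i (ltnW hi).
  rewrite hv hR' e2 in h2 *.
  have -> : 2 ^ (2 * i.+1) < 2 ^ r + 1 by rewrite addn1 ltnS leq_exp2l //; lia.
  split=> //; first by sp; lia.
  apply: tri_asg => //=; first by sp; rewrite hv; lia.
  by rewrite hv expnS.
- move=> st' [hf _] hv.
  have hR' : vr st' vR = 2 ^ r by rewrite hf.
  have [h1 [h2 h3]] := hb _ (leqnn r./2).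
  rewrite hv hR' e2 in h2 *.
  have -> : (2 ^ (2 * (r./2).+1) < 2 ^ r + 1) = false by rewrite addn1 ltnS leq_exp2l //; lia.
  by split=> //; sp; lia.
Qed.

Lemma stage_f_lt R Cnt H V X q : stage_f M R Cnt H V X q < M.
Proof. by rewrite /stage_f ltn_pmod; lia. Qed.
Lemma inv_f_lt R Cnt H V X q : inv_f M R Cnt H V X q < M.
Proof. by rewrite /inv_f ltn_pmod; lia. Qed.
Lemma comb_f_lt R H X q : comb_f M R H X q < M.
Proof. by rewrite /comb_f ltn_pmod; lia. Qed.
Lemma leaf_f_lt C X q : leaf_f M C X q < M.
Proof. by rewrite /leaf_f ltn_pmod; lia. Qed.

Lemma tri_stages Cnt a R H st : 0 < Cnt -> 2 ^ a %| R -> 0 < R -> is_val H (Cnt * 2 ^ a) ->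
  vr st vM = M -> vr st vC = Cnt -> vr st vR = R -> vr st vH = H ->
  vr st vT = 2 * H * R -> 2 * H * R <= Sz ->
  (forall q, q < 2 * H * R -> ar st aX q <= M) ->
  tri (Sz.+1 * a.+2) stagesS st (fun st' =>
    (forall q, q < 2 * H * R -> ar st' aX q <= M) /\
    (forall (A : comNzRingType) (y : A), M%:R%R = 0%R :> A -> (y ^+ R = -1)%R ->
      forall pos, pos < 2 * H ->
      ycol y R (ar st' aX) (2 * H) pos = butterflies y R Cnt H a.+1 (ycol y R (ar st aX) (2 * H)) pos)).
Proof.
move=> hC hRa hR0 HE vm vc vR' vh vt hT hX.
have hH0 : 0 < H by rewrite HE muln_gt0 hC expn_gt0.
have hHT : 2 * H <= 2 * H * R by rewrite leq_pmulr.
have UU : U <= U * U by rewrite leq_pmulr; lia.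
apply: tri_seq; apply: tri_asg => //=; rewrite vc.
set st0 := setv _ _ _.
apply: (@tri_while _ _ _ _ (fun i st' => [/\ vr st' vV = Cnt * 2 ^ i,
    forall q, q < 2 * H * R -> ar st' aX q <= M &
    (forall (A : comNzRingType) (y : A), M%:R%R = 0%R :> A -> (y ^+ R = -1)%R ->
      forall pos, pos < 2 * H ->
      ycol y R (ar st' aX) (2 * H) pos = butterflies y R Cnt H i (ycol y R (ar st aX) (2 * H)) pos)]) a.+1 Sz.+1) => //.
- by split; rewrite // /st0 /= /upd /= expn0 muln1.
- move=> i st' hi [hf hfa] [hv hX' hcol].
  have E x : x \notin wv (stageS;; 14 <~ EC 2 |*| EV 14) -> x != vV -> vr st' x = vr st x.
    by move=> h1 h2; rewrite hf // /st0 /= /upd (negbTE h2).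
  have vi : Cnt * 2 ^ i <= H by rewrite HE leq_mul2l leq_exp2l // -ltnS hi orbT.
  split=> /=.
  + by rewrite E // vh; bd.
  + by rewrite (E vH) // vh hv eqb0 -leqNgt; lia.
  apply: tri_seq; apply: (@tri_imp _ _ _ _ (1 * (2 * H * R).+1)).
  * apply: (@tri_stage B Sz U M T P hB hSz hM 1 Cnt a i R H (Cnt * 2 ^ i)) => //; by rewrite E.
  * by lia.
  * move=> st2 [hf2 _] hs2.
    have hv2 : vr st2 vV = Cnt * 2 ^ i by rewrite hf2.
    apply: tri_asg => //=; first by rewrite hv2; bd; lia.
    rewrite /upd /= hv2; split; first by rewrite expnS mulnCA.
      by move=> q hq; rewrite hs2 // ltnW // stage_f_lt.
    move=> A y hA hy pos hp.
    have hta : i <= a by lia.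
    clear vh; rewrite /is_val in HE; subst H.
    rewrite (col_stage hA hy hC hta hRa hR0 hX' hs2) //.
    by apply: butterfly_ext => // p hp'; apply: hcol.
- move=> st' [hf hfa] [hv hX' hcol].
  have E x : x \notin wv (stageS;; 14 <~ EC 2 |*| EV 14) -> x != vV -> vr st' x = vr st x.
    by move=> h1 h2; rewrite hf // /st0 /= /upd (negbTE h2).
  split=> /=; last by split.
  + by rewrite E // vh; bd.
  + by rewrite (E vH) // vh hv HE expnS mulnCA ltnn.
Qed.

Lemma tri_istages Cnt a R H st : 0 < Cnt -> 2 ^ a %| R -> 0 < R -> is_val H (Cnt * 2 ^ a) ->
  vr st vM = M -> vr st vC = Cnt -> vr st vR = R -> vr st vH = H ->
  vr st vT = 2 * H * R -> 2 * H * R <= Sz ->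
  (forall q, q < 2 * H * R -> ar st aX q <= M) ->
  tri (Sz.+1 * a.+2) istagesS st (fun st' =>
    (forall q, q < 2 * H * R -> ar st' aX q <= M) /\
    (forall (A : comNzRingType) (y : A), M%:R%R = 0%R :> A -> (y ^+ R = -1)%R -> forall h : nat -> A,
      (forall pos, pos < 2 * H -> ycol y R (ar st aX) (2 * H) pos = butterflies y R Cnt H a.+1 h pos) ->
      forall pos, pos < 2 * H ->
      ycol y R (ar st' aX) (2 * H) pos = ((2 ^ a.+1)%:R * h pos)%R)).
Proof.
move=> hC hRa hR0 HE vm vc vR' vh vt hT hX.
have hH0 : 0 < H by rewrite HE muln_gt0 hC expn_gt0.
have hHT : 2 * H <= 2 * H * R by rewrite leq_pmulr.
have UU : U <= U * U by rewrite leq_pmulr; lia.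
have hCH : Cnt <= H by rewrite HE leq_pmulr ?expn_gt0.
have hV i : i <= a -> Cnt * 2 ^ (a.+1 - i) %/ 2 = Cnt * 2 ^ (a - i).
  by move=> hi; rewrite subSn // expnS mulnCA mulKn.
apply: tri_seq; apply: tri_asg => //=; rewrite vh.
set st0 := setv _ _ _.
(* The value is written as a division by 2 because the loop ends with [Cnt %/ 2], where the
   truncated exponent [a - i] would give [Cnt]. *)
apply: (@tri_while _ _ _ _ (fun i st' => [/\ vr st' vV = Cnt * 2 ^ (a.+1 - i) %/ 2,
    forall q, q < 2 * H * R -> ar st' aX q <= M &
    (forall (A : comNzRingType) (y : A), M%:R%R = 0%R :> A -> (y ^+ R = -1)%R -> forall h : nat -> A,
      (forall pos, pos < 2 * H -> ycol y R (ar st aX) (2 * H) pos = butterflies y R Cnt H a.+1 h pos) ->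
      forall pos, pos < 2 * H ->
      ycol y R (ar st' aX) (2 * H) pos = ((2 ^ i)%:R * butterflies y R Cnt H (a.+1 - i) h pos)%R)]) a.+1 Sz.+1) => //.
- split=> //; first by rewrite /st0 /= /upd /= hV // subn0.
  by move=> A y hA hy h hh pos hp; rewrite subn0 expn0 mul1r; apply: hh.
- move=> i st' hi [hf hfa] [hv hX' hcol].
  have hia : i <= a by lia.
  rewrite hV // in hv.
  have E x : x \notin wv (invS;; vV <~ EV vV |/| EC 2) -> x != vV -> vr st' x = vr st x.
    by move=> h1 h2; rewrite hf // /st0 /= /upd (negbTE h2).
  have vi : Cnt * 2 ^ (a - i) <= H by rewrite HE leq_mul2l leq_exp2l // leq_subr orbT.
  have vi2 : Cnt <= Cnt * 2 ^ (a - i) by rewrite leq_pmulr ?expn_gt0.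
  split=> /=.
  + by rewrite hv; sp; lia.
  + by rewrite (E vC) // vc hv eqb0 -leqNgt; lia.
  apply: tri_seq; apply: (@tri_imp _ _ _ _ (1 * (2 * H * R).+1)).
  * apply: (@tri_inv B Sz U M T P hB hSz hM 1 Cnt a (a - i) R H (Cnt * 2 ^ (a - i))) => //; rewrite ?E ?leq_subr //.
  * by lia.
  * move=> st2 [hf2 _] hs2.
    have hv2 : vr st2 vV = Cnt * 2 ^ (a - i) by rewrite hf2.
    apply: tri_asg => //=.
    rewrite /upd /= hv2; split.
    + by rewrite subSS.
    + by move=> q hq; rewrite hs2 // ltnW // inv_f_lt.
    move=> A y hA hy h hh pos hp.
    have hta : a - i <= a by rewrite leq_subr.
    clear vh; rewrite /is_val in HE; subst H.
    rewrite subSS expnS natrM.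
    apply: (col_inv hA hy hC hta hRa hR0 hX' hs2) => // p hp'.
    by rewrite (hcol _ _ hA hy h hh) // subSn.
- move=> st' [hf hfa] [hv hX' hcol].
  have E x : x \notin wv (invS;; vV <~ EV vV |/| EC 2) -> x != vV -> vr st' x = vr st x.
    by move=> h1 h2; rewrite hf // /st0 /= /upd (negbTE h2).
  rewrite subnn expn0 muln1 in hv.
  have h2 : Cnt %/ 2 < Cnt by rewrite ltn_Pdiv.
  split=> /=; last first.
  + by split=> // A y hA hy h hh pos hp; rewrite (hcol _ _ hA hy h hh) // subnn.
  + by rewrite (E vC) // vc hv addn1 ltnS leqNgt h2.
  + by rewrite hv; sp; lia.
Qed.

Lemma tri_fwd k Cnt r l st : 0 < Cnt -> 1 < r <= k ->
  vr st vM = M -> vr st vC = Cnt -> vr st vR = 2 ^ r -> vr st vL = l -> l < Sz ->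
  2 * (Cnt * 2 ^ r) <= Sz ->
  (forall q, q < Cnt * 2 ^ r -> ar st aX q <= M) ->
  tri (Sz.+1 * k.+2) fwdS st (fun st' =>
    [/\ vr st' vC = 2 * (Cnt * 2 ^ r./2), vr st' vR = 2 ^ (r - r./2), vr st' vL = l.+1 &
      [/\ ar st' aHist l = 2 ^ r./2, forall i, i != l -> ar st' aHist i = ar st aHist i,
         forall q, q < 2 * (Cnt * 2 ^ r) -> ar st' aX q <= M &
         fwdlev M Cnt r./2 r (ar st aX) (ar st' aX)]]).
Proof.
move=> hC /andP[r1 rk] vm vc vR' vl hl hT hX.
set a := r./2; have har : a <= r by lia.
have haa : a <= r - a by lia.
have h2r : 2 ^ a * 2 ^ (r - a) = 2 ^ r by rewrite -expnD subnKC.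
have p2 x : 0 < 2 ^ x by rewrite expn_gt0.
have UU : U <= U * U by rewrite leq_pmulr; lia.
have c2r : Cnt * 2 ^ r <= Sz by lia.
have r2 : 2 ^ r <= Cnt * 2 ^ r by rewrite leq_pmull.
have a2 : 2 ^ a <= 2 ^ r by rewrite leq_exp2l.
have Cr : Cnt <= Cnt * 2 ^ r by rewrite leq_pmulr.
have Ca : Cnt * 2 ^ a <= Cnt * 2 ^ r by rewrite leq_mul2l a2 orbT.
have Ca2 : 2 * (Cnt * 2 ^ a) <= 2 * (Cnt * 2 ^ r) by rewrite leq_mul2l.
have hT2 : 2 * (Cnt * 2 ^ a) * 2 ^ (r - a) = 2 * (Cnt * 2 ^ r) by rewrite -h2r; lia.
have hT1 : (Cnt * 2 ^ a) * 2 ^ (r - a) = Cnt * 2 ^ r by rewrite -h2r mulnA.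
have FF : 0 < Sz.+1 * k.+2 by [].
apply: tri_seq; apply: tri_imp (tri_mloop vR' r1 _) _ _; first by lia.
  by apply: leq_trans (leq_pmull _ _); lia.
move=> st1 [f1 g1] va1; rewrite -/a in va1.
have vm1 : vr st1 vM = M by rewrite f1.
have vc1 : vr st1 vC = Cnt by rewrite f1.
have vR1 : vr st1 vR = 2 ^ r by rewrite f1.
have vl1 : vr st1 vL = l by rewrite f1.
apply: tri_seq; apply: tri_set => //=; rewrite ?vl1 ?va1 //.
apply: tri_seq; apply: tri_asg => //=; rewrite ?vc1 ?va1; first by bd.
apply: tri_seq; apply: tri_asg => //=; rewrite /upd /= ?vR1 ?va1.
rewrite -expnB //.
apply: tri_seq; apply: tri_asg => //=; rewrite /upd /= ?hT2 //.
  by sp; lia.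
set st2 := setv _ vT _.
apply: tri_seq; apply: (@tri_imp _ _ _ _ (1 * (2 * (Cnt * 2 ^ a) * 2 ^ (r - a)).+1)).
- apply: (@tri_pad B Sz U M T P hB hSz hM 1 (2 ^ (r - a)) (Cnt * 2 ^ a)) => //; rewrite ?muln_gt0 ?hC ?p2 ?hT2 //.
  by move=> q; rewrite -mulnA h2r /= => hq; rewrite g1 // hX.
- rewrite hT2; apply: leq_trans (leq_pmulr _ _) => //; lia.
move=> st3 [f3 g3] hpad.
apply: tri_seq; apply: (@tri_imp _ _ _ _ (Sz.+1 * a.+2)).
- apply: (@tri_stages Cnt a (2 ^ (r - a)) (Cnt * 2 ^ a)) => //; rewrite ?f3 ?hT2 //.
  + by rewrite dvdn_exp2l.
  + move=> q hq; rewrite hpad ?hT2 // /pad_f; case: (ltnP (q %% (2 * (Cnt * 2 ^ a))) (Cnt * 2 ^ a)) => [hp|_] /=; last by rewrite mul0n.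
    rewrite mul1n g1 //= hX //.
    have : q %/ (2 * (Cnt * 2 ^ a)) < 2 ^ (r - a) by rewrite ltn_divLR ?muln_gt0 ?hC ?p2 // mulnC hT2.
    by move=> hq2; have := inrange hp hq2; rewrite hT1.
- by rewrite leq_mul2l; lia.
move=> st4 [f4 g4] [hX4 hcol].
have vh4 : vr st4 vH = Cnt * 2 ^ a by rewrite f4 // f3.
have vl4 : vr st4 vL = l by rewrite f4 // f3.
have vR4 : vr st4 vR = 2 ^ (r - a) by rewrite f4 // f3.
apply: tri_seq; apply: tri_asg => //=; rewrite ?vh4; first by bd.
apply: tri_asg => //=; rewrite /upd /= ?vl4; first by bd.
rewrite vR4 addn1; split=> //; split.
- by rewrite g4 // g3 //= ?eqxx.
- by move=> i hi; rewrite g4 // g3 //= ?eqxx ?(negbTE hi) /= g1.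
- by move=> q hq; apply: hX4; rewrite hT2.
move=> A y hA hy pos hp.
rewrite (hcol _ _ hA hy) //.
have hst p : p < 2 * (Cnt * 2 ^ a) -> ycol y (2 ^ (r - a)) (ar st3 0) (2 * (Cnt * 2 ^ a)) p =
    (if p < Cnt * 2 ^ a then ycol y (2 ^ (r - a)) (ar st aX) (Cnt * 2 ^ a) p else 0%R).
  move=> hp2; rewrite (col_pad y hpad) //.
  by case: ifP => // _; apply: eq_bigr => j _; rewrite /= g1.
have hfA t : t <= a.+1 -> forall p, p < 2 * (Cnt * 2 ^ a) ->
   butterflies y (2 ^ (r - a)) Cnt (Cnt * 2 ^ a) t (ycol y (2 ^ (r - a)) (ar st3 0) (2 * (Cnt * 2 ^ a))) p =
   butterflies y (2 ^ (r - a)) Cnt (Cnt * 2 ^ a) t (fun p => if p < Cnt * 2 ^ a then ycol y (2 ^ (r - a)) (ar st aX) (Cnt * 2 ^ a) p else 0%R) p.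
  elim: t => [|t IH] ht p hp2; first exact: hst.
  apply: butterfly_ext => //; apply: IH; lia.
exact: hfA.
Qed.

Lemma tri_bwd k Cnt a r l st : 0 < Cnt -> 2 * a <= r -> r <= k ->
  vr st vM = M -> vr st vC = 2 * (Cnt * 2 ^ a) -> vr st vR = 2 ^ (r - a) -> vr st vL = l.+1 -> l < Sz ->
  ar st aHist l = 2 ^ a ->
  2 * (Cnt * 2 ^ r) <= Sz ->
  (forall q, q < 2 * (Cnt * 2 ^ r) -> ar st aX q <= M) ->
  tri (Sz.+1 * k.+2) bwdS st (fun st' =>
    [/\ vr st' vC = Cnt, vr st' vR = 2 ^ r, vr st' vL = l,
      forall q, q < Cnt * 2 ^ r -> ar st' aX q < M &
      invlev M Cnt a r (ar st aX) (ar st' aX)]).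
Proof.
move=> hC haar rk vm vc vR' vl hl ha hT hX.
have har : a <= r by lia.
have haa : a <= r - a by lia.
have h2r : 2 ^ a * 2 ^ (r - a) = 2 ^ r by rewrite -expnD subnKC.
have p2 x : 0 < 2 ^ x by rewrite expn_gt0.
have UU : U <= U * U by rewrite leq_pmulr; lia.
have c2r : Cnt * 2 ^ r <= Sz by lia.
have a2 : 2 ^ a <= 2 ^ r by rewrite leq_exp2l.
have ra2 : 2 ^ (r - a) <= 2 ^ r by rewrite leq_exp2l ?leq_subr.
have r2 : 2 ^ r <= Cnt * 2 ^ r by rewrite leq_pmull.
have Ca : Cnt * 2 ^ a <= Cnt * 2 ^ r by rewrite leq_mul2l a2 orbT.
have Ca2 : 2 * (Cnt * 2 ^ a) <= 2 * (Cnt * 2 ^ r) by rewrite leq_mul2l.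
have hT2 : 2 * (Cnt * 2 ^ a) * 2 ^ (r - a) = 2 * (Cnt * 2 ^ r) by rewrite -h2r; lia.
have hT1 : (Cnt * 2 ^ a) * 2 ^ (r - a) = Cnt * 2 ^ r by rewrite -h2r mulnA.
have FF : 0 < Sz.+1 * k.+2 by [].
apply: tri_seq; apply: tri_asg => //=; rewrite vl subn1 /=.
apply: tri_seq; apply: tri_asg => //=; rewrite /upd /= ha.
apply: tri_seq; apply: tri_asg => //=; rewrite /upd /= vc mulKn //.
apply: tri_seq; apply: tri_asg => //=; rewrite /upd /= mulnK //.
apply: tri_seq; apply: tri_asg => //=; rewrite /upd /= ?vR' ?hT2.
  by sp; lia.
set st2 := setv _ vT _.
apply: tri_seq; apply: (@tri_imp _ _ _ _ (Sz.+1 * a.+2)).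
- apply: (@tri_istages Cnt a (2 ^ (r - a)) (Cnt * 2 ^ a) st2) => //; rewrite ?hT2 //.
  by rewrite dvdn_exp2l.
- by rewrite leq_mul2l; lia.
move=> st3 [f3 g3]; rewrite hT2 => -[hX3 hcol].
have vh3 : vr st3 vH = Cnt * 2 ^ a by rewrite f3.
have vl3 : vr st3 vL = l by rewrite f3.
have vR3 : vr st3 vR = 2 ^ (r - a) by rewrite f3.
have vm3 : vr st3 vM = M by rewrite f3.
have va3 : vr st3 vA = 2 ^ a by rewrite f3.
have vc3 : vr st3 vC = Cnt by rewrite f3.
apply: tri_seq; apply: tri_asg => //=; rewrite ?vh3 ?vR3 hT1; first by sp; lia.
set st4 := setv _ vT _.
apply: tri_seq; apply: (@tri_imp _ _ _ _ (1 * ((Cnt * 2 ^ a) * 2 ^ (r - a)).+1)).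
- apply: (@tri_comb B Sz U M T P hB hSz hM 1 (2 ^ (r - a)) (Cnt * 2 ^ a)) => //; rewrite ?muln_gt0 ?hC ?p2 ?hT2 // ?hT1 //.
- rewrite hT1; apply: leq_trans (leq_pmulr _ _) => //; lia.
move=> st5 [f5 g5] hs5.
have vR5 : vr st5 vR = 2 ^ (r - a) by rewrite f5.
have va5 : vr st5 vA = 2 ^ a by rewrite f5.
apply: tri_asg => //=; rewrite /upd /= ?vR5 ?va5 1?mulnC ?h2r; first by sp; lia.
split; rewrite ?f5 //.
- by move=> q hq; rewrite hs5 ?hT1 // comb_f_lt.
move=> A y hA hy h hh pos hp.
rewrite (col_comb hA hy (p2 _) _ hs5) //; last by move=> q; rewrite hT2; apply: hX3.
rewrite !(hcol _ _ hA hy h) //; [ring | lia | lia].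
Qed.

(** The [2 * 2 ^ k] cells double at each of [L] levels and [2 ^ L <= 2 * k], hence the space
    [4 * (2 ^ k * k)]. The factors [k.+2] bound the levels and the passes of each level. *)
Lemma tri_conv k st : 1 < k -> vr st vM = M -> vr st vD = 2 ^ k -> 4 * (2 ^ k * k) <= Sz ->
  (forall q, q < 2 * 2 ^ k -> ar st aX q <= M) ->
  tri (Sz.+1 * k.+2 * k.+2) convS st (fun st' => exists s Xf Z,
    [/\ lwf s k, lrad s k = 1, gain s <= k * 2 ^ k, forall q, q < 2 ^ k -> ar st' aX q < M &
     [/\ fwds M s 2 k (ar st aX) Xf, leaflev M (lcnt s 1) Xf Z & invs M s 1 k Z (ar st' aX)]]).
Proof.
move=> k1 vm vd hS hX.
have [L [hL1 hLr hL2 hLk]] := levs_depth k1.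
have p2 x : 0 < 2 ^ x by rewrite expn_gt0.
have UU : U <= U * U by rewrite leq_pmulr; lia.
have kS : 2 ^ k * 2 <= 2 ^ k * k by rewrite leq_mul2l k1 orbT.
have kS2 : k <= 2 ^ k * k by rewrite leq_pmull.
have hcnt i Cnt : lcnt (levs i k) Cnt * 2 ^ lrad (levs i k) k = Cnt * 2 ^ (k + i).
  by rewrite (lcnt_eq _ (lwf_levs i k)) size_levs.
have hbd i : i <= L -> 2 * 2 ^ (k + i) <= Sz.
  move=> hi; apply: leq_trans hS; rewrite expnD.
  have : 2 ^ i <= 2 * k by apply: leq_trans hL2; rewrite leq_exp2l.
  move=> h; have := leq_mul (leqnn (2 ^ k)) h; lia.
have hrk i : lrad (levs i k) k <= k.
  elim: i => [|i IH] //; rewrite levs_rcons lrad_rcons; lia.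
set F := Sz.+1 * k.+2.
have F0 : 0 < F by [].
have FF : 0 < F * k.+2 by [].
have FL : F * L.+1 <= F * k.+2 by rewrite leq_mul2l; lia.
apply: tri_seq; apply: tri_asg => //.
apply: tri_seq; apply: tri_asg => //=; rewrite /upd /= vd.
apply: tri_seq; apply: tri_asg => //=.
set st0 := setv _ vL _.
pose J i st' := [/\ vr st' vC = lcnt (levs i k) 2, vr st' vR = 2 ^ lrad (levs i k) k, vr st' vL = i &
  [/\ forall j, j < i -> ar st' aHist j = 2 ^ nth 0 (levs L k) j,
    forall q, q < 2 * 2 ^ (k + i) -> ar st' aX q <= M & fwds M (levs i k) 2 k (ar st aX) (ar st' aX)]].
apply: tri_seq; apply: (@tri_while _ _ _ _ J L F) => //.
- by split=> //; split=> // q; rewrite addn0; apply: hX.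
- move=> i st' hi [hf _] [hc hr hl [hh hx hw]].
  have vm' : vr st' vM = M by rewrite hf.
  have hri := hLr i hi.
  split=> //=.
    by rewrite hr -{1}(expn1 2) ltn_exp2l // hri.
  apply: (@tri_imp _ _ _ _ F).
  + apply: (@tri_fwd k (lcnt (levs i k) 2) (lrad (levs i k) k) i) => //.
    * exact: lcnt_gt0.
    * by rewrite hri hrk.
    * by have := ltn_expl k (ltnSn 1); lia.
    * by rewrite hcnt -expnS -addnS hbd.
    * by move=> q; rewrite hcnt; apply: hx.
  + by [].
  move=> st2 [hf2 _] [hc2 hr2 hl2 [hh2 hh3 hx2 hlv]].
  split; rewrite ?levs_rcons ?lcnt_rcons ?lrad_rcons //; split.
  + move=> j; rewrite ltnS leq_eqVlt => /orP[/eqP ->|hj]; first by rewrite hh2 nth_levs.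
    by rewrite hh3 ?hh //; lia.
  + by move=> q hq; apply: hx2; rewrite hcnt -expnS -addnS.
  + exact: fwds_rcons hw hlv.
move=> st1 [hf1 _] [hc hr hl [hh hx hw]].
have vm1 : vr st1 vM = M by rewrite hf1.
rewrite hL1 in hr.
split=> //=; first by rewrite hr.
set C := lcnt (levs L k) 1.
have hC0 : 0 < C by apply: lcnt_gt0.
have hC2 : C * 2 = 2 ^ (k + L) by have := hcnt L 1; rewrite hL1 mul1n.
have hc' : vr st1 vC = 2 * C by rewrite hc -lcnt2.
have hbL := hbd L (leqnn L).
apply: tri_seq; apply: tri_asg => //=; rewrite hc' mulKn //.
apply: tri_seq; apply: tri_asg => //=; rewrite /upd /=; first by sp; lia.
apply: tri_seq; apply: (@tri_imp _ _ _ _ (1 * (C * 2).+1)).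
- apply: (@tri_leaf B Sz U M T P hB hSz hM 1 C) => //=.
  + by rewrite -mulnA hC2.
  + by move=> q; rewrite -mulnA hC2; apply: hx.
- by rewrite mul1n hC2 -mulnA; apply: leq_trans (leq_pmulr _ _) => //; lia.
move=> st2 [hf2 hg2] hlf.
have hleaf : leaflev M C (ar st1 aX) (ar st2 aX).
  by move=> A y hA hy c hcC; apply: (col_leaf hA _ hy hlf) => //; lia.
(* On the way back [L - i] levels remain to be undone; [invs] covers those already undone, which are
   the deepest ones. *)
pose I i st' := [/\ vr st' vC = lcnt (levs (L - i) k) 1, vr st' vR = 2 ^ lrad (levs (L - i) k) k, vr st' vL = L - i,
  forall q, q < 2 ^ (k + (L - i)) -> ar st' aX q < M &
  invs M (drop (L - i) (levs L k)) (lcnt (levs (L - i) k) 1) (lrad (levs (L - i) k) k) (ar st2 aX) (ar st' aX)].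
apply: (@tri_while _ _ _ _ I L F) => //.
- rewrite /I subn0 hL1 drop_oversize ?size_levs //; split=> //; rewrite ?hf2 //.
  by move=> q; rewrite -hC2 => hq; rewrite hlf // leaf_f_lt.
- move=> i st' hi [hf hg] [hc2 hr2 hl2 hx2 hinv].
  have vm' : vr st' vM = M by rewrite hf // hf2.
  split=> //=; first by rewrite hl2 eqb0 -leqNgt; lia.
  set j := L - i.+1; have hj : L - i = j.+1 by rewrite /j; lia.
  have hjL : j < L by lia.
  rewrite hj levs_rcons lcnt_rcons lrad_rcons in hc2 hr2 hl2 hx2 hinv.
  apply: (@tri_imp _ _ _ _ F).
  + apply: (@tri_bwd k (lcnt (levs j k) 1) (lrad (levs j k) k)./2 (lrad (levs j k) k) j) => //.
    * exact: lcnt_gt0.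
    * by lia.
    * by have := ltn_expl k (ltnSn 1); lia.
    * by rewrite hg // hg2 //= hh // nth_levs.
    * by rewrite hcnt mul1n -expnS -addnS; apply: leq_trans (hbd _ hjL); rewrite leq_pmull.
    * by move=> q; rewrite hcnt mul1n -expnS -addnS => hq; rewrite ltnW // hx2.
  + by [].
  move=> st3 _ [hc3 hr3 hl3 hx3 hlv]; split=> //.
  + by move=> q hq; apply: hx3; rewrite hcnt mul1n.
  + rewrite (drop_nth 0) ?size_levs // nth_levs //=; exists (ar st' aX) => //.
- move=> st3 [hf3 _] []; rewrite subnn => hc3 hr3 hl3 hx3 hinv; split=> //=; first by rewrite hl3.
  exists (levs L k), (ar st1 aX), (ar st2 aX); split=> //.
  + exact: lwf_levs.
  + have := gain_eq (lwf_levs L k); rewrite hL1 size_levs expnD.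
    have := leq_mul (leqnn (2 ^ k)) hL2; lia.
  + by move=> q hq; apply: hx3; rewrite addn0.
  + by split=> //; move: hinv; rewrite drop0.
Qed.

End Conv.

(** * Renaming characters with a tournament tree *)

Notation aCh := 3 (only parsing).
Notation aTr := 4 (only parsing).
Notation aId := 5 (only parsing).
Notation vW := 30 (only parsing).
Notation tU := 31 (only parsing).
Notation tK := 32 (only parsing).
Notation tA := 33 (only parsing).
Notation tB := 34 (only parsing).
Notation tPrev := 35 (only parsing).
Notation tCur := 36 (only parsing).
Notation tL := 37 (only parsing).
Notation tG := 38 (only parsing).

Section Tournament.
Variables (Q : nat) (ch : nat -> nat).

(** The sentinel [Q], which is no leaf number, marks an exhausted subtree and loses every
    comparison. *)
Definition better a b := if (a == Q) || (b != Q) && (ch b < ch a) then b else a.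

Definition kle a b := (b == Q) || (a != Q) && (ch a <= ch b).

Lemma kle_refl a : kle a a. Proof. by rewrite /kle leqnn andbT orbN. Qed.

Lemma kle_trans a b c : kle a b -> kle b c -> kle a c.
Proof.
rewrite /kle; case: eqP => //= hb; case: eqP => //= hc; case: eqP => //= ha.
exact: leq_trans.
Qed.

Lemma kle_betterl a b : kle (better a b) a.
Proof.
rewrite /better; case: ifP => h; last exact: kle_refl.
by move: h; rewrite /kle; case: (a == Q) => //= /andP[-> /ltnW ->].
Qed.

Lemma kle_betterr a b : kle (better a b) b.
Proof.
rewrite /better; case: ifP => h; first exact: kle_refl.
by move: h; rewrite /kle; case: (a == Q) => //=; case: (b == Q) => //= /negbT; rewrite -leqNgt => ->.
Qed.

(** Heap layout: the children of [u] are [2 * u] and [2 * u + 1], the leaves start at [Q]. Node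
    [skip] may be out of date; as nodes start at 1, [skip = 0] means none. *)
Definition treeok skip (tr : nat -> nat) :=
  forall u, 0 < u < Q -> u != skip -> tr u = better (tr (2 * u)) (tr (2 * u + 1)).

Lemma tree_min tr : treeok 0 tr -> forall u, 0 < u < 2 * Q -> kle (tr 1) (tr u).
Proof.
move=> hok u; elim/ltn_ind: u => u IH hu.
have [->|u1] : u = 1 \/ 1 < u by lia.
  exact: kle_refl.
have hv : 0 < u./2 < Q by lia.
have hvu : kle (tr u./2) (tr u).
  rewrite hok //; last by lia.
  have [e|e] : u = 2 * u./2 \/ u = 2 * u./2 + 1 by lia.
    by rewrite [in X in kle _ X]e kle_betterl.
  by rewrite [in X in kle _ X]e kle_betterr.
by apply: kle_trans hvu; apply: IH; lia.
Qed.

Lemma tree_leaf tr (alive : pred nat) : treeok 0 tr ->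
  (forall l, l < Q -> tr (Q + l) = if alive l then l else Q) ->
  forall u, 0 < u < 2 * Q -> tr u != Q -> (tr u < Q) && alive (tr u).
Proof.
move=> hok hl u hu.
have [n hn] : exists n, 2 * Q - u <= n by exists (2 * Q - u).
elim: n u hu hn => [|n IH] u hu hn; first by lia.
case: (ltnP u Q) => huQ.
  rewrite hok; [|lia|lia].
  by rewrite /better; case: ifP => _; apply: IH; lia.
have -> : u = Q + (u - Q) by lia.
rewrite hl; last by lia.
case: ifP => ha; last by rewrite eqxx.
by move=> _; rewrite ha andbT; lia.
Qed.

Lemma tree_root tr (alive : pred nat) : treeok 0 tr ->
  (forall l, l < Q -> tr (Q + l) = if alive l then l else Q) ->
  forall l, l < Q -> alive l -> [/\ tr 1 < Q, alive (tr 1) & ch (tr 1) <= ch l].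
Proof.
move=> hok hl l hlQ ha.
have h1 : 0 < Q + l < 2 * Q by lia.
have := tree_min hok h1; rewrite hl // ha /kle.
have -> : (l == Q) = false by lia.
move=> /andP[hn hle].
have h2 : 0 < 1 < 2 * Q by lia.
by have /andP[] := tree_leaf hok hl h2 hn.
Qed.

End Tournament.

(** [aCh] is also read at the sentinel, but the value read there never decides: the first summand or
    the zero factor does. *)
Definition fixS :=
  tA <~ EArr aTr (EC 2 |*| EV tU) ;; tB <~ EArr aTr (EC 2 |*| EV tU |+| EC 1) ;;
  tG <~ (EC 0 |<| (EV tA |=| EV vW)
      |+| (EC 1 |-| (EV tB |=| EV vW)) |*| (EArr aCh (EV tB) |<| EArr aCh (EV tA))) ;;
  SSet aTr (EV tU) (EV tG |*| EV tB |+| (EC 1 |-| EV tG) |*| EV tA).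

Definition buildS :=
  SFor tK (EV vW) (SSet aTr (EV vW |+| EV tK) (EV tK)) ;;
  SFor tK (EV vW |-| EC 1) (tU <~ EV vW |-| EC 1 |-| EV tK ;; fixS).

(** Keys leave the tree in nondecreasing order, so the rank grows exactly when the key differs from
    the previous one. Starting [tPrev] at the first minimum gives that minimum rank 0. *)
Definition extractS :=
  tPrev <~ EArr aTr (EC 1) ;; tCur <~ EC 0 ;;
  SFor tK (EV vW)
    (tL <~ EArr aTr (EC 1) ;;
     tCur <~ EV tCur |+| (EC 1 |-| (EArr aCh (EV tL) |=| EArr aCh (EV tPrev))) ;;
     SSet aId (EV tL) (EV tCur) ;;
     tPrev <~ EV tL ;;
     SSet aTr (EV vW |+| EV tL) (EV vW) ;;
     tU <~ (EV vW |+| EV tL) |/| EC 2 ;;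
     SWhile (EC 0 |<| EV tU) (fixS ;; tU <~ EV tU |/| EC 2)).

Definition rankS := buildS ;; extractS.

Section Rank.
Variables (B Sz U Q qe : nat) (T : seq nat) (P : seq (option nat)).
Hypothesis hB : 8 * (U * U) < B.
Hypothesis hSz : Sz <= U.
Hypothesis U1 : 1 < U.
Hypothesis hQ : Q = 2 ^ qe.
Hypothesis hqe : 0 < qe.
Hypothesis hQS : 2 * Q <= Sz.
Notation tri := (tri B Sz T P).

Let UU : U <= U * U. Proof. by rewrite leq_pmulr; lia. Qed.
Let Q2 : 1 < Q. Proof. by rewrite hQ -{1}(expn0 2) ltn_exp2l. Qed.

Lemma tri_fix st u : vr st vW = Q -> vr st tU = u -> 0 < u < Q ->
  ar st aTr (2 * u) <= Q -> ar st aTr (2 * u + 1) <= Q ->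
  tri 1 fixS st (fun st' => forall i, ar st' aTr i =
    if i == u then better Q (ar st aCh) (ar st aTr (2 * u)) (ar st aTr (2 * u + 1)) else ar st aTr i).
Proof.
move=> vw vu hu h1 h2.
apply: tri_seq; apply: tri_asg => //=; rewrite ?vu; first by sp; lia.
apply: tri_seq; apply: tri_asg => //=; rewrite /upd /= ?vu; first by sp; lia.
set a := ar st _ _ in h1 *; set b := ar st _ _ in h2 *.
set g := nat_of_bool ((a == Q) || (b != Q) && (ar st aCh b < ar st aCh a)).
have eg : nat_of_bool (0 < (a == Q) + (1 - (b == Q)) * (ar st aCh b < ar st aCh a)) = g.
  by rewrite /g; case: (a == Q); case: (b == Q); case: (ar st aCh b < ar st aCh a).
apply: tri_seq; apply: tri_asg => //=; rewrite /upd /= ?vw ?eg.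
  have h3 : nat_of_bool (ar st aCh b < ar st aCh a) <= 1 by rewrite leq_b1.
  have h4 : nat_of_bool (a == Q) <= 1 by rewrite leq_b1.
  have h5 : (1 - (b == Q)) * (ar st aCh b < ar st aCh a) <= 1 * 1 by rewrite leq_mul // leq_subr.
  by sp; lia.
have hg : g <= 1 by rewrite /g leq_b1.
apply: tri_set => //=; rewrite /upd /= ?vu; first by lia.
  have h3 : g * b <= 1 * Q by rewrite leq_mul.
  have h4 : (1 - g) * a <= 1 * Q by rewrite leq_mul // leq_subr.
  by sp; lia.
move=> i; rewrite /better; case: eqP => // _.
rewrite /g; case: ifP => _ /=; lia.
Qed.

Definition trbnd lo (tr : nat -> nat) := forall u, lo < u < 2 * Q -> tr u <= Q.

Lemma tri_build st : vr st vW = Q ->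
  tri Q.+1 buildS st (fun st' => [/\ treeok Q (ar st aCh) 0 (ar st' aTr), trbnd 0 (ar st' aTr) &
    forall l, l < Q -> ar st' aTr (Q + l) = l]).
Proof.
move=> vw.
apply: tri_seq.
apply: (@tri_for B Sz T P (fun i st' => forall l, l < i -> ar st' aTr (Q + l) = l) Q 1) => //=.
- by lia.
- by lia.
- by move=> st' [hf _]; rewrite hf.
- move=> i st' hi [hf _] hv hI.
  have vw' : vr st' vW = Q by rewrite hf.
  apply: tri_set => //=; rewrite ?vw' ?hv; [by sp; lia| lia |].
  move=> l hl; rewrite eqn_add2l; case: eqP => // hne; apply: hI; lia.
move=> st1 [hf1 hg1] _ hI1.
have vw1 : vr st1 vW = Q by rewrite hf1.
apply: (@tri_for B Sz T P (fun i st' => [/\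
   forall u, Q - 1 - i < u < Q -> ar st' aTr u = better Q (ar st aCh) (ar st' aTr (2 * u)) (ar st' aTr (2 * u + 1)),
   trbnd (Q - 1 - i) (ar st' aTr) &
   forall l, l < Q -> ar st' aTr (Q + l) = l]) (Q - 1) 1) => //=.
- by lia.
- by lia.
- by move=> st' [hf _]; rewrite hf //= vw1; split=> //; lia.
- split=> //; first by move=> u; lia.
  move=> u hu; have -> : u = Q + (u - Q) by lia.
  by rewrite hI1; lia.
- move=> i st' hi [hf hg] hv [h1 h2 h3].
  have vw' : vr st' vW = Q by rewrite hf.
  set u := Q - 1 - i in h1 h2 *; have hu : 0 < u < Q by lia.
  apply: tri_seq; apply: tri_asg => //=; rewrite vw' hv -/u.
  apply: (@tri_imp _ _ _ _ 1).
  + by apply: (@tri_fix _ u) => //=; apply: h2; lia.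
  + by [].
  move=> st2 _ /= hs.
  have hch : ar st' aCh = ar st' aCh by [].
  have hbe a b : better Q (ar st' aCh) a b = better Q (ar st aCh) a b.
    by rewrite /better !hg //= !hg1.
  have eu : Q - 1 - i.+1 = u.-1 by lia.
  rewrite eu; split.
  + move=> v hv2; rewrite !hs.
    have -> : (2 * v == u) = false by lia.
    have -> : (2 * v + 1 == u) = false by lia.
    case: eqP => [-> //|hne]; apply: h1; lia.
  + move=> v hv2; rewrite hs; case: eqP => [_|hne]; last by apply: h2; lia.
    by rewrite /better; case: ifP => _; apply: h2; lia.
  + move=> l hl; rewrite hs.
    have -> : (Q + l == u) = false by lia.
    exact: h3.
- move=> st2 _ _ [h1 h2 h3]; have e : Q - 1 - (Q - 1) = 0 by lia.
  by rewrite e in h1 h2; split=> // u hu _; apply: h1.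
Qed.

(** Recomputing the only outdated node can invalidate nothing but its parent; after [qe] halvings
    the outdated node is 0, hence none. *)
Lemma tri_climb st u0 : vr st vW = Q -> vr st tU = u0 -> Q <= 2 * u0 < 2 * Q ->
  treeok Q (ar st aCh) u0 (ar st aTr) -> trbnd 0 (ar st aTr) ->
  tri qe.+1 (SWhile (EC 0 |<| EV tU) (fixS ;; tU <~ EV tU |/| EC 2)) st (fun st' =>
    [/\ treeok Q (ar st aCh) 0 (ar st' aTr), trbnd 0 (ar st' aTr) &
        forall l, Q <= l -> ar st' aTr l = ar st aTr l]).
Proof.
move=> vw vu hu hok hb.
apply: (@tri_while _ _ _ _ (fun i st' => vr st' tU = u0 %/ 2 ^ i /\
   [/\ treeok Q (ar st aCh) (u0 %/ 2 ^ i) (ar st' aTr), trbnd 0 (ar st' aTr) &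
        forall l, Q <= l -> ar st' aTr l = ar st aTr l]) qe 1) => //.
- by rewrite mul1n.
- by rewrite expn0 divn1.
- move=> i st' hi [hf hg] [hv [h1 h2 h3]].
  have vw' : vr st' vW = Q by rewrite hf.
  have hui : 0 < u0 %/ 2 ^ i.
    rewrite divn_gt0 ?expn_gt0 //.
    have : 2 * 2 ^ i <= Q by rewrite hQ -expnS leq_exp2l.
    by lia.
  have hui2 : u0 %/ 2 ^ i <= u0 by rewrite leq_div.
  have eS : u0 %/ 2 ^ i.+1 = u0 %/ 2 ^ i %/ 2 by rewrite expnSr divnMA.
  rewrite eS; set u := u0 %/ 2 ^ i in hv h1 hui hui2 *.
  split=> //=; first by rewrite hv hui.
  apply: tri_seq; apply: (@tri_imp _ _ _ _ 1).
  + apply: (@tri_fix _ u) => //; first by lia.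
      by apply: h2; lia.
    by apply: h2; lia.
  + by [].
  move=> st2 [hf2 hg2] hs.
  have hv2 : vr st2 tU = u by rewrite hf2.
  have hbe a b : better Q (ar st' aCh) a b = better Q (ar st aCh) a b by rewrite /better !hg.
  apply: tri_asg => //=; rewrite /upd /= hv2; split=> //; split.
  + move=> v hv3 hne; rewrite !hs hbe.
    have -> : (2 * v == u) = false by lia.
    have -> : (2 * v + 1 == u) = false by lia.
    by case: eqP => [->|/eqP hvu] //; apply: h1.
  + move=> v hv3; rewrite hs; case: eqP => [_|hne]; last by apply: h2.
    by rewrite /better; case: ifP => _; apply: h2; lia.
  + move=> l hl; rewrite hs.
    have -> : (l == u) = false by lia.
    exact: h3.
- move=> st' [hf _] [hv [h1 h2 h3]].
  have e0 : u0 %/ 2 ^ qe = 0 by rewrite divn_small // -hQ; lia.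
  rewrite e0 in hv h1.
  by split=> //=; rewrite hv.
Qed.

Lemma tri_rank st : vr st vW = Q ->
  tri (Q.+1 * qe.+1) rankS st (fun st' =>
    (forall l, l < Q -> ar st' aId l <= Q) /\
    forall l l', l < Q -> l' < Q ->
      (ar st' aId l == ar st' aId l') = (ar st aCh l == ar st aCh l')).
Proof.
move=> vw; set ch := ar st aCh.
apply: tri_seq; apply: tri_imp (tri_build vw) _ _; first by rewrite leq_pmulr.
move=> st1 [hf1 hg1] [ok1 b1 lf1].
have vw1 : vr st1 vW = Q by rewrite hf1.
have root1 l : l < Q -> ar st1 aTr 1 < Q /\ ch (ar st1 aTr 1) <= ch l.
  move=> hl; pose al := fun _ : nat => true.
  have h l' : l' < Q -> ar st1 aTr (Q + l') = if al l' then l' else Q by exact: lf1.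
  by have [] := @tree_root _ _ _ al ok1 h l hl isT.
apply: tri_seq; apply: tri_asg => //=; first by lia.
apply: tri_seq; apply: tri_asg => //=.
set st2 := setv _ tCur _.
(* [s] lists the extracted leaves; [prev] carries their largest key and [cur] is its rank, at most
   the number of extractions. *)
pose I k st' := exists s : seq nat, exists cur prev : nat,
  [/\ uniq s, size s = k, all (fun l => l < Q) s, vr st' tPrev = prev /\ vr st' tCur = cur &
   [/\ prev < Q, cur <= k,
     [/\ treeok Q ch 0 (ar st' aTr), trbnd 0 (ar st' aTr) &
       forall l, l < Q -> ar st' aTr (Q + l) = if l \notin s then l else Q],
     (forall l, l \in s -> ch l <= ch prev) /\ (forall l, l < Q -> l \notin s -> ch prev <= ch l) &
     [/\ forall l, l \in s -> ar st' aId l <= cur,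
       forall l l', l \in s -> l' \in s -> (ar st' aId l == ar st' aId l') = (ch l == ch l') &
       forall l, l \in s -> (ar st' aId l == cur) = (ch l == ch prev)]]].
apply: (@tri_for B Sz T P I Q qe.+1) => //=.
- by rewrite mulnC.
- by lia.
- by move=> st' [hf _]; rewrite hf.
- exists [::], 0, (ar st1 aTr 1); split=> //; split=> //.
  + by have [] := root1 0 (ltnW Q2).
  + by split=> // l hl _; have [] := root1 l hl.
- move=> i st' hi [hf hg] hvi [s [cur [prev [h1 h2 h3 [h4 h5] [h6 h7 [k1 k2 k3] [k4 k5] [m1 m2 m3]]]]]].
  have vw' : vr st' vW = Q by rewrite hf.
  have hch l : ar st' aCh l = ch l by rewrite hg //= hg1.
  have hbe a b : better Q (ar st' aCh) a b = better Q ch a b by rewrite /better !hch.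
  (* Fewer than [Q] leaves are gone, so one is left and the root is a true minimum rather than the
     sentinel. *)
  have [l0 hl0 hns] : exists2 l, l < Q & l \notin s.
    have : ~~ all (mem s) (iota 0 Q).
      apply/negP => /allP hall.
      have := @uniq_leq_size _ (iota 0 Q) s (iota_uniq 0 Q) hall; rewrite size_iota h2; lia.
    by case/allPn => l; rewrite mem_iota /= add0n => hl hls; exists l.
  have hroot l : l < Q -> l \notin s -> [/\ ar st' aTr 1 < Q, ar st' aTr 1 \notin s & ch (ar st' aTr 1) <= ch l].
    by move=> hl hls; exact: (@tree_root _ _ _ (fun x => x \notin s) k1 k3 l hl hls).
  set l := ar st' aTr 1 in hroot.
  have [hlQ hls _] := hroot _ hl0 hns.
  have hpl : ch prev <= ch l by apply: k5.
  apply: tri_seq; apply: tri_asg => //=; first by lia.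
  rewrite -/l.
  set cur' := cur + (ch l != ch prev).
  have hc1 : nat_of_bool (ch l != ch prev) <= 1 by rewrite leq_b1.
  apply: tri_seq; apply: tri_asg => //=; rewrite /upd /= ?h4 ?h5 ?hch.
    by sp; lia.
  have -> : cur + (1 - (ch l == ch prev)) = cur' by rewrite /cur'; case: eqP.
  apply: tri_seq; apply: tri_set => //=; rewrite /upd /=; first by lia.
  apply: tri_seq; apply: tri_asg => //=; rewrite /upd /=.
  apply: tri_seq; apply: tri_set => //=; rewrite /upd /= ?vw'; [by sp; lia|lia|].
  apply: tri_seq; apply: tri_asg => //=; rewrite /upd /= ?vw'; first by sp; lia.
  set st3 := setv _ tU _.
  have tr3 j : ar st3 aTr j = if j == Q + l then Q else ar st' aTr j by [].
  apply: (@tri_imp _ _ _ _ qe.+1).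
  + apply: (@tri_climb _ ((Q + l) %/ 2)) => //.
    * by have [q' hq'] : exists q', Q = 2 * q'; [exists (2 ^ qe.-1); rewrite hQ -expnS prednK | lia].
    * move=> u hu hne; rewrite !tr3.
      have hbe3 a b : better Q (ar st3 aCh) a b = better Q ch a b by exact: hbe.
      have e1 : (u == Q + l) = false by lia.
      have e2 : (2 * u == Q + l) = false.
        apply/negP => /eqP e; move/negP: hne; apply; rewrite -e mulKn //.
      have e3 : (2 * u + 1 == Q + l) = false.
        apply/negP => /eqP e; move/negP: hne; apply.
        by rewrite -e mulnC divnMDl // divn_small // addn0.
      rewrite e1 e2 e3 hbe3; apply: k1 => //; lia.
    * by move=> u hu; rewrite tr3; case: ifP => // _; apply: k2.
  + by [].
  move=> st4 [hf4 hg4] [n1 n2 n3].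
  have id4 j : ar st4 aId j = if j == l then cur' else ar st' aId j by rewrite hg4.
  have hltS x : x \in s -> ar st' aId x <= cur by exact: m1.
  exists (l :: s), cur', l; split=> /=.
  + by rewrite hls.
  + by rewrite h2.
  + by rewrite hlQ.
  + by rewrite !hf4.
  have hxl x : x \in s -> (x == l) = false.
    by move=> hx; apply/negP => /eqP e; rewrite -e hx in hls.
  (* By monotonicity an earlier leaf can share the new rank only when the new key equals the
     previous one. *)
  have hidx x : x \in s -> (ar st' aId x == cur') = (ch x == ch l).
    move=> hx; rewrite /cur'; case: (eqVneq (ch l) (ch prev)) => [e|hne].
      by rewrite addn0 m3 // e.
    have a1 := m1 _ hx; have a2 := k4 _ hx; move: hpl hne a1 a2; rewrite /=; lia.
  split=> //.
  + by rewrite /cur'; lia.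
  + split=> //.
    * move=> u hu hne; have hbe3 a b : better Q (ar st3 aCh) a b = better Q ch a b by exact: hbe.
      by rewrite (n1 u hu hne) hbe3.
    * move=> j hj; rewrite n3 ?leq_addr // tr3 eqn_add2l inE negb_or.
      by case: eqP => // hne; rewrite k3.
  + split.
    * move=> x; rewrite inE => /orP[/eqP -> //|hx].
      by apply: leq_trans (k4 _ hx) hpl.
    * move=> x hx; rewrite inE negb_or => /andP[_ hxs].
      by have [] := hroot _ hx hxs.
  + split.
    * move=> x; rewrite inE id4 => /orP[/eqP ->|hx]; first by rewrite eqxx.
      by rewrite hxl //; apply: leq_trans (m1 _ hx) _; rewrite leq_addr.
    * move=> x y; rewrite !inE !id4 => /orP[/eqP ->|hx] /orP[/eqP ->|hy]; rewrite ?eqxx ?hxl //.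
      - by rewrite eq_sym hidx // eq_sym.
      - by rewrite hidx.
      - exact: m2.
    * move=> x; rewrite inE id4 => /orP[/eqP ->|hx]; first by rewrite !eqxx.
      by rewrite hxl // hidx.
- move=> st4 [hf hg] _ [s [cur [prev [h1 h2 h3 _ [h6 h7 _ _ [m1 m2 _]]]]]].
  have hall l : l < Q -> l \in s.
    move=> hl; have hsub : {subset s <= iota 0 Q}.
      by move=> x hx; rewrite mem_iota /= add0n; apply: (allP h3).
    have [|_ ->] := uniq_min_size h1 hsub; first by rewrite size_iota h2.
    by rewrite mem_iota.
  split=> [l hl|l l' hl hl'].
    by apply: leq_trans (m1 _ (hall _ hl)) h7.
  by rewrite m2 ?hall.
Qed.

End Rank.

(** * The matching program *)

Notation vS := 0 (only parsing).
Notation vN := 1 (only parsing).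
Notation vP := 2 (only parsing).
Notation vB := 5 (only parsing).
Notation vK := 6 (only parsing).
Notation vRes := 7 (only parsing).
Notation vI0 := 8 (only parsing).
Notation vJ0 := 9 (only parsing).
Notation vI := 18 (only parsing).
Notation aAcc := 6 (only parsing).

(** The last quarter of the [4N] leaves keeps whatever it holds; this may only add further ranks. *)
Definition loadS :=
  SFor vI (EC 2 |*| EV vB) (SSet aCh (EV vI) (ERdT (EV vI0 |+| EV vJ0 |+| EV vI))) ;;
  SFor vI (EV vB) (SSet aCh (EC 2 |*| EV vB |+| EV vI) (ERdP (EV vJ0 |+| EV vI))).

Definition fillTS :=
  SFor vI (EC 2 |*| EV vB)
    (tA <~ EArr aId (EV vI) ;; tL <~ EC 8 |*| EV vI ;;
     SSet aX (EV tL) (EV tA |*| EV tA) ;; SSet aX (EV tL |+| EC 2) (EV tA) ;;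
     SSet aX (EV tL |+| EC 4) (EC 1) ;; SSet aX (EV tL |+| EC 6) (EC 0)).

(** The pattern is reversed, so that a product computes correlations. The marker [tB] also vanishes
    past the end of the pattern, and the upper half is cleared because [convS] overwrites [aX]. *)
Definition fillPS :=
  SFor vI (EV vB)
    (tA <~ EArr aId (EC 2 |*| EV vB |+| EV vI) ;;
     tB <~ (EV vJ0 |+| EV vI |<| EV vP) |*| (EC 1 |-| EWild (EV vJ0 |+| EV vI)) ;;
     tL <~ EC 8 |*| (EV vB |-| EC 1 |-| EV vI) ;;
     SSet aX (EV tL |+| EC 7) (EV tB) ;;
     SSet aX (EV tL |+| EC 5) (EV tB |*| (EV vM |-| EC 2 |*| EV tA)) ;;
     SSet aX (EV tL |+| EC 3) (EV tB |*| (EV tA |*| EV tA)) ;;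
     SSet aX (EV tL |+| EC 1) (EC 0) ;;
     tL <~ EC 8 |*| (EV vB |+| EV vI) ;;
     SSet aX (EV tL |+| EC 7) (EC 0) ;; SSet aX (EV tL |+| EC 5) (EC 0) ;;
     SSet aX (EV tL |+| EC 3) (EC 0) ;; SSet aX (EV tL |+| EC 1) (EC 0)).

(** Coefficient [4 * i + 4 * N - 1] pairs text slot [4 * (i + j) + c] with pattern slot
    [4 * (N - 1 - j) + 3 - c] and nothing else, since two slot offsets below 4 can only add up to 3
    modulo 4 by being 3. A nonzero value is recorded by a Boolean or. *)
Definition pairS :=
  loadS ;; rankS ;; fillTS ;; fillPS ;; convS ;;
  SFor vI (EV vB) (SSet aAcc (EV vI)
    (EC 0 |<| EArr aAcc (EV vI) |+| EArr aX (EC 4 |*| EV vI |+| EC 4 |*| EV vB |-| EC 1))).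

Lemma eq8 a b c d : c < 8 -> d < 8 -> (8 * a + c == 8 * b + d) = (a == b) && (c == d).
Proof. by lia. Qed.
Lemma eq8l a b c : c < 8 -> (8 * a + c == 8 * b) = (a == b) && (c == 0).
Proof. by lia. Qed.
Lemma eq8r a b d : d < 8 -> (8 * a == 8 * b + d) = (a == b) && (0 == d).
Proof. by lia. Qed.
Lemma eq8b a b : (8 * a == 8 * b) = (a == b).
Proof. by lia. Qed.

Definition mismatch (T : seq nat) (P : seq (option nat)) i j : bool :=
  if nth None P j is Some c then nth 0 T (i + j) != c else false.

(** Squared distance over [nat]: one of the truncated differences is always 0. *)
Definition dist2 t p := ((t - p) + (p - t)) * ((t - p) + (p - t)).

Lemma dist2E t p : t * t + p * p = dist2 t p + 2 * (t * p).
Proof.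
case: (leqP t p) => h.
  have [d ->] : exists d, p = t + d by exists (p - t); lia.
  have e1 : t - (t + d) = 0 by lia.
  by rewrite /dist2 e1 addKn; ring.
have [d ->] : exists d, t = p + d by exists (t - p); lia.
have e1 : p - (p + d) = 0 by lia.
by rewrite /dist2 e1 addKn; ring.
Qed.

Lemma dist2_eq0 t p : (dist2 t p == 0) = (t == p).
Proof. by rewrite /dist2 muln_eq0 orbb; lia. Qed.

(* The interleaved product: text side (t^2, t, 1, 0), pattern side (v, -2vp, vp^2, 0). *)
Lemma inter_sum M N i (f g : nat -> nat) (t p v : nat -> nat) : 0 < N -> i < N ->
  (forall j, j < N -> 2 * p j <= M) ->
  (forall l, l < 2 * N -> [/\ f (4 * l) = t l * t l, f (4 * l + 1) = t l & f (4 * l + 2) = 1]) ->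
  (forall j, j < N -> [/\ g (4 * (N - 1 - j) + 3) = v j, g (4 * (N - 1 - j) + 2) = v j * (M - 2 * p j),
     g (4 * (N - 1 - j) + 1) = v j * (p j * p j) & g (4 * (N - 1 - j)) = 0]) ->
  \sum_(b < 4 * N) f (4 * i + 4 * N - 1 - b) * g b =
  \sum_(j < N) v j * dist2 (t (i + j)) (p j) %[mod M].
Proof.
move=> N0 hi hp hf hg.
rewrite (big_ord_mul 4 N (fun b => f (4 * i + 4 * N - 1 - b) * g b)) exchange_big /=.
rewrite (reindex_inj rev_ord_inj) /=.
(* Storing [-2p] as [M - 2p] adds [M] times the text symbol at each non-wildcard, a multiple of the
   modulus. *)
have -> : \sum_(j < N) \sum_(r < 4) f (4 * i + 4 * N - 1 - (r + 4 * (N - j.+1))) * g (r + 4 * (N - j.+1)) =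
   \sum_(j < N) v j * dist2 (t (i + j)) (p j) + M * \sum_(j < N) v j * t (i + j).
  rewrite big_distrr /= -big_split /=; apply: eq_bigr => -[j hj] _ /=.
  have hl : i + j < 2 * N by lia.
  have [f0 f1 f2] := hf _ hl; have [g3 g2 g1 g0] := hg _ hj.
  rewrite !big_ord_recr big_ord0 /= !add0n.
  have -> : N - j.+1 = N - 1 - j by lia.
  rewrite g0 ![_ + 4 * (N - 1 - j)]addnC g1 g2 g3 muln0 add0n.
  have -> : 4 * i + 4 * N - 1 - (4 * (N - 1 - j) + 1) = 4 * (i + j) + 2 by lia.
  have -> : 4 * i + 4 * N - 1 - (4 * (N - 1 - j) + 2) = 4 * (i + j) + 1 by lia.
  have -> : 4 * i + 4 * N - 1 - (4 * (N - 1 - j) + 3) = 4 * (i + j) by lia.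
  rewrite f0 f1 f2.
  have h := dist2E (t (i + j)) (p j).
  set a := t (i + j) in h *; set q := p j in h *.
  have hq : M = 2 * q + (M - 2 * q) by have := hp _ hj; rewrite -/q; lia.
  rewrite {2}hq; set m := M - 2 * q; set V := v j.
  transitivity (V * (a * a + q * q) + a * (V * m)); first by ring.
  by rewrite h; ring.
by rewrite addnC mulnC modnMDl.
Qed.

(** * One pair of blocks *)

Section Pair.
Variables (B Sz U M k N : nat) (T : seq nat) (P : seq (option nat)).
Hypothesis hB : 8 * (U * U) < B.
Hypothesis hSz : Sz <= U.
Hypothesis hM : 1 < M <= U.
Hypothesis hN : 0 < N.
Hypothesis hk : 1 < k.
Hypothesis hD : 2 ^ k = 8 * N.
Hypothesis hS : 4 * (2 ^ k * k) <= Sz.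
(** The bound [k * 2 ^ k] on the gain, times [N] squared distances of ranks at most [4 * N]: below
    [M], the residue determines the value. *)
Hypothesis hMb : k * 2 ^ k * (N * (4 * N * (4 * N))) < M.
Notation tri := (tri B Sz T P).

Let UU : U <= U * U. Proof. by rewrite leq_pmulr; lia. Qed.
Let NS : 64 * N <= Sz.
Proof.
have h : 8 * N * 2 <= 8 * N * k by rewrite leq_mul2l hk orbT.
by have := hS; rewrite hD; lia.
Qed.
Let NM : 4 * N * (4 * N) < M.
Proof.
apply: leq_ltn_trans hMb; apply: leq_trans (leq_pmull _ hN) (leq_pmull _ _).
by rewrite muln_gt0 expn_gt0 /=; lia.
Qed.

Lemma tri_load st i0 j0 : vr st vB = N -> vr st vI0 = i0 -> vr st vJ0 = j0 -> i0 + j0 <= U ->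
  tri (2 * N).+1 loadS st (fun st' =>
    (forall l, l < 2 * N -> ar st' aCh l = nth 0 T (i0 + j0 + l)) /\
    (forall j, j < N -> ar st' aCh (2 * N + j) = if nth None P (j0 + j) is Some c then c else 0)).
Proof.
move=> vb vi vj hij; apply: tri_seq.
apply: (@tri_for B Sz T P (fun i st' => forall l, l < i -> ar st' aCh l = nth 0 T (i0 + j0 + l)) (2 * N) 1) => //=.
- by lia.
- by lia.
- by move=> st' [hf _]; rewrite hf //= vb; sp; lia.
- move=> i st' hi [hf _] hv hI.
  apply: tri_set => //=; rewrite ?hv ?(hf vI0) ?(hf vJ0) // ?vi ?vj; [lia | sp; lia |].
  move=> l hl; case: eqP => [->//|hne]; apply: hI; lia.
move=> st1 [hf1 _] _ hI1.
apply: (@tri_for B Sz T P (fun i st' =>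
    (forall l, l < 2 * N -> ar st' aCh l = nth 0 T (i0 + j0 + l)) /\
    (forall j, j < i -> ar st' aCh (2 * N + j) = if nth None P (j0 + j) is Some c then c else 0)) N 1) => //=.
- by lia.
- by lia.
- by move=> st' [hf _]; rewrite hf //= hf1.
- move=> i st' hi [hf _] hv [h1 h2].
  apply: tri_set => //=; rewrite ?hv ?(hf vB) ?(hf1 vB) ?(hf vJ0) ?(hf1 vJ0) // ?vb ?vj; [sp; lia | lia | sp; lia |].
  split=> [l hl|j hj].
    have -> : (l == 2 * N + i) = false by lia.
    exact: h1.
  rewrite eqn_add2l; case: eqP => [->//|hne]; apply: h2; lia.
Qed.

Lemma tri_fillT st (Id : nat -> nat) : vr st vB = N -> (forall l, l < 4 * N -> Id l <= 4 * N) ->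
  (forall l, ar st aId l = Id l) ->
  tri (2 * N).+1 fillTS st (fun st' => forall l, l < 2 * N ->
    [/\ ar st' aX (8 * l) = Id l * Id l, ar st' aX (8 * l + 2) = Id l,
        ar st' aX (8 * l + 4) = 1 & ar st' aX (8 * l + 6) = 0]).
Proof.
move=> vb hId hA.
apply: (@tri_for B Sz T P (fun i st' => forall l, l < i ->
    [/\ ar st' aX (8 * l) = Id l * Id l, ar st' aX (8 * l + 2) = Id l,
        ar st' aX (8 * l + 4) = 1 & ar st' aX (8 * l + 6) = 0]) (2 * N) 1) => //=.
- by lia.
- by lia.
- by move=> st' [hf _]; rewrite hf //= vb; sp; lia.
move=> i st' hi [hf hg] hv hI.
have hi4 : Id i <= 4 * N by apply: hId; lia.
have hii : Id i * Id i <= 4 * N * (4 * N) by apply: leq_mul.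
have hAi l : ar st' aId l = Id l by rewrite hg.
apply: tri_seq; apply: tri_asg => //=; rewrite ?hv; first by sp; lia.
apply: tri_seq; apply: tri_asg => //=; rewrite /upd /= ?hv ?hAi; first by sp; lia.
do 4!(first [apply: tri_seq; apply: tri_set | apply: tri_set]; rewrite //= /upd /= ?hv ?hAi; try by sp; lia).
move=> l hl; rewrite ?eq8 ?eq8l ?eq8r ?eq8b //; case: (eqVneq l i) => [->|hne] /=; first by split.
by apply: hI; lia.
Qed.

Definition nonwild j : nat := isSome (nth None P j).

Lemma nonwild_ev j : (j < size P) * (1 - ((j < size P) && (nth None P j == None))) = nonwild j.
Proof.
rewrite /nonwild; case: ltnP => h /=; first by rewrite mul1n; case: (nth None P j).
by rewrite mul0n nth_default.
Qed.

Lemma tri_fillP st j0 (Id : nat -> nat) : vr st vB = N -> vr st vM = M -> vr st vJ0 = j0 ->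
  vr st vP = size P -> j0 <= U ->
  (forall l, l < 4 * N -> Id l <= 4 * N) ->
  (forall l, ar st aId l = Id l) ->
  tri N.+1 fillPS st (fun st' => [/\ forall j, j < N ->
    [/\ ar st' aX (8 * (N - 1 - j) + 7) = nonwild (j0 + j),
        ar st' aX (8 * (N - 1 - j) + 5) = nonwild (j0 + j) * (M - 2 * Id (2 * N + j)),
        ar st' aX (8 * (N - 1 - j) + 3) = nonwild (j0 + j) * (Id (2 * N + j) * Id (2 * N + j)) &
        ar st' aX (8 * (N - 1 - j) + 1) = 0],
    forall j, j < N -> [/\ ar st' aX (8 * (N + j) + 7) = 0, ar st' aX (8 * (N + j) + 5) = 0,
        ar st' aX (8 * (N + j) + 3) = 0 & ar st' aX (8 * (N + j) + 1) = 0] &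
    forall l, [/\ ar st' aX (8 * l) = ar st aX (8 * l), ar st' aX (8 * l + 2) = ar st aX (8 * l + 2),
        ar st' aX (8 * l + 4) = ar st aX (8 * l + 4) & ar st' aX (8 * l + 6) = ar st aX (8 * l + 6)]]).
Proof.
move=> vb vm vj vp hj0 hId hA.
apply: (@tri_for B Sz T P (fun i st' => [/\ forall j, j < i ->
    [/\ ar st' aX (8 * (N - 1 - j) + 7) = nonwild (j0 + j),
        ar st' aX (8 * (N - 1 - j) + 5) = nonwild (j0 + j) * (M - 2 * Id (2 * N + j)),
        ar st' aX (8 * (N - 1 - j) + 3) = nonwild (j0 + j) * (Id (2 * N + j) * Id (2 * N + j)) &
        ar st' aX (8 * (N - 1 - j) + 1) = 0],
    forall j, j < i -> [/\ ar st' aX (8 * (N + j) + 7) = 0, ar st' aX (8 * (N + j) + 5) = 0,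
        ar st' aX (8 * (N + j) + 3) = 0 & ar st' aX (8 * (N + j) + 1) = 0] &
    forall l, [/\ ar st' aX (8 * l) = ar st aX (8 * l), ar st' aX (8 * l + 2) = ar st aX (8 * l + 2),
        ar st' aX (8 * l + 4) = ar st aX (8 * l + 4) & ar st' aX (8 * l + 6) = ar st aX (8 * l + 6)]]) N 1) => //=.
- by lia.
- by lia.
- by move=> st' [hf _]; rewrite hf.
move=> i st' hi [hf hg] hv [I1 I2 I3].
have vb' : vr st' vB = N by rewrite hf.
have vm' : vr st' vM = M by rewrite hf.
have vj' : vr st' vJ0 = j0 by rewrite hf.
have vp' : vr st' vP = size P by rewrite hf.
set q := Id (2 * N + i).
have hq : q <= 4 * N by apply: hId; lia.
have hqq : q * q <= 4 * N * (4 * N) by apply: leq_mul.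
have hAi l : ar st' aId l = Id l by rewrite hg.
set pb := nonwild (j0 + i).
have hpb : pb <= 1 by rewrite leq_b1.
have h1 : pb * (M - 2 * q) <= 1 * M by apply: leq_mul => //; rewrite leq_subr.
have h2 : pb * (q * q) <= 1 * (4 * N * (4 * N)) by apply: leq_mul.
have h3 : (j0 + i < size P) * (1 - ((j0 + i < size P) && (nth None P (j0 + i) == None))) < B.
  by rewrite nonwild_ev -/pb; lia.
apply: tri_seq; apply: tri_asg => //=; rewrite ?hv ?vb'; first by sp; lia.
apply: tri_seq; apply: tri_asg => //=; rewrite /upd /= ?hv ?vj' ?vp' ?hAi -/q; first by sp; lia.
rewrite nonwild_ev -/pb.
apply: tri_seq; apply: tri_asg => //=; rewrite /upd /= ?hv ?vb'; first by sp; lia.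
do 4!(apply: tri_seq; apply: tri_set; rewrite //= /upd /= ?vm'; try by sp; lia).
apply: tri_seq; apply: tri_asg => //=; rewrite /upd /= ?hv ?vb'; first by sp; lia.
do 4!(first [apply: tri_seq; apply: tri_set | apply: tri_set]; rewrite //= /upd /=; try by sp; lia).
split.
- move=> j hj; rewrite ?eq8 //.
  have -> : (N - 1 - j == N + i) = false by lia.
  have -> : (N - 1 - j == N - 1 - i) = (j == i) by lia.
  by case: (eqVneq j i) => [->|hne] //=; apply: I1; lia.
- move=> j hj; rewrite ?eq8 // eqn_add2l.
  have -> : (N + j == N - 1 - i) = false by lia.
  by case: (eqVneq j i) => [->|hne] //=; apply: I2; lia.
- by move=> l; rewrite ?eq8 ?eq8l ?eq8r ?eq8b // !andbF.
Qed.

Lemma dist2_le a b c : a <= c -> b <= c -> dist2 a b <= c * c.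
Proof. by move=> ha hb; apply: leq_mul; lia. Qed.

Lemma div4 b : exists l r, b = 4 * l + r /\ r < 4.
Proof. by exists (b %/ 4), (b %% 4); split; [lia | rewrite ltn_pmod]. Qed.

Lemma tri_pair st i0 j0 : vr st vB = N -> vr st vD = 2 ^ k -> vr st vW = 4 * N -> vr st vM = M ->
  vr st vP = size P -> vr st vI0 = i0 -> vr st vJ0 = j0 -> i0 + j0 <= U ->
  (forall i, i < N -> ar st aAcc i <= 1) ->
  tri (Sz.+1 * k.+2 * k.+2) pairS st (fun st' => forall i, i < N -> ar st' aAcc i <= 1 /\
    (ar st' aAcc i == 0) = (ar st aAcc i == 0) && all (fun j => ~~ mismatch T P (i0 + i) (j0 + j)) (iota 0 N)).
Proof.
move=> vb vd vw vm vp vi vj hij hacc.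
have hQ : 4 * N = 2 ^ k.-1.
  by have := hD; rewrite -{1}(prednK (ltnW hk)) expnS; lia.
have k0 : 0 < k.-1 by lia.
have F1 : Sz.+1 <= Sz.+1 * k.+2 * k.+2 by rewrite -mulnA leq_pmulr.
have F2 : (4 * N).+1 * k.-1.+1 <= Sz.+1 * k.+2 * k.+2.
  by rewrite -mulnA; apply: leq_mul; [lia | apply: leq_trans (leq_pmull _ _); lia].
apply: tri_seq; apply: tri_imp (tri_load vb vi vj hij) _ _; first by lia.
move=> st1 [f1 g1] [ld1 ld2].
apply: tri_seq; apply: (@tri_imp _ _ _ _ ((4 * N).+1 * k.-1.+1)).
- by apply: (@tri_rank B Sz U (4 * N) k.-1) => //; rewrite ?f1 //; lia.
- exact: F2.
move=> st2 [f2 g2] [rk1 rk2].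
apply: tri_seq; apply: (@tri_imp _ _ _ _ (2 * N).+1).
- by apply: (@tri_fillT st2 (ar st2 aId)) => //; rewrite f2 // f1.
- by lia.
move=> st3 [f3 g3] ft.
apply: tri_seq; apply: (@tri_imp _ _ _ _ N.+1).
- apply: (@tri_fillP st3 j0 (ar st2 aId)) => //; rewrite ?f3 ?f2 ?f1 //; try lia.
  by move=> l; rewrite g3.
- by lia.
move=> st4 [f4 g4] [fp1 fp2 fp3].
set Id := ar st2 aId in rk1 rk2 ft fp1.
set X := ar st4 aX.
have ft4 l : l < 2 * N -> [/\ X (8 * l) = Id l * Id l, X (8 * l + 2) = Id l, X (8 * l + 4) = 1 & X (8 * l + 6) = 0].
  by move=> hl; have [a0 a1 a2 a3] := fp3 l; have [b0 b1 b2 b3] := ft l hl; split; rewrite /X ?a0 ?a1 ?a2 ?a3.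
have IdQ l : l < 4 * N -> Id l * Id l <= 4 * N * (4 * N).
  by move=> hl; apply: leq_mul; apply: rk1.
have hX q : q < 2 * 2 ^ k -> X q <= M.
  rewrite hD => hq.
  have [l [r [e hr]]] : exists l r, q = 8 * l + r /\ r < 8.
    by exists (q %/ 8), (q %% 8); split; [lia | rewrite ltn_pmod].
  have hl : l < 2 * N by lia.
  have [a0 a1 a2 a3] := ft4 l hl.
  have hl4 : l < 4 * N by lia.
  have i1 := IdQ l hl4; have i2 := rk1 l hl4.
  have h4 : 4 * N <= 4 * N * (4 * N) by rewrite leq_pmulr //; lia.
  have [c1 c3 c5 c7] : [/\ X (8 * l + 1) <= M, X (8 * l + 3) <= M, X (8 * l + 5) <= M & X (8 * l + 7) <= M].
    case: (ltnP l N) => hlN.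
      have e1 : l = N - 1 - (N - 1 - l) by lia.
      have hj : N - 1 - l < N by lia.
      have := fp1 _ hj; rewrite -e1 -/X => -[-> -> -> ->].
      have hl5 : 2 * N + (N - 1 - l) < 4 * N by lia.
      have i3 := IdQ _ hl5.
      have hpv : nonwild (j0 + (N - 1 - l)) <= 1 by rewrite leq_b1.
      have h1 := leq_mul hpv (leq_subr (2 * Id (2 * N + (N - 1 - l))) M).
      have h2 := leq_mul hpv i3.
      by split; lia.
    have e1 : l = N + (l - N) by lia.
    have hj : l - N < N by lia.
    by have := fp2 _ hj; rewrite -e1 -/X => -[-> -> -> ->].
  rewrite e; case: r hr {e} => [|[|[|[|[|[|[|[|]]]]]]]] // _; rewrite ?addn0 ?a0 ?a1 ?a2 ?a3 //; lia.
apply: tri_seq; apply: (@tri_imp _ _ _ _ (Sz.+1 * k.+2 * k.+2)).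
- apply: (@tri_conv B Sz U M T P hB hSz hM k st4) => //; rewrite ?f4 ?f3 ?f2 ?f1 //.
- by [].
move=> st5 [f5 g5] [s [Xf [Z [w1 w2 w3 w4 [w5 w6 w7]]]]].
set Y := ar st5 aX in w4 w7.
have gain0 : 0 < gain s.
  by rewrite /gain prodn_cond_gt0 // => a _; rewrite expn_gt0.
have hmm i : i < N -> (Y (4 * i + 4 * N - 1) == 0) = all (fun j => ~~ mismatch T P (i0 + i) (j0 + j)) (iota 0 N).
  move=> hi; set kk := 4 * i + 4 * N - 1.
  set S := \sum_(j < N) nonwild (j0 + j) * dist2 (Id (i + j)) (Id (2 * N + j)).
  have hkk : kk < 2 ^ k by rewrite hD /kk; lia.
  (* Both sides are below [M], so the congruence given by [conv_coef] and [inter_sum] is an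
     equality. *)
  have hY : Y kk = gain s * S.
    have hSb : S <= N * (4 * N * (4 * N)).
      rewrite -[X in _ <= X * _]card_ord -sum_nat_const; apply: leq_sum => -[j hj] _ /=.
      rewrite -[X in _ <= X]mul1n; apply: leq_mul; first by rewrite leq_b1.
      by apply: dist2_le; apply: rk1; lia.
    have hgS : gain s * S < M by apply: leq_ltn_trans hMb; apply: leq_mul.
    rewrite -(modn_small hgS) -(modn_small (w4 _ hkk)).
    have hL : 0 < 4 * N <= 2 ^ k by rewrite hD; lia.
    have hLk : 4 * N <= kk.+1 <= 2 ^ k by rewrite /kk hD in hkk *; lia.
    have hM1 : 1 < M by lia.
    rewrite (conv_coef hM1 (ltnW hk) w1 w2 w5 w6 w7 _ hL hLk); last first.
      move=> b; rewrite hD => hb; have [l [r [e hr]]] := div4 b.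
      have e1 : 2 * b + 1 = 8 * (N + (l - N)) + (2 * r + 1) by lia.
      have hlN : l - N < N by lia.
      rewrite e1; have [z7 z5 z3 z1] := fp2 _ hlN.
      by case: r hr {e e1} => [|[|[|[|]]]].
    rewrite -modnMmr.
    rewrite (@inter_sum M N i (fun a => X (2 * a)) (fun b => X (2 * b + 1)) Id (fun j => Id (2 * N + j)) (fun j => nonwild (j0 + j))) ?modnMmr //.
    - move=> j hj; have h := rk1 (2 * N + j); have : Id (2 * N + j) <= 4 * N by apply: h; lia.
      have : 4 * N * 4 <= 4 * N * (4 * N) by rewrite leq_mul2l; lia.
      lia.
    - move=> l hl; have [a0 a1 a2 a3] := ft4 l hl.
      have e c : 2 * (4 * l + c) = 8 * l + 2 * c by lia.
      have e0 : 2 * (4 * l) = 8 * l by lia.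
      by rewrite /= !e e0.
    - move=> j hj; have [b7 b5 b3 b1] := fp1 j hj.
      have e c : 2 * (4 * (N - 1 - j) + c) + 1 = 8 * (N - 1 - j) + (2 * c + 1) by lia.
      have e0 : 2 * (4 * (N - 1 - j)) + 1 = 8 * (N - 1 - j) + 1 by lia.
      by rewrite /= !e e0.
  (* The gain is positive and the sum vanishes termwise; by [rk2] equal ranks mean equal
     characters. *)
  rewrite hY muln_eq0 gtn_eqF //= /S sum_nat_eq0.
  apply/forallP/allP => /= [h j|h [j hj]] /=.
    rewrite mem_iota /= add0n => hj.
    have := h (Ordinal hj); rewrite /= muln_eq0 dist2_eq0 rk2; [|lia|lia].
    rewrite ld1; last by lia.
    rewrite ld2 // /mismatch /nonwild; case: (nth None P (j0 + j)) => [c|] //=.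
    by rewrite addnACA negbK.
  have hj2 : j \in iota 0 N by rewrite mem_iota.
  have := h j hj2; rewrite muln_eq0 dist2_eq0 rk2; [|lia|lia].
  rewrite ld1; last by lia.
  rewrite ld2 // /mismatch /nonwild; case: (nth None P (j0 + j)) => [c|] //=.
  by rewrite addnACA negbK.
have acc5 i : ar st5 aAcc i = ar st aAcc i by rewrite g5 // g4 // g3 // g2 // g1.
apply: (@tri_for B Sz T P (fun t st' => (forall i, i < t -> ar st' aAcc i <= 1 /\
    (ar st' aAcc i == 0) = (ar st aAcc i == 0) && (Y (4 * i + 4 * N - 1) == 0)) /\
    forall i, t <= i -> ar st' aAcc i = ar st aAcc i) N 1) => //=.
- by lia.
- by lia.
- by move=> st' [hf _]; rewrite hf // f5 // f4 // f3 // f2 // f1.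
- move=> t st' ht [hf hg] hv [I1 I2].
  have vb' : vr st' vB = N by rewrite hf // f5 // f4 // f3 // f2 // f1.
  have hk2 : 4 * t + 4 * N - 1 < 2 ^ k by rewrite hD; lia.
  have hY := w4 _ hk2; have hA := hacc t ht.
  apply: tri_set => //=; rewrite ?hv ?vb' ?I2 ?hg // -?/Y; [lia | sp; lia |].
  split=> [i|i hi].
    rewrite ltnS leq_eqVlt => /orP[/eqP ->|hi].
      by rewrite eqxx leq_b1; split=> //; rewrite eqb0 -leqNgt leqn0 addn_eq0.
    have -> : (i == t) = false by lia.
    exact: I1.
  have -> : (i == t) = false by lia.
  by apply: I2; lia.
- move=> st' _ _ [I1 _] i hi; have [b1 b2] := I1 i hi.
  by split; rewrite // b2 hmm.
Qed.

End Pair.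

(** * Loops over the blocks *)

Definition scanS := vJ0 <~ EC 0 ;; SWhile (EV vJ0 |<| EV vP) (pairS ;; vJ0 <~ EV vJ0 |+| EV vB).

(** Text reads past the end give 0 and might feign agreement, hence the separate length test. Later
    occurrences overwrite [vRes], any one being acceptable. *)
Definition blockS :=
  SFor vI (EV vB) (SSet aAcc (EV vI) (EC 0)) ;;
  scanS ;;
  SFor vI (EV vB)
    (tA <~ (EV vI0 |+| EV vI |+| EV vP |<| EV vN |+| EC 1) |*| (EArr aAcc (EV vI) |=| EC 0) ;;
     vRes <~ EV tA |*| (EV vI0 |+| EV vI |+| EC 1) |+| (EC 1 |-| EV tA) |*| EV vRes).

Definition mainS :=
  vRes <~ EC 0 ;; vI0 <~ EC 0 ;;
  SWhile (EV vI0 |+| EV vP |<| EV vN |+| EC 1) (blockS ;; vI0 <~ EV vI0 |+| EV vB).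

(** The exponent starts at 3 so that [N = 2 ^ k / 8] is at least 1. The test at exponent [i] asks
    whether the [4 * (2 ^ i.+1 * i.+1)] cells of the next exponent are still at most [s]. *)
Definition initS :=
  vD <~ EC 8 ;; vK <~ EC 3 ;;
  SWhile (EC 8 |*| EV vD |*| (EV vK |+| EC 1) |<| EV vS |+| EC 1)
    (vD <~ EC 2 |*| EV vD ;; vK <~ EV vK |+| EC 1) ;;
  vB <~ EV vD |/| EC 8 ;; vW <~ EV vD |/| EC 2 ;;
  vM <~ EV vN |+| EC 1 ;; vM <~ EV vM |*| EV vM ;;
  vM <~ EV vM |*| EV vM ;; vM <~ EC 16 |*| EC 32 |*| EV vM.

Definition wildS := initS ;; mainS ;; vS <~ EV vRes.

Definition matchb (T : seq nat) P i := (i + size P <= size T) && all (fun j => ~~ mismatch T P i j) (iota 0 (size P)).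

Lemma matchP T P i : reflect (wmatch_at T P i) (matchb T P i).
Proof.
apply: (iffP andP) => [[h1 /allP h2]|[h1 h2]]; split=> //.
  move=> j hj; have := h2 j; rewrite mem_iota /= add0n hj => /(_ isT).
  by rewrite /mismatch; case: (nth None P j) => // c; rewrite negbK => /eqP.
apply/allP => j; rewrite mem_iota /= add0n => /h2.
by rewrite /mismatch; case: (nth None P j) => // c ->; rewrite eqxx.
Qed.

(** [nth None] reads a wildcard past the end, so the last block of a scan may overhang the
    pattern. *)
Lemma all_mismatch T P i m : size P <= m ->
  all (fun j => ~~ mismatch T P i j) (iota 0 m) = all (fun j => ~~ mismatch T P i j) (iota 0 (size P)).
Proof.
move=> h; rewrite -(subnKC h) iotaD all_cat add0n.
rewrite [X in _ && X](_ : _ = true) ?andbT //; apply/allP => j; rewrite mem_iota => /andP[hj _].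
by rewrite /mismatch nth_default.
Qed.

Section Main.
Variables (B Sz U M k N : nat) (T : seq nat) (P : seq (option nat)).
Hypothesis hB : 8 * (U * U) < B.
Hypothesis hSz : Sz <= U.
Hypothesis hM : 1 < M <= U.
Hypothesis hN : 0 < N.
Hypothesis hk : 1 < k.
Hypothesis hD : 2 ^ k = 8 * N.
Hypothesis hS : 4 * (2 ^ k * k) <= Sz.
Hypothesis hMb : k * 2 ^ k * (N * (4 * N * (4 * N))) < M.
Hypothesis hn : 8 * (size T + N).+1 <= U.
Hypothesis hP : size P <= size T.
Notation tri := (tri B Sz T P).
Let F := Sz.+1 * k.+2 * k.+2.
Let kp := (size P + N - 1) %/ N.
Let ki := (size T - size P) %/ N + 1.

Let UU : U <= U * U. Proof. by rewrite leq_pmulr; lia. Qed.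
Let NS : 64 * N <= Sz.
Proof.
have h : 8 * N * 2 <= 8 * N * k by rewrite leq_mul2l hk orbT.
by have := hS; rewrite hD; lia.
Qed.
Let F0 : 0 < F. Proof. by []. Qed.
Let FN : N.+1 <= F.
Proof. by apply: leq_trans (_ : Sz.+1 <= _); [lia | rewrite /F -mulnA leq_pmulr]. Qed.

Let kp_lt t : t < kp -> t * N < size P.
Proof.
rewrite /kp => ht; have : t.+1 * N <= size P + N - 1.
  by apply: leq_trans (leq_trunc_div _ N); rewrite leq_mul2r ht orbT.
by rewrite mulSn; lia.
Qed.

Let kp_ge : size P <= kp * N.
Proof.
rewrite /kp; have := ltn_ceil (size P + N - 1) hN; rewrite mulSn; lia.
Qed.

Definition env st := [/\ vr st vB = N, vr st vD = 2 ^ k, vr st vW = 4 * N, vr st vM = M &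
   vr st vP = size P /\ vr st vN = size T].

Lemma env_frame s qs st st' : frame s qs st st' ->
  all (fun x => x \notin s) [:: vB; vD; vW; vM; vP; vN] -> env st -> env st'.
Proof.
move=> [hf _] /= /and5P[h1 h2 h3 h4 /and3P[h5 h6 _]] [e1 e2 e3 e4 [e5 e6]].
by split; rewrite ?hf.
Qed.

Lemma tri_scan st i0 : env st -> vr st vI0 = i0 -> i0 <= size T ->
  (forall i, i < N -> ar st aAcc i = 0) ->
  tri (F * kp.+1) scanS st (fun st' => forall i, i < N ->
    (ar st' aAcc i == 0) = all (fun j => ~~ mismatch T P (i0 + i) j) (iota 0 (size P))).
Proof.
move=> he vi hi0 hacc.
apply: tri_seq; apply: tri_asg => //=.
set st0 := setv _ _ _.
have he0 : env st0 by case: he.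
apply: (@tri_while _ _ _ _ (fun t st' => vr st' vJ0 = t * N /\ forall i, i < N -> ar st' aAcc i <= 1 /\
   (ar st' aAcc i == 0) = all (fun j => ~~ mismatch T P (i0 + i) j) (iota 0 (t * N))) kp F) => //.
- by split=> // i hi; rewrite /= hacc.
- move=> t st' ht hf [hv hI].
  have he' : env st' by apply: env_frame hf _ he0.
  have [e1 e2 e3 e4 [e5 e6]] := he'.
  have hi' : vr st' vI0 = i0 by rewrite (proj1 hf).
  have htp := kp_lt ht.
  split=> //=; first by rewrite hv e5 htp.
  apply: tri_seq; apply: (@tri_imp _ _ _ _ F).
  + apply: (@tri_pair B Sz U M k N T P hB hSz hM hN hk hD hS hMb st' i0 (t * N)) => //; first by lia.
    by move=> i /hI[].
  + by [].
  move=> st2 hf2 hI2.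
  have [d1 d2 d3 d4 [d5 d6]] : env st2 by apply: env_frame hf2 _ he'.
  have hv2 : vr st2 vJ0 = t * N by rewrite (proj1 hf2).
  apply: tri_asg => //=; first by rewrite hv2 d1; sp; lia.
  rewrite /upd /= hv2 d1 mulSn addnC; split=> // i hi; have [a1 a2] := hI2 i hi; split=> //.
  rewrite a2 (proj2 (hI i hi)) [N + t * N]addnC iotaD all_cat add0n; congr (_ && _).
  by rewrite -[in RHS](addn0 (t * N)) iotaDl all_map.
- move=> st' hf [hv hI].
  have he' : env st' by apply: env_frame hf _ he0.
  have [e1 e2 e3 e4 [e5 e6]] := he'.
  split=> //=; first by rewrite hv e5 ltnNge kp_ge.
  by move=> i hi; rewrite (proj2 (hI i hi)) all_mismatch.
Qed.

Lemma tri_block st i0 r0 : env st -> vr st vI0 = i0 -> i0 <= size T -> vr st vRes = r0 -> r0 <= U ->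
  tri (F * kp.+1) blockS st (fun st' =>
    vr st' vRes = r0 /\ (forall i, i0 <= i < i0 + N -> ~~ matchb T P i) \/
    exists i, [/\ i0 <= i < i0 + N, vr st' vRes = i.+1 & matchb T P i]).
Proof.
move=> he vi hi0 vres hr0.
have [e1 e2 e3 e4 [e5 e6]] := he.
have FF : F <= F * kp.+1 by rewrite leq_pmulr.
apply: tri_seq.
apply: (@tri_for B Sz T P (fun t st' => forall i, i < t -> ar st' aAcc i = 0) N 1) => //=.
- by lia.
- by lia.
- by move=> st' [hf _]; rewrite hf.
- move=> t st' ht _ hv hI; apply: tri_set => //=; rewrite ?hv; first by lia.
  move=> i hi; case: eqP => // hne; apply: hI; lia.
move=> st1 hf1 _ hI1.
have he1 : env st1 by apply: env_frame hf1 _ he.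
have vi1 : vr st1 vI0 = i0 by rewrite (proj1 hf1).
apply: tri_seq; apply: tri_imp (tri_scan he1 vi1 hi0 hI1) (leqnn _) _.
move=> st2 hf2 hI2.
have he2 : env st2 by apply: env_frame hf2 _ he1.
have vi2 : vr st2 vI0 = i0 by rewrite (proj1 hf2).
have vres2 : vr st2 vRes = r0 by rewrite (proj1 hf2) // (proj1 hf1).
have [d1 d2 d3 d4 [d5 d6]] := he2.
apply: (@tri_for B Sz T P (fun t st' =>
    vr st' vRes = r0 /\ (forall i, i0 <= i < i0 + t -> ~~ matchb T P i) \/
    exists i, [/\ i0 <= i < i0 + t, vr st' vRes = i.+1 & matchb T P i]) N 1) => //=.
- by lia.
- by lia.
- by move=> st' [hf _]; rewrite hf.
- by left; split=> // i; lia.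
- move=> t st' ht hf hv hI.
  have [c1 c2 c3 c4 [c5 c6]] : env st' by apply: env_frame hf _ he2.
  have vi' : vr st' vI0 = i0 by rewrite (proj1 hf).
  have hres : vr st' vRes <= U.
    case: hI => [[-> _] //|[i [hi -> _]]]; lia.
  have hacc := hI2 t ht; rewrite -(proj2 hf aAcc) // in hacc.
  have hc : nat_of_bool (i0 + t + size P < size T + 1) * (ar st' aAcc t == 0) = nat_of_bool (matchb T P (i0 + t)).
    by rewrite mulnb addn1 ltnS hacc.
  apply: tri_seq; apply: tri_asg => //=; rewrite ?vi' ?hv ?c5 ?c6 ?hc.
    by have hb := leq_b1 (matchb T P (i0 + t)); sp; lia.
  set m := matchb T P (i0 + t).
  have h1 : nat_of_bool m * (i0 + t + 1) <= 1 * U by apply: leq_mul; [rewrite leq_b1 | lia].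
  have h2 : (1 - nat_of_bool m) * vr st' vRes <= 1 * U by apply: leq_mul => //; rewrite leq_subr.
  apply: tri_asg => //=; rewrite /upd /= ?vi' ?hv; first by sp; lia.
  case hm: m.
    right; exists (i0 + t); split; [by lia | by rewrite /= mul1n mul0n addn0 addn1 | exact: hm].
  rewrite mul0n add0n mul1n; case: hI => [[a1 a2]|[i [a1 a2 a3]]].
    left; split=> // i hi; have [hlt|e] : i < i0 + t \/ i = i0 + t by lia.
      by apply: a2; lia.
    by rewrite e -/m hm.
  by right; exists i; split=> //; lia.
Qed.

Lemma tri_main st : env st ->
  tri (F * kp.+1 * ki.+1) mainS st (fun st' => correct_output T P (vr st' vRes)).
Proof.
move=> he; have [e1 e2 e3 e4 [e5 e6]] := he.
apply: tri_seq; apply: tri_asg => //=.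
apply: tri_seq; apply: tri_asg => //=.
set st0 := setv _ _ _.
have he0 : env st0 by case: he.
have hki t : (t < ki) = (t * N + size P <= size T).
  by rewrite /ki addn1 ltnS leq_divRL // leq_subRL // addnC.
apply: (@tri_while _ _ _ _ (fun t st' => vr st' vI0 = t * N /\
   (vr st' vRes = 0 /\ (forall i, i < t * N -> ~~ matchb T P i) \/
    exists i, vr st' vRes = i.+1 /\ matchb T P i)) ki (F * kp.+1)) => //.
- by split=> //; left.
- move=> t st' ht hf [hv hI].
  have he' : env st' by apply: env_frame hf _ he0.
  have [c1 c2 c3 c4 [c5 c6]] := he'.
  have ht' := ht; rewrite hki in ht'.
  split=> /=.
  + by rewrite hv c5 c6; sp; lia.
  + by rewrite hv c5 c6 eqb0 -leqNgt; lia.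
  have hres : vr st' vRes <= U.
    by case: hI => [[-> _] //|[i [-> /andP[h _]]]]; lia.
  have hi0 : t * N <= size T by lia.
  apply: tri_seq; apply: tri_imp (tri_block he' hv hi0 erefl hres) (leqnn _) _.
  move=> st2 hf2 hI2.
  have [d1 d2 d3 d4 [d5 d6]] : env st2 by apply: env_frame hf2 _ he'.
  have hv2 : vr st2 vI0 = t * N by rewrite (proj1 hf2).
  apply: tri_asg => //=; first by rewrite hv2 d1; sp; lia.
  rewrite /upd /= hv2 d1 mulSn addnC; split=> //.
  case: hI2 => [[a1 a2]|[i [a1 a2 a3]]]; last by right; exists i.
  rewrite a1; case: hI => [[b1 b2]|]; last by right.
  left; split=> // i hi; case: (ltnP i (t * N)) => h; first exact: b2.
  by apply: a2; lia.
- move=> st' hf [hv hI].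
  have he' : env st' by apply: env_frame hf _ he0.
  have [c1 c2 c3 c4 [c5 c6]] := he'.
  have hend : size T < ki * N + size P by have := hki ki; rewrite ltnn; lia.
  have hkiN : ki * N <= size T + N.
    have : ki.-1 < ki by rewrite /ki addn1.
    rewrite hki; have -> : ki * N = ki.-1 * N + N by rewrite /ki addn1 mulSn addnC.
    lia.
  split=> /=.
  + by rewrite hv c5 c6; sp; lia.
  + by rewrite hv c5 c6; lia.
  case: hI => [[a1 a2]|[i [a1 a2]]].
    left; split=> // i /matchP hm; have := a2 i; rewrite hm => h.
    have := h; case: (ltnP i (ki * N)) => h1; first by move=> /(_ isT).
    by move: hm => /andP[h2 _]; lia.
  by right; exists i; split=> //; apply/matchP.
Qed.

End Main.

(** * Parameters and arithmetic bounds *)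

Lemma block_exponent_ex s : exists k, [/\ 2 < k, s < 8 * 2 ^ k * (k + 1),
  forall i, 2 < i < k -> 8 * 2 ^ i * (i + 1) <= s & k = 3 \/ 4 * (2 ^ k * k) <= s].
Proof.
have ex : exists k, (2 < k) && (s < 8 * 2 ^ k * (k + 1)).
  exists s.+3 => //=; have := ltn_expl s (ltnSn 1); rewrite !expnS.
  by rewrite -[X in X < _ -> _]muln1 => h; apply: leq_trans (leq_pmulr _ _); lia.
exists (ex_minn ex); case: ex_minnP => k /andP[k2 hs] hmin.
have hlt i : 2 < i < k -> 8 * 2 ^ i * (i + 1) <= s.
  move=> /andP[h1 h2]; rewrite leqNgt; apply/negP => h3.
  by have := hmin i; rewrite h1 h3 => /(_ isT); lia.
split=> //.
have [->|k3] : k = 3 \/ 3 < k by lia.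
  by left.
(* By minimality the previous exponent satisfied the loop test, and [8 * 2 ^ k.-1 * k] equals
   [4 * (2 ^ k * k)]. *)
right; have hk : 2 < k.-1 < k by lia.
have := hlt _ hk; have -> : k.-1 + 1 = k by lia.
have e2 : 2 ^ k = 2 * 2 ^ k.-1 by rewrite -expnS prednK //; lia.
by rewrite e2 mulnA; lia.
Qed.

Section Init.
Variables (B Sz U s n k : nat) (T : seq nat) (P : seq (option nat)).
Let M := 16 * 32 * ((n + 1) * (n + 1) * ((n + 1) * (n + 1))).
Hypothesis hB : 8 * (M * M) < B.
Hypothesis k2 : 2 < k.
Hypothesis hk : s < 8 * 2 ^ k * (k + 1).
Hypothesis hk1 : forall i, 2 < i < k -> 8 * 2 ^ i * (i + 1) <= s.
Hypothesis hbd : 8 * 2 ^ k * (k + 1) <= M.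
Hypothesis hs : s <= n.
Notation tri := (tri B Sz T P).

Let hM1 : (n + 1) * (n + 1) * ((n + 1) * (n + 1)) <= M.
Proof. by rewrite /M; lia. Qed.
Let hM2 : (n + 1) * (n + 1) <= (n + 1) * (n + 1) * ((n + 1) * (n + 1)).
Proof. by rewrite leq_pmull // muln_gt0 addn1. Qed.
Let hM3 : n + 1 <= (n + 1) * (n + 1).
Proof. by rewrite leq_pmull // addn1. Qed.
Let hMM : M <= M * M.
Proof. by rewrite leq_pmull //; lia. Qed.

Lemma tri_init st : vr st vS = s -> vr st vN = n ->
  tri k initS st (fun st' => [/\ vr st' vB = 2 ^ (k - 3), vr st' vD = 2 ^ k,
    vr st' vW = 4 * 2 ^ (k - 3) & vr st' vM = M]).
Proof.
move=> vs vn.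
have k0 : 0 < k by lia.
have BM : M < B by lia.
have hi i : i < k.+1 -> 8 * 2 ^ i * (i + 1) <= M.
  by move=> h; apply: leq_trans hbd; apply: leq_mul; [rewrite leq_mul2l leq_exp2l //= -ltnS h orbT | lia].
apply: tri_seq; apply: tri_asg => //=.
apply: tri_seq; apply: tri_asg => //=.
set st0 := setv _ _ _.
apply: tri_seq.
apply: (@tri_while _ _ _ _ (fun i st' => vr st' vD = 2 ^ (i + 3) /\ vr st' vK = i + 3) (k - 3) 1) => //.
- by lia.
- move=> i st' hik [hf _] [h1 h2].
  have vs' : vr st' vS = s by rewrite hf.
  have h3 : i + 3 < k by lia.
  have h4 := hi _ (ltnW h3).
  have h6 : 2 < i + 3 < k by lia.
  have h5 := hk1 h6.
  have h7 : 8 * 2 ^ (i + 3) <= 8 * 2 ^ (i + 3) * (i + 3 + 1) by rewrite leq_pmulr //; lia.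
  have h8 : i + 3 + 1 <= 8 * 2 ^ (i + 3) * (i + 3 + 1) by rewrite leq_pmull // muln_gt0 expn_gt0.
  split=> /=.
  + by rewrite h1 h2 vs'; sp; lia.
  + by rewrite h1 h2 vs' eqb0 -leqNgt; lia.
  apply: tri_seq; apply: tri_asg => //=; first by rewrite h1; sp; lia.
  apply: tri_asg => //=; rewrite /upd /= ?h1 ?h2; first by sp; lia.
  by rewrite -expnS addSn addn1.
move=> st1 [hf1 _] [h1 h2].
have vs1 : vr st1 vS = s by rewrite hf1.
have vn1 : vr st1 vN = n by rewrite hf1.
have e3 : k - 3 + 3 = k by lia.
rewrite e3 in h1 h2.
have h7 : 8 * 2 ^ k <= 8 * 2 ^ k * (k + 1) by rewrite leq_pmulr //; lia.
have h8 : k + 1 <= 8 * 2 ^ k * (k + 1) by rewrite leq_pmull // muln_gt0 expn_gt0.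
split=> /=.
- by rewrite h1 h2 vs1; sp; lia.
- by rewrite h1 h2 vs1; lia.
have d8 : 2 ^ k = 8 * 2 ^ (k - 3) by rewrite -(expnD 2 3); congr expn; lia.
apply: tri_seq; apply: tri_asg => //=; rewrite ?h1.
have -> : 2 ^ k %/ 8 = 2 ^ (k - 3) by rewrite d8 mulKn.
apply: tri_seq; apply: tri_asg => //=; rewrite /upd /= ?h1.
have -> : 2 ^ k %/ 2 = 4 * 2 ^ (k - 3) by rewrite d8; lia.
apply: tri_seq; apply: tri_asg => //=; rewrite /upd /= ?vn1; first by sp; lia.
apply: tri_seq; apply: tri_asg => //=; rewrite /upd /=; first by sp; lia.
apply: tri_seq; apply: tri_asg => //=; rewrite /upd /=; first by sp; lia.
apply: tri_asg => //=; rewrite /upd /=; sp; lia.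
Qed.

End Init.

(** One factor [N] comes from the array size and one from [s]; they absorb the two block counts,
    each [N]-fold at most [3 * n]. Hence [9 * n ^ 2], the constant [33 * 64 = 2112], and four
    factors [k + 2], which give [5 ^ 4 = 625] and the fourth power of the logarithm. *)
Lemma time_bound n s k N p lg Sz : 0 < N -> 0 < k -> p <= n -> N <= n -> Sz = 32 * N * k ->
  s <= 64 * N * (k + 1) -> k + 2 <= 5 * lg.+1 ->
  Sz.+1 * k.+2 * k.+2 * ((p + N - 1) %/ N).+1 * ((n - p) %/ N + 1).+1 * s <=
  2112 * 9 * 625 * n ^ 2 * lg.+1 ^ 4.
Proof.
move=> N0 k0 hp hN hSz hs hk.
set a := (p + N - 1) %/ N; set b := (n - p) %/ N + 1.
have ha : N * a.+1 <= 3 * n.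
  by rewrite mulnS mulnC; have := leq_trunc_div (p + N - 1) N; rewrite -/a; lia.
have hb : N * b.+1 <= 3 * n.
  by rewrite /b mulnS mulnDr mulnC; have := leq_trunc_div (n - p) N; lia.
have h1 : Sz.+1 <= 33 * (N * (k + 2)).
  by rewrite hSz; have := leq_pmulr N k0; lia.
have h2 : s <= 64 * (N * (k + 2)) by apply: leq_trans hs _; rewrite -mulnA !leq_mul2l; lia.
apply: (@leq_trans (33 * (N * (k + 2)) * (k + 2) * (k + 2) * a.+1 * b.+1 * (64 * (N * (k + 2))))).
  by do 2!(apply: leq_mul => //); do 2!(apply: leq_mul; last by lia); apply: leq_mul => //; lia.
have -> : 33 * (N * (k + 2)) * (k + 2) * (k + 2) * a.+1 * b.+1 * (64 * (N * (k + 2))) =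
   2112 * ((N * a.+1) * (N * b.+1)) * ((k + 2) ^ 4) by rewrite !expnS expn0; ring.
apply: (@leq_trans (2112 * (3 * n * (3 * n)) * (5 * lg.+1) ^ 4)).
  by apply: leq_mul; [rewrite leq_mul2l leq_mul ?orbT | rewrite leq_exp2r].
by rewrite expnMn !expnS !expn0; apply: eq_leq; ring.
Qed.

(** The left side is [2 ^ 21 * q ^ 8]; as [q >= 2], the power [q ^ 22] dominates the constant,
    whence the exponent 30. *)
Lemma word_bound n w q : 0 < n -> q = n + 1 -> n.+1 ^ 30 <= 2 ^ w ->
  8 * (16 * 32 * (q * q * (q * q)) * (16 * 32 * (q * q * (q * q)))) < 2 ^ w.
Proof.
move=> n0 qE; apply: leq_trans; have -> : n.+1 = q by rewrite qE addn1.
have -> : q ^ 30 = q ^ 22 * q ^ 8 by rewrite -expnD.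
have q1 : 1 < q by rewrite qE; lia.
have h : 2 ^ 22 <= q ^ 22 by rewrite leq_exp2r.
have hq8 : 0 < q ^ 8 by rewrite expn_gt0 ltnW.
apply: leq_trans (leq_mul h (leqnn _)).
have -> : 8 * (16 * 32 * (q * q * (q * q)) * (16 * 32 * (q * q * (q * q)))) = 2 ^ 21 * q ^ 8.
  by rewrite !expnS !expn0; ring.
by rewrite (ltn_pmul2r hq8) ltn_exp2l.
Qed.

(** The constant 96 is [4 * (2 ^ 3 * 3)], the space at the smallest exponent, needed even for
    [s = 1]. The gain is at most [24 * q] and the sum at most [16 * q ^ 3]; their product
    [384 * q ^ 4] stays below [M = 512 * q ^ 4]. *)
Lemma param_bounds n s k N q M : 0 < s <= n -> 2 < k -> k = 3 \/ 4 * (2 ^ k * k) <= s ->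
  N = 2 ^ (k - 3) -> q = n + 1 -> M = 16 * 32 * (q * q * (q * q)) ->
  [/\ 2 ^ k = 8 * N, 4 * (2 ^ k * k) <= 96 * s, N <= n,
    [/\ 1 < M, 4 * (2 ^ k * k) <= M, 8 * (n + N).+1 <= M & 8 * 2 ^ k * (k + 1) <= M] &
    k * 2 ^ k * (N * (4 * N * (4 * N))) < M].
Proof.
move=> /andP[s0 sn] k2 hk2 NE qE ME.
have hD : 2 ^ k = 8 * N by rewrite NE -(expnD 2 3); congr expn; lia.
have hDk : 2 ^ k <= 2 ^ k * k by rewrite leq_pmulr //; lia.
have h96 : 4 * (2 ^ k * k) <= 96 * s.
  case: hk2 => [->|h]; first by rewrite (_ : 4 * (2 ^ 3 * 3) = 96) // leq_pmulr.
  by clear -h s0; lia.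
have hNn : N <= n.
  case: hk2 => [e|h]; first by move: s0 sn; rewrite NE e; apply: leq_trans.
  by clear -h hDk hD sn; lia.
clear NE.
have q1 : 1 < q by lia.
have hqq : q <= q * q * (q * q) by rewrite -!mulnA leq_pmulr // !muln_gt0; lia.
have hMq : 512 * q <= M by rewrite ME; clear -hqq; lia.
have h2k : 2 ^ k * 1 <= 2 ^ k * k by rewrite muln1.
split=> //.
  split; [lia|lia|lia|].
  have h : 8 * 2 ^ k * (k + 1) <= 8 * 2 ^ k * (2 * k) by rewrite leq_mul2l; lia.
  apply: leq_trans h _; clear -h96 sn hMq qE; lia.
have h1 : k * 2 ^ k <= 24 * q by rewrite mulnC; clear -h96 sn qE; lia.
have hNq : N <= q by lia.
have h2 : N * (4 * N * (4 * N)) <= q * (4 * q * (4 * q)) by rewrite !leq_mul.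
apply: leq_ltn_trans (leq_mul h1 h2) _.
have -> : 24 * q * (q * (4 * q * (4 * q))) = 384 * (q * q * (q * q)) by ring.
by rewrite ME ltn_pmul2r // !muln_gt0; clear -q1; lia.
Qed.

(* One fixed program works for all n, s: time t with t * s <= c * n^2 * log^k n
   (i.e. t = O~(n^2/s)) and working space at most c * s words, on a word RAM
   with word size w >= d * log n (w = Theta(log n) allowed), characters fitting
   in a word. *)
Theorem theorem3 :
  exists (prog : seq instr) (c k d : nat),
  forall (n s w : nat) (T : seq nat) (P : seq (option nat)),
    size T = n -> size P <= n -> 1 <= s <= n ->
    n.+1 ^ d <= 2 ^ w ->
    all (fun ch => ch < 2 ^ w) T ->
    all (fun p => if p is Some ch then ch < 2 ^ w else true) P ->
    exists t, t * s <= c * n ^ 2 * (trunc_log 2 n).+1 ^ k /\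
              solves_within prog w s T P t (c * s).
Proof.
(* [K] and [C] are made abstract so that no conversion computes the size of the program or the
   product of the constants. *)
have [K hK] : exists K, K = csize wildS by exists (csize wildS).
have [C hC] : exists C, C = 2112 * 9 * 625 by exists (2112 * 9 * 625).
(* 832 is [HB + NQ * 96], each array having at most [96 * s] cells; 4 and 30 come from [time_bound]
   and [word_bound]. *)
exists (cstmt 0 wildS ++ [:: IHalt]), (K * C + 832), 4, 30.
move=> n s w T P hT hP hsn hw _ _; have /andP[s0 sn] := hsn.
have [k [k2 hks hk1 hk2]] := block_exponent_ex s.
have [N NE] : exists N, N = 2 ^ (k - 3) by exists (2 ^ (k - 3)).
have [q qE] : exists q, q = n + 1 by exists (n + 1).
have hB := word_bound (leq_trans s0 sn) qE hw; clear hw.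
have [M ME] : exists M, M = 16 * 32 * (q * q * (q * q)) by exists (16 * 32 * (q * q * (q * q))).
rewrite -ME in hB.
have [hD hSz96 hNn [M1 hSM hn hbd] hMb] := param_bounds hsn k2 hk2 NE qE ME.
have N0 : 0 < N by rewrite NE expn_gt0.
have kk : 0 < k by exact: leq_trans k2.
have [Sz SzE] : exists Sz, Sz = 4 * (2 ^ k * k) by exists (4 * (2 ^ k * k)).
rewrite -SzE in hSz96 hSM.
have hS0 : 4 * (2 ^ k * k) <= Sz by rewrite SzE.
have Sz0 : 0 < Sz by rewrite SzE !muln_gt0 expn_gt0.
have kSz : k <= Sz by rewrite SzE mulnA leq_pmull // muln_gt0 expn_gt0.
have hM2 : 1 < M <= M by rewrite M1 leqnn.
have hPT : size P <= size T by rewrite hT.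
rewrite -hT in hn.
pose st0 := St (Defs.mem (init_config s T P)) (fun _ _ => 0).
have [t [st' [hx ht hout]]] : tri (2 ^ w) Sz T P
    (Sz.+1 * k.+2 * k.+2 * ((size P + N - 1) %/ N).+1 * ((size T - size P) %/ N + 1).+1) wildS st0
    (fun st' => correct_output T P (vr st' 0)).
  have hB' := hB; have hbd' := hbd; rewrite ME qE in hB' hbd'.
  apply: tri_seq; apply: tri_imp (@tri_init (2 ^ w) Sz s n k T P hB' k2 hks hk1 hbd' sn st0 erefl hT) _ _.
    rewrite -!mulnA; apply: leq_trans (leq_pmulr _ _) => //.
    exact: leq_trans kSz (leqnSn _).
  move=> st1 [hf _] [v1 v2 v3 v4].
  rewrite -NE in v1 v3; rewrite -qE -ME in v4.
  have he : env M k N T P st1 by split=> //; rewrite !hf.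
  (* [M] itself serves as the bound [U] on indices and cells. *)
  apply: tri_seq; apply: tri_imp (@tri_main (2 ^ w) Sz M M k N T P hB hSM hM2 N0 (ltnW k2) hD hS0 hMb hn hPT st1 he) (leqnn _) _.
  by move=> st2 _ hres; apply: tri_asg.
exists t; split.
  rewrite -hK hT in ht.
  have hlg : k + 2 <= 5 * (trunc_log 2 n).+1.
    case: hk2 => [->|h]; first by rewrite leq_pmulr.
    have hkl : k <= trunc_log 2 n.
      apply: trunc_log_max => //; apply: leq_trans sn; apply: leq_trans h.
      by rewrite mulnCA leq_pmulr // muln_gt0.
    by clear -hkl; lia.
  have hsz2 : Sz = 32 * N * k by rewrite SzE hD !mulnA.
  have hs2 : s <= 64 * N * (k + 1) by rewrite ltnW //; rewrite hD mulnA in hks.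
  have tb := time_bound N0 kk hP hNn hsz2 hs2 hlg; rewrite -hC in tb.
  apply: (@leq_trans (K * (C * n ^ 2 * (trunc_log 2 n).+1 ^ 4))).
    by apply: leq_trans (leq_mul ht (leqnn s)) _; rewrite -mulnA leq_mul2l tb orbT.
  rewrite -[X in _ <= X]mulnA [X in _ <= X]mulnDl -[C * _ * _]mulnA mulnA.
  exact: leq_addr.
have hS : HB + NQ * Sz <= (K * C + 832) * s.
  apply: (@leq_trans (832 * s)); last by rewrite leq_mul2r leq_addl orbT.
  rewrite /HB /NQ; clear -hSz96 s0; lia.
have hBB : HB + NQ * Sz <= 2 ^ w.
  have M2 : 2 * M <= M * M by rewrite leq_mul2r M1 orbT.
  have M3 : 8 <= M by rewrite ME; apply: leq_trans (leq_pmulr _ _) => //; rewrite !muln_gt0 qE addn1.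
  rewrite /HB /NQ; clear -hB hSM M2 M3; lia.
have hwf : wfs wildS by vm_compute.
have hcode : codeat (cstmt 0 wildS ++ [:: IHalt]) 0 (cstmt 0 wildS).
  by move=> i hi; rewrite /fetch nth_cat add0n hi.
have hrel : memrel st0 (Defs.mem (init_config s T P)).
  split=> // q0 i hq0; rewrite /st0 /=.
  have h x : x < HB -> (NQ * i + (HB + q0) == x) = false.
    by move=> hxB; rewrite gtn_eqF // addnC -addnA (leq_trans hxB) // leq_addr.
  by rewrite !h.
have [m' [[hrun hstep] [hm' _]]] := cstmt_steps hS hBB Sz0 hx hwf hcode hrel.
split; last split; last split.
- by rewrite hrun /halted /fetch nth_cat size_cstmt ltnn subnn.
- by move=> t' /hstep[].
- by move=> t' /hstep[].
- by rewrite hrun /= hm'.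
Qed.
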